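(* Let $f$, $\beta\in(0,1/2)$, and the objects in the context be given, let $\kappa=\sqrt{1-2\beta}$, $d_\pm=\tilde f_1(\pm\kappa)$, $\Gamma=\frac{\gamma^2(0,\beta)}{\kappa}(|d_+|^2+|d_-|^2)$ and $W(z)=\frac{i}{z-i\Gamma/2}$. Assume $\Gamma\neq0$. Let $\delta_0(\varepsilon)>0$ satisfy $\varepsilon\delta_0(\varepsilon)^2\to0$ as $\varepsilon\to0$, let $\delta\in(-\delta_0(\varepsilon),\delta_0(\varepsilon))$, set $\nu=\operatorname{Re}\nu_0(\varepsilon,\beta)+\delta$ (assumed $>0$) and $\mu=\varepsilon\nu$. Then, as $\varepsilon\to0$, $$\mathcal R=W\Big(\frac\delta\varepsilon\Big)\Big(\frac{\gamma^2(0,\beta)}{\kappa}\overline{d_+}\,d_-+\delta\,\overline{\tilde f_0(2\kappa)}\frac{\gamma(0,\beta)}{\kappa}+O(\varepsilon+\varepsilon\delta^2)\Big),$$ $$\mathcal T=W\Big(\frac\delta\varepsilon\Big)\Big(\frac{\delta}{i\varepsilon}+\frac{\gamma^2(0,\beta)}{2\kappa}(|d_+|^2-|d_-|^2)+\delta\,\tilde f_0(0)\frac{\gamma(0,\beta)}{\kappa}+O(\varepsilon+\varepsilon\delta^2)\Big).$$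
   Context: Let $f:\mathbb R^2\to\mathbb R$ be smooth, $2\pi$-periodic in $y$, vanishing for $|x|>R$. Let $0<\beta<1/2$, $\varepsilon>0$ small, $\mu$ small. Notation: $f_j(x)=\int_0^{2\pi}e^{-ijy}f(x,y)dy$, $\tilde f_j(\xi)=\int e^{-i\xi x}f_j(x)dx$; $k_0=(1-2\beta-\mu^2)^{1/2}$; $k_m=((\beta+m)^2-(1-\beta)^2+\mu^2)^{1/2}$ for $m\ne0,-1$; kernels $H_0=\frac{i}{2k_0}e^{ik_0|x|}$, $H_{-1}=\frac1{2\mu}(e^{-\mu|x|}-1)$, $H_m=\frac1{2k_m}e^{-k_m|x|}$; $\gamma(\mu,\beta)=\frac1{4\pi}((1-\beta)^2-\mu^2)$; $(\hat T\mathbf A)_m=2\gamma\sum_n(H_n\ast A_n)f_{m-n}$ on sequences $\mathbf A=(A_n)_{n\in\mathbb Z}$ of continuous functions supported in $[-R,R]$ (with $(H\ast A)(x)=\int H(x-\xi)A(\xi)d\xi$); $(\mathbf g^{(1)})_m=e^{ik_0x}f_m$, $(\mathbf g^{(2)})_m=f_{m+1}$; $\langle h\rangle=\int_{\mathbb R}h\,dx$; $F=\langle((1-\varepsilon\hat T)^{-1}\mathbf g^{(2)})_{-1}\rangle$, $Q=\langle((1-\varepsilon\hat T)^{-1}\mathbf g^{(1)})_{-1}\rangle$, $P^\pm=\langle((1-\varepsilon\hat T)^{-1}\mathbf g^{(1)})_0e^{\pm ik_0x}\rangle$, $R^\pm=\langle((1-\varepsilon\hat T)^{-1}\mathbf g^{(2)})_0e^{\pm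 ik_0x}\rangle$, all functions of $(\varepsilon,\mu,\beta)$ analytic for small $\varepsilon,\mu$. The reflection and transmission coefficients of the scattering problem for $-\nabla^2\Psi=\omega^2(1+\varepsilon f)\Psi$, $\omega^2=(1-\beta)^2-\mu^2$, with $\beta$-quasiperiodicity in $y$ and incident wave $e^{i\beta y+ik_0x}$ are $\mathcal R=\frac{i\varepsilon\gamma}{k_0}\frac{(\mu-\varepsilon\gamma F)P^++\varepsilon\gamma QR^+}{\mu-\varepsilon\gamma F}$, $\mathcal T=1+\frac{i\varepsilon\gamma}{k_0}\frac{(\mu-\varepsilon\gamma F)P^-+\varepsilon\gamma QR^-}{\mu-\varepsilon\gamma F}$. $\nu_0(\varepsilon,\beta)=\mu_0(\varepsilon,\beta)/\varepsilon$, where $\mu_0$ is the root of $\mu-\varepsilon\gamma(\mu,\beta)F(\varepsilon,\mu,\beta)=0$ tending to $0$ as $\varepsilon\to0$ (equivalently $\nu_0$ is the root of $\nu-\gamma(\varepsilon\nu,\beta)F(\varepsilon,\varepsilon\nu,\beta)=0$). *)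

(* Defs.v *)
From Stdlib Require Import Reals ZArith ClassicalEpsilon.
From Coquelicot Require Import Coquelicot.
Open Scope R_scope.

Definition Cexp (z : C) : C :=
  (exp (Re z) * cos (Im z), exp (Re z) * sin (Im z)).

(* principal square root (branch cut on the negative real axis) *)
Definition Csqrt (z : C) : C :=
  (sqrt ((Cmod z + Re z) / 2),
   (if Rlt_dec (Im z) 0 then -1 else 1) * sqrt ((Cmod z - Re z) / 2)).

Definition CInt (g : R -> C) (a b : R) : C :=
  (RInt (fun t => Re (g t)) a b, RInt (fun t => Im (g t)) a b).

Definition Zsum (a : Z -> C) : C :=
  (Series (fun k => Re (a (Z.of_nat k))) + Series (fun k => Re (a (- Z.of_nat (S k))%Z)),
   Series (fun k => Im (a (Z.of_nat k))) + Series (fun k => Im (a (- Z.of_nat (S k))%Z))).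

Definition partial (b : bool) (g : R -> R -> R) : R -> R -> R :=
  fun x y => if b then Derive (fun t => g t y) x else Derive (fun t => g x t) y.

Fixpoint pderiv (l : list bool) (g : R -> R -> R) : R -> R -> R :=
  match l with nil => g | cons b l' => partial b (pderiv l' g) end.

Definition smooth2 (g : R -> R -> R) : Prop :=
  forall l : list bool,
    (forall x y, continuous (fun p : R * R => pderiv l g (fst p) (snd p)) (x, y)) /\
    (forall x y, ex_derive (fun t => pderiv l g t y) x) /\
    (forall x y, ex_derive (fun t => pderiv l g x t) y).

Open Scope C_scope.

Section Objects.
Variables (f : R -> R -> R) (Rs : R).  (* f vanishes for |x| > Rs *)

Definition fcoef (j : Z) (x : R) : C :=
  CInt (fun y => Cexp (0%R, (- IZR j * y)%R) * RtoC (f x y)) 0 (2 * PI).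

(* tilde f_j(xi) = int_R e^{-i xi x} f_j(x) dx  (f_j vanishes outside [-Rs,Rs]) *)
Definition ftilde (j : Z) (xi : R) : C :=
  CInt (fun x => Cexp (0%R, (- xi * x)%R) * fcoef j x) (- Rs) Rs.

Definition k0 (mu : C) (beta : R) : C := Csqrt (RtoC (1 - 2 * beta) - mu * mu).
Definition km (mu : C) (beta : R) (m : Z) : C :=
  Csqrt (RtoC ((beta + IZR m) ^ 2 - (1 - beta) ^ 2) + mu * mu).

Definition Hker (mu : C) (beta : R) (n : Z) (x : R) : C :=
  if Z.eq_dec n 0 then Ci / (RtoC 2 * k0 mu beta) * Cexp (Ci * k0 mu beta * RtoC (Rabs x))
  else if Z.eq_dec n (-1) then / (RtoC 2 * mu) * (Cexp (- mu * RtoC (Rabs x)) - RtoC 1)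
  else / (RtoC 2 * km mu beta n) * Cexp (- km mu beta n * RtoC (Rabs x)).

Definition gam (mu : C) (beta : R) : C :=
  RtoC (/ (4 * PI)) * (RtoC ((1 - beta) ^ 2) - mu * mu).

(* (H * A)(x) = int H(x - xi) A(xi) dxi, A supported in [-Rs,Rs] *)
Definition conv (h : R -> C) (A : R -> C) (x : R) : C :=
  CInt (fun xi => h (x - xi)%R * A xi) (- Rs) Rs.

Definition Top (mu : C) (beta : R) (A : Z -> R -> C) (m : Z) (x : R) : C :=
  RtoC 2 * gam mu beta *
  Zsum (fun n => conv (Hker mu beta n) (A n) x * fcoef (m - n) x).

Definition admissible (A : Z -> R -> C) : Prop :=
  (exists M, forall n x, (Cmod (A n x) <= M)%R) /\
  (forall n x, continuous (A n) x) /\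
  (forall n x, (Rs < Rabs x)%R -> A n x = RtoC 0).

Definition solves (eps : R) (mu : C) (beta : R) (g A : Z -> R -> C) : Prop :=
  forall m x, A m x - RtoC eps * Top mu beta A m x = g m x.

Definition resolv (eps : R) (mu : C) (beta : R) (g : Z -> R -> C) : Z -> R -> C :=
  epsilon (inhabits (fun _ _ => RtoC 0))
    (fun A => admissible A /\ solves eps mu beta g A /\
       forall B, admissible B -> solves eps mu beta g B -> forall n x, B n x = A n x).

Definition g1 (mu : C) (beta : R) (m : Z) (x : R) : C :=
  Cexp (Ci * k0 mu beta * RtoC x) * fcoef m x.
Definition g2 (m : Z) (x : R) : C := fcoef (m + 1) x.

(* <h> = int_R h, for h supported in [-Rs,Rs] *)
Definition avg (h : R -> C) : C := CInt h (- Rs) Rs.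

Definition FF eps mu beta := avg (resolv eps mu beta g2 (-1)%Z).
Definition QQ eps mu beta := avg (resolv eps mu beta (g1 mu beta) (-1)%Z).
Definition PP (s : R) eps mu beta :=
  avg (fun x => resolv eps mu beta (g1 mu beta) 0%Z x * Cexp (RtoC s * Ci * k0 mu beta * RtoC x)).
Definition RR (s : R) eps mu beta :=
  avg (fun x => resolv eps mu beta g2 0%Z x * Cexp (RtoC s * Ci * k0 mu beta * RtoC x)).

Definition Refl (eps : R) (mu : C) (beta : R) : C :=
  Ci * RtoC eps * gam mu beta / k0 mu beta *
  (((mu - RtoC eps * gam mu beta * FF eps mu beta) * PP 1 eps mu beta
    + RtoC eps * gam mu beta * QQ eps mu beta * RR 1 eps mu beta)
   / (mu - RtoC eps * gam mu beta * FF eps mu beta)).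

Definition Trans (eps : R) (mu : C) (beta : R) : C :=
  RtoC 1 + Ci * RtoC eps * gam mu beta / k0 mu beta *
  (((mu - RtoC eps * gam mu beta * FF eps mu beta) * PP (-1) eps mu beta
    + RtoC eps * gam mu beta * QQ eps mu beta * RR (-1) eps mu beta)
   / (mu - RtoC eps * gam mu beta * FF eps mu beta)).

End Objects.

Definition Wfun (Gam : R) (z : R) : C := Ci / (RtoC z - Ci * RtoC (Gam / 2)).

(* Main.v *)
(** The resolvent [A = (1 - eps T)^{-1} g] is a Neumann series in the sup norm: the Fourier
    coefficients of [f] are [O(1/(1 + j^2))] and the kernels are bounded, so [T] is bounded on
    bounded sequences.  The kernels are moreover Lipschitz in [mu] uniformly in the mode, hence
    [F] varies with [mu] at rate [O(eps)] only.  At real [mu], all kernels but [H_0] are real and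
    even, so the first-order term of [Im F] comes from [Im H_0 = cos (k x) / (2k)] alone and is a
    sum of two squares; this gives [Im nu0 = eps Gam / 2 + O(eps^2)].  Consequently the
    denominator [(mu - eps gamma F) / eps] equals [Z (1 + O(eps))] with
    [Z = delta - i eps Gam / 2], while [W (delta / eps) = i eps / Z].  Dividing the amplitudes by
    [W] leaves products of quantities known up to [O(eps)], since [mu^2 = O(eps)] when
    [eps delta^2] is bounded. *)

Require Import Defs.
From Stdlib Require Import Reals ZArith Lra Lia Psatz ClassicalEpsilon.
From Coquelicot Require Import Coquelicot.
Open Scope R_scope.

(** * Complex exponential, square root and integrals *)

(** The error has to be relative, uniformly from [delta] = 0 to the largest admissible [delta]:
    W(delta / eps) is of order one at resonance and of order eps / |delta| far from it. So [Y] is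
    compared with [Z] multiplicatively, |Y - Z| <= C eps |Z|. The lower bound |Z| >= eps Gam / 2,
    with Gam > 0, turns the absolute error eps^2 of Im nu0 into such a relative error; Re nu0 needs
    no expansion, because nu is centred there and it cancels. What remains of Y - Z is h(mu0) -
    h(mu) with h = gamma F. Its Lipschitz factor |mu| + |mu0| + eps is merely bounded when [delta]
    is large, which suffices because |mu - mu0| = eps |nu - nu0| already carries an eps.

    The root mu0 is complex, whereas Im F is computed at real mu only. Hence Im h is read off at the
    real point mu = eps and carried over to mu0, both points being O(eps); this takes Lipschitz
    bounds on a complex disc in place of analyticity, and uses the root equation only as the
    fixed-point equation nu0 = h(eps nu0). Since [resolv] is a choice operator, existence and
    uniqueness of the solution precede every estimate. *)

Lemma im_le_Cmod (z : C) : Rabs (Im z) <= Cmod z.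
Proof.
  destruct z as [a b]; eapply Rle_trans; [|apply (Rmax_Cmod (a, b))].
  apply Rmax_r.
Qed.

Lemma Cmod_le_ReIm (z : C) : Cmod z <= Rabs (Re z) + Rabs (Im z).
Proof.
  destruct z as [a b]; replace (a, b) with (RtoC a + Ci * RtoC b)%C.
  - eapply Rle_trans; [apply Cmod_triangle|].
    rewrite Cmod_mult, Cmod_Ci, !Cmod_R; simpl.
    rewrite !Rmult_0_l, !Rmult_0_r, !Rmult_1_l, !Rminus_0_r, !Rplus_0_l, Rplus_0_r; lra.
  - unfold RtoC, Ci, Cplus, Cmult; simpl; f_equal; ring.
Qed.

Lemma C_ext (z w : C) : Re z = Re w -> Im z = Im w -> z = w.
Proof. destruct z, w; simpl; congruence. Qed.

Lemma Re_mult (a b : C) : Re (a * b)%C = Re a * Re b - Im a * Im b.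
Proof. reflexivity. Qed.

Lemma Im_mult (a b : C) : Im (a * b)%C = Re a * Im b + Im a * Re b.
Proof. reflexivity. Qed.

Lemma Cmod_minus_sym (a b : C) : Cmod (a - b)%C = Cmod (b - a)%C.
Proof. rewrite <- Cmod_opp; f_equal; ring. Qed.

Lemma Cmod_triangle_minus (a b : C) : Cmod (a - b)%C <= Cmod a + Cmod b.
Proof. unfold Cminus; rewrite <- (Cmod_opp b); apply Cmod_triangle. Qed.

Lemma Cmod_le_plus (a b : C) : Cmod a <= Cmod b + Cmod (a - b)%C.
Proof.
  replace a with (b + (a - b))%C at 1 by ring; apply Cmod_triangle.
Qed.

Lemma Cmod_mult_le (a b : C) (x y : R) :
  Cmod a <= x -> Cmod b <= y -> Cmod (a * b)%C <= x * y.
Proof.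
  intros; rewrite Cmod_mult; apply Rmult_le_compat; auto using Cmod_ge_0.
Qed.

Lemma Cmod_mult_diff (a a' b b' : C) (x y dx dy : R) :
  Cmod b <= y -> Cmod a' <= x -> Cmod (a - a')%C <= dx -> Cmod (b - b')%C <= dy ->
  Cmod (a * b - a' * b')%C <= dx * y + x * dy.
Proof.
  intros Hb Ha Hx Hy.
  replace (a * b - a' * b')%C with ((a - a') * b + a' * (b - b'))%C by ring.
  eapply Rle_trans; [apply Cmod_triangle|].
  apply Rplus_le_compat; apply Cmod_mult_le; auto.
Qed.

Lemma Cexp_plus (z w : C) : Cexp (z + w)%C = (Cexp z * Cexp w)%C.
Proof.
  destruct z as [a b], w as [c d]; unfold Cexp, Cplus, Cmult; simpl.
  rewrite exp_plus, cos_plus, sin_plus; f_equal; ring.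
Qed.

Lemma Cexp_0 : Cexp (RtoC 0) = RtoC 1.
Proof.
  unfold Cexp, RtoC; simpl; rewrite exp_0, cos_0, sin_0; f_equal; ring.
Qed.

Lemma Cmod_Cexp (z : C) : Cmod (Cexp z) = exp (Re z).
Proof.
  destruct z as [a b]; unfold Cexp, Cmod; simpl.
  replace (exp a * cos b * (exp a * cos b * 1) + exp a * sin b * (exp a * sin b * 1))
    with (exp a * exp a * (Rsqr (sin b) + Rsqr (cos b))) by (unfold Rsqr; ring).
  rewrite sin2_cos2, Rmult_1_r; apply sqrt_square; left; apply exp_pos.
Qed.

Lemma exp_le_mono (x y : R) : x <= y -> exp x <= exp y.
Proof.
  intros [H | ->]; [left; apply exp_increasing; exact H | apply Rle_refl].
Qed.

Lemma Cmod_Cexp_le (z : C) : Cmod (Cexp z) <= exp (Cmod z).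
Proof.
  rewrite Cmod_Cexp; apply exp_le_mono.
  eapply Rle_trans; [apply Rle_abs | apply re_le_Cmod].
Qed.

(** Both signs follow from the tangent inequality 1 + x <= exp x at x = a and x = -a, together with
    exp a exp(-a) = 1. *)
Lemma exp_minus_1_bound (a : R) : Rabs (exp a - 1) <= Rabs a * exp (Rabs a).
Proof.
  pose proof (exp_ineq1_le a) as H1.
  pose proof (exp_ineq1_le (- a)) as H2.
  assert (H3 : exp a * exp (- a) = 1)
    by (rewrite <- exp_plus, Rplus_opp_r; apply exp_0).
  pose proof (exp_pos a); pose proof (exp_pos (- a)).
  unfold Rabs at 2 3; destruct (Rcase_abs a) as [Ha | Ha].
  - rewrite Rabs_left1 by (assert (exp a <= exp 0) by (apply exp_le_mono; lra);
      rewrite exp_0 in *; lra).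
    nra.
  - rewrite Rabs_pos_eq by lra. nra.
Qed.

Lemma sin_abs_le (x : R) : Rabs (sin x) <= Rabs x.
Proof.
  unfold Rabs at 2; destruct (Rcase_abs x) as [Hx | Hx].
  - rewrite <- Rabs_Ropp, <- sin_neg.
    destruct (Rle_dec (- x) PI) as [H | H].
    + rewrite Rabs_pos_eq by (apply sin_ge_0; lra).
      left; apply sin_lt_x; lra.
    + apply Rabs_le; pose proof (SIN_bound (- x)); pose proof PI2_1; lra.
  - destruct (Req_dec x 0) as [-> | H0]; [rewrite sin_0, Rabs_R0; lra|].
    destruct (Rle_dec x PI) as [H | H].
    + rewrite Rabs_pos_eq by (apply sin_ge_0; lra).
      left; apply sin_lt_x; lra.
    + apply Rabs_le; pose proof (SIN_bound x); pose proof PI2_1; lra.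
Qed.

Lemma cos_minus_1_abs_le (x : R) : Rabs (cos x - 1) <= Rabs x.
Proof.
  replace (cos x - 1) with (- 2 * sin (x / 2) * sin (x / 2)).
  - pose proof (sin_abs_le (x / 2)) as H.
    rewrite !Rabs_mult, Rabs_left by lra.
    replace (Rabs (x / 2)) with (Rabs x / 2) in H
      by (unfold Rdiv; rewrite Rabs_mult, (Rabs_pos_eq (/ 2)); lra).
    assert (Rabs (sin (x / 2)) <= 1) by (apply Rabs_le, SIN_bound).
    pose proof (Rabs_pos (sin (x / 2))); nra.
  - replace x with (2 * (x / 2)) at 3 by field.
    rewrite cos_2a_sin; ring.
Qed.

(** The factor 3 counts three pieces, each at most M exp M with M = |z|: exp a - 1 and exp a (cos b
    - 1) in the real part, exp a sin b in the imaginary part. *)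
Lemma Cexp_minus_1_bound (z : C) : Cmod (Cexp z - RtoC 1)%C <= 3 * Cmod z * exp (Cmod z).
Proof.
  destruct z as [a b].
  set (M := Cmod (a, b)).
  assert (Ha : Rabs a <= M) by apply (re_le_Cmod (a, b)).
  assert (Hb : Rabs b <= M) by apply (im_le_Cmod (a, b)).
  assert (HM : 0 <= M) by apply Cmod_ge_0.
  pose proof (exp_minus_1_bound a) as He.
  pose proof (exp_pos M).
  assert (Hea : exp (Rabs a) <= exp M) by (apply exp_le_mono; exact Ha).
  assert (Heb : Rabs (exp a) <= exp M).
  { rewrite Rabs_pos_eq by (left; apply exp_pos). apply exp_le_mono.
    eapply Rle_trans; [apply Rle_abs | exact Ha]. }
  assert (He' : Rabs (exp a - 1) <= M * exp M).
  { eapply Rle_trans; [exact He|].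
    apply Rmult_le_compat; auto using Rabs_pos. left; apply exp_pos. }
  assert (H1 : Rabs (exp a * (cos b - 1)) <= exp M * M).
  { rewrite Rabs_mult; apply Rmult_le_compat; auto using Rabs_pos.
    eapply Rle_trans; [apply cos_minus_1_abs_le | exact Hb]. }
  assert (H2 : Rabs (exp a * sin b) <= exp M * M).
  { rewrite Rabs_mult; apply Rmult_le_compat; auto using Rabs_pos.
    eapply Rle_trans; [apply sin_abs_le | exact Hb]. }
  eapply Rle_trans; [apply Cmod_le_ReIm|].
  unfold Cexp; simpl.
  replace (exp a * cos b + - (1)) with (exp a * (cos b - 1) + (exp a - 1)) by ring.
  replace (exp a * sin b + - 0) with (exp a * sin b) by ring.
  pose proof (Rabs_triang (exp a * (cos b - 1)) (exp a - 1)).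
  lra.
Qed.

Lemma Cexp_diff_bound (z w : C) :
  Cmod (Cexp z - Cexp w)%C <= Cmod (Cexp w) * (3 * Cmod (z - w)%C * exp (Cmod (z - w)%C)).
Proof.
  replace (Cexp z - Cexp w)%C with (Cexp w * (Cexp (z - w) - RtoC 1))%C.
  - apply Cmod_mult_le; [lra | apply Cexp_minus_1_bound].
  - replace z with (w + (z - w))%C at 2 by ring. rewrite Cexp_plus; ring.
Qed.

Lemma Csqrt_sqr (w : C) : (Csqrt w * Csqrt w)%C = w.
Proof.
  destruct w as [a b]; unfold Csqrt; set (m := Cmod (a, b)); simpl.
  assert (Ha : Rabs a <= m) by apply (re_le_Cmod (a, b)).
  apply Rabs_le_between in Ha.
  assert (Hm : m * m = a * a + b * b).
  { unfold m, Cmod; simpl. rewrite sqrt_def; [ring|].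
    pose proof (Rle_0_sqr a); pose proof (Rle_0_sqr b); unfold Rsqr in *; lra. }
  assert (H1 : sqrt ((m + a) / 2) * sqrt ((m + a) / 2) = (m + a) / 2) by (apply sqrt_def; lra).
  assert (H2 : sqrt ((m - a) / 2) * sqrt ((m - a) / 2) = (m - a) / 2) by (apply sqrt_def; lra).
  (* The cross term of the square is |b|; the sign attached to the imaginary part of [Csqrt]
     restores b. *)
  assert (H3 : sqrt ((m + a) / 2) * sqrt ((m - a) / 2) = Rabs b / 2).
  { rewrite <- sqrt_mult by lra.
    replace ((m + a) / 2 * ((m - a) / 2)) with (Rsqr (b / 2)) by (unfold Rsqr; nra).
    rewrite sqrt_Rsqr_abs; unfold Rdiv; rewrite Rabs_mult, (Rabs_pos_eq (/ 2)); lra. }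
  unfold Cmult; simpl.
  destruct (Rlt_dec b 0) as [Hb | Hb].
  - rewrite Rabs_left in H3 by lra. f_equal; nra.
  - rewrite Rabs_pos_eq in H3 by lra. f_equal; nra.
Qed.

Lemma Csqrt_Re_ge (w : C) (s : R) : s <= Re w -> sqrt s <= Re (Csqrt w).
Proof.
  intros H; unfold Csqrt; simpl; apply sqrt_le_1_alt.
  assert (Rabs (Re w) <= Cmod w) by apply re_le_Cmod.
  pose proof (Rle_abs (Re w)); lra.
Qed.

Lemma Csqrt_RtoC (r : R) : 0 <= r -> Csqrt (RtoC r) = RtoC (sqrt r).
Proof.
  intros H; unfold Csqrt. rewrite Cmod_R, Rabs_pos_eq by exact H. unfold RtoC; simpl.
  replace ((r - r) / 2) with 0 by field. rewrite sqrt_0, Rmult_0_r.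
  f_equal; f_equal; field.
Qed.

(** Factor z - w as a difference of squares of the roots: the sum of two principal roots has real
    part at least 2 sqrt s, hence modulus at least that. *)
Lemma Csqrt_lipschitz (z w : C) (s : R) :
  0 < s -> s <= Re z -> s <= Re w ->
  2 * sqrt s * Cmod (Csqrt z - Csqrt w)%C <= Cmod (z - w)%C.
Proof.
  intros Hs Hz Hw.
  replace (z - w)%C with ((Csqrt z + Csqrt w) * (Csqrt z - Csqrt w))%C.
  2:{ rewrite <- (Csqrt_sqr z) at 3. rewrite <- (Csqrt_sqr w) at 3. ring. }
  rewrite Cmod_mult; apply Rmult_le_compat_r; [apply Cmod_ge_0|].
  eapply Rle_trans; [|apply re_le_Cmod].
  eapply Rle_trans; [|apply Rle_abs].
  pose proof (Csqrt_Re_ge z s Hz); pose proof (Csqrt_Re_ge w s Hw).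
  change (Re (Csqrt z + Csqrt w)%C) with (Re (Csqrt z) + Re (Csqrt w)). lra.
Qed.

(** * Complex-valued continuous maps and componentwise integration *)

Lemma continuous_C_pair {T : UniformSpace} (g : T -> C) (x : T) :
  continuous (fun t => Re (g t)) x -> continuous (fun t => Im (g t)) x -> continuous g x.
Proof.
  intros H1 H2.
  apply (continuous_ext (fun t => (Re (g t), Im (g t)))).
  - intros t; destruct (g t); reflexivity.
  - eapply filterlim_filter_le_2;
      [|apply (filterlim_pair (fun t => Re (g t)) (fun t => Im (g t)) H1 H2)].
    intros P [d Hd].
    exists (ball (Re (g x)) d) (ball (Im (g x)) d).
    + apply locally_ball.
    + apply locally_ball.
    + intros u v Hu Hv; apply Hd; split; assumption.
Qed.

Lemma continuous_Re {T : UniformSpace} (g : T -> C) (x : T) : continuous g x -> continuous (fun t => Re (g t)) x.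
Proof. intros H; apply (continuous_comp g fst); [exact H | apply continuous_fst]. Qed.

Lemma continuous_Im {T : UniformSpace} (g : T -> C) (x : T) : continuous g x -> continuous (fun t => Im (g t)) x.
Proof. intros H; apply (continuous_comp g snd); [exact H | apply continuous_snd]. Qed.

Lemma continuous_Cmult {T : UniformSpace} (g h : T -> C) (x : T) :
  continuous g x -> continuous h x -> continuous (fun t => (g t * h t)%C) x.
Proof.
  intros Hg Hh; apply continuous_C_pair; simpl.
  - apply (continuous_minus (fun t => Re (g t) * Re (h t)) (fun t => Im (g t) * Im (h t)));
      apply (continuous_mult (K := R_AbsRing)); auto using continuous_Re, continuous_Im.
  - apply (continuous_plus (fun t => Re (g t) * Im (h t)) (fun t => Im (g t) * Re (h t)));
      apply (continuous_mult (K := R_AbsRing)); auto using continuous_Re, continuous_Im.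
Qed.

Lemma continuous_Cplus {T : UniformSpace} (g h : T -> C) (x : T) :
  continuous g x -> continuous h x -> continuous (fun t => (g t + h t)%C) x.
Proof.
  intros Hg Hh; apply continuous_C_pair; simpl.
  - apply (continuous_plus (fun t => Re (g t)) (fun t => Re (h t)));
      auto using continuous_Re.
  - apply (continuous_plus (fun t => Im (g t)) (fun t => Im (h t)));
      auto using continuous_Im.
Qed.

Lemma continuous_Cminus {T : UniformSpace} (g h : T -> C) (x : T) :
  continuous g x -> continuous h x -> continuous (fun t => (g t - h t)%C) x.
Proof.
  intros Hg Hh; apply continuous_C_pair; simpl.
  - apply (continuous_minus (fun t => Re (g t)) (fun t => Re (h t)));
      auto using continuous_Re.
  - apply (continuous_minus (fun t => Im (g t)) (fun t => Im (h t)));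
      auto using continuous_Im.
Qed.

Lemma continuous_RtoC {T : UniformSpace} (g : T -> R) (x : T) :
  continuous g x -> continuous (fun t => RtoC (g t)) x.
Proof. intros H; apply continuous_C_pair; simpl; [exact H | apply continuous_const]. Qed.

Lemma continuous_Cexp {T : UniformSpace} (g : T -> C) (x : T) :
  continuous g x -> continuous (fun t => Cexp (g t)) x.
Proof.
  intros H.
  pose proof (continuous_Re g x H) as Hr; pose proof (continuous_Im g x H) as Hi.
  assert (He : continuous (fun t => exp (Re (g t))) x)
    by (apply (continuous_comp (fun t => Re (g t)) exp); [exact Hr | apply continuous_exp]).
  apply continuous_C_pair; simpl; apply (continuous_mult (K := R_AbsRing)); auto.
  - apply (continuous_comp (fun t => Im (g t)) cos); [exact Hi | apply continuous_cos].
  - apply (continuous_comp (fun t => Im (g t)) sin); [exact Hi | apply continuous_sin].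
Qed.

Lemma ex_RInt_Re (g : R -> C) (a b : R) :
  (forall x, continuous g x) -> ex_RInt (fun t => Re (g t)) a b.
Proof. intros H; apply (ex_RInt_continuous (V := R_CompleteNormedModule)); intros; apply continuous_Re, H. Qed.

Lemma ex_RInt_Im (g : R -> C) (a b : R) :
  (forall x, continuous g x) -> ex_RInt (fun t => Im (g t)) a b.
Proof. intros H; apply (ex_RInt_continuous (V := R_CompleteNormedModule)); intros; apply continuous_Im, H. Qed.

Lemma CInt_ext (g h : R -> C) (a b : R) :
  (forall x, Rmin a b < x < Rmax a b -> g x = h x) -> CInt g a b = CInt h a b.
Proof.
  intros H; unfold CInt; f_equal; apply RInt_ext; intros x Hx; rewrite (H x Hx); reflexivity.
Qed.

(** The factor 2 is the price of bounding real and imaginary integrals separately. Over [-Rs, Rs] it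
    produces the constant 4 Rs that runs through all later estimates. *)
Lemma CInt_bound (g : R -> C) (a b M : R) :
  a <= b -> (forall x, continuous g x) -> (forall x, a <= x <= b -> Cmod (g x) <= M) ->
  Cmod (CInt g a b) <= 2 * (b - a) * M.
Proof.
  intros Hab Hc HM.
  eapply Rle_trans; [apply Cmod_le_ReIm|]; simpl.
  assert (Rabs (RInt (fun t => Re (g t)) a b) <= (b - a) * M).
  { apply abs_RInt_le_const; [exact Hab | apply ex_RInt_Re, Hc |].
    intros; eapply Rle_trans; [apply re_le_Cmod | apply HM; assumption]. }
  assert (Rabs (RInt (fun t => Im (g t)) a b) <= (b - a) * M).
  { apply abs_RInt_le_const; [exact Hab | apply ex_RInt_Im, Hc |].
    intros; eapply Rle_trans; [apply im_le_Cmod | apply HM; assumption]. }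
  lra.
Qed.

Lemma CInt_minus (g h : R -> C) (a b : R) :
  (forall x, continuous g x) -> (forall x, continuous h x) ->
  CInt (fun t => (g t - h t)%C) a b = (CInt g a b - CInt h a b)%C.
Proof.
  intros Hg Hh; apply C_ext; simpl;
  [exact (RInt_minus (fun t => Re (g t)) (fun t => Re (h t)) a b
           (ex_RInt_Re _ _ _ Hg) (ex_RInt_Re _ _ _ Hh))
  |exact (RInt_minus (fun t => Im (g t)) (fun t => Im (h t)) a b
           (ex_RInt_Im _ _ _ Hg) (ex_RInt_Im _ _ _ Hh))].
Qed.

Lemma CInt_plus (g h : R -> C) (a b : R) :
  (forall x, continuous g x) -> (forall x, continuous h x) ->
  CInt (fun t => (g t + h t)%C) a b = (CInt g a b + CInt h a b)%C.
Proof.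
  intros Hg Hh; apply C_ext; simpl;
  [exact (RInt_plus (fun t => Re (g t)) (fun t => Re (h t)) a b
           (ex_RInt_Re _ _ _ Hg) (ex_RInt_Re _ _ _ Hh))
  |exact (RInt_plus (fun t => Im (g t)) (fun t => Im (h t)) a b
           (ex_RInt_Im _ _ _ Hg) (ex_RInt_Im _ _ _ Hh))].
Qed.

Lemma CInt_scal (c : C) (g : R -> C) (a b : R) :
  (forall x, continuous g x) -> CInt (fun t => (c * g t)%C) a b = (c * CInt g a b)%C.
Proof.
  intros Hg.
  pose proof (ex_RInt_Re g a b Hg) as H1; pose proof (ex_RInt_Im g a b Hg) as H2.
  assert (S : forall u (k : R), ex_RInt u a b -> RInt (fun t => k * u t) a b = k * RInt u a b)
    by (intros u k Hu; exact (RInt_scal (V := R_CompleteNormedModule) u a b k Hu)).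
  assert (E : forall u (k : R), ex_RInt u a b -> ex_RInt (fun t => k * u t) a b)
    by (intros u k Hu; exact (ex_RInt_scal (V := R_CompleteNormedModule) u a b k Hu)).
  apply C_ext; unfold CInt; simpl.
  - etransitivity; [apply (RInt_minus (V := R_CompleteNormedModule)
      (fun t => Re c * Re (g t)) (fun t => Im c * Im (g t))); apply E; assumption|].
    rewrite !S by assumption; reflexivity.
  - etransitivity; [apply (RInt_plus (V := R_CompleteNormedModule)
      (fun t => Re c * Im (g t)) (fun t => Im c * Re (g t))); apply E; assumption|].
    rewrite !S by assumption; reflexivity.
Qed.

Lemma CInt_conj (g : R -> C) (a b : R) :
  (forall x, continuous g x) -> CInt (fun t => Cconj (g t)) a b = Cconj (CInt g a b).
Proof.
  intros Hg; apply C_ext; simpl; [reflexivity|].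
  apply (RInt_opp (V := R_CompleteNormedModule) (fun t => Im (g t)) a b), ex_RInt_Im, Hg.
Qed.

Lemma CInt_diff_bound (g h : R -> C) (a b M : R) :
  a <= b -> (forall x, continuous g x) -> (forall x, continuous h x) ->
  (forall x, a <= x <= b -> Cmod (g x - h x)%C <= M) ->
  Cmod (CInt g a b - CInt h a b)%C <= 2 * (b - a) * M.
Proof.
  intros Hab Hg Hh HM; rewrite <- CInt_minus by assumption.
  apply CInt_bound; [exact Hab | | exact HM].
  intros x; apply continuous_Cminus; auto.
Qed.

(** * Dominated series over the integers *)

Lemma ex_series_dom (a b : nat -> R) :
  (forall k, Rabs (a k) <= b k) -> ex_series b -> ex_series a.
Proof. intros H Hb; apply (ex_series_le (V := R_CompleteNormedModule) a b H Hb). Qed.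

Lemma Series_abs_le (a b : nat -> R) :
  (forall k, Rabs (a k) <= b k) -> ex_series b -> Rabs (Series a) <= Series b.
Proof.
  intros H Hb.
  eapply Rle_trans.
  - apply Series_Rabs, (ex_series_dom _ b); [|exact Hb].
    intros k; rewrite Rabs_Rabsolu; apply H.
  - apply Series_le; [|exact Hb]. intros k; split; [apply Rabs_pos | apply H].
Qed.

(** The right side does not depend on the terms [a], so it gives uniform convergence of function
    series as well as the remainder of the Picard iteration. *)
Lemma Series_tail_bound (a b : nat -> R) (N : nat) :
  (forall k, Rabs (a k) <= b k) -> ex_series b ->
  Rabs (Series a - sum_n a N) <= Series b - sum_n b N.
Proof.
  intros H Hb.
  assert (Ha : ex_series a) by (apply (ex_series_dom a b); assumption).
  rewrite (Series_incr_n a (S N)) by (auto with arith).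
  rewrite (Series_incr_n b (S N)) by (auto with arith).
  simpl pred. rewrite <- !sum_n_Reals.
  replace (sum_n a N + Series (fun k => a (S N + k)%nat) - sum_n a N)
    with (Series (fun k => a (S N + k)%nat)) by ring.
  replace (sum_n b N + Series (fun k => b (S N + k)%nat) - sum_n b N)
    with (Series (fun k => b (S N + k)%nat)) by ring.
  apply Series_abs_le; [intros; apply H|].
  apply (ex_series_incr_n b (S N)), Hb.
Qed.

(** The Weierstrass test, phrased as a limit in the uniform space of functions because the exchange
    theorems for limits and for integrals expect that form. *)
Lemma sum_n_cvu (u : nat -> R -> R) (b : nat -> R) :
  (forall k x, Rabs (u k x) <= b k) -> ex_series b ->
  filterlim (fun N x => sum_n (fun k => u k x) N) eventually
    (locally (T := fct_UniformSpace R R_UniformSpace) (fun x => Series (fun k => u k x))).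
Proof.
  intros H Hb.
  apply (proj2 (filterlim_locally (U := fct_UniformSpace R R_UniformSpace)
    (F := eventually) _ _)); intros e.
  pose proof (Series_correct b Hb) as Hs.
  assert (Hl : eventually (fun N => ball (Series b) e (sum_n b N)))
    by (apply Hs, locally_ball).
  revert Hl; apply filter_imp; intros N HN x.
  pose proof (Series_tail_bound (fun k => u k x) b N (fun k => H k x) Hb) as T.
  change (Rabs (sum_n (fun k => u k x) N - Series (fun k => u k x)) < e).
  change (Rabs (sum_n b N - Series b) < e) in HN.
  rewrite Rabs_minus_sym. rewrite Rabs_minus_sym in HN.
  eapply Rle_lt_trans; [exact T|]. eapply Rle_lt_trans; [apply Rle_abs | exact HN].
Qed.

Lemma continuous_sum_n (u : nat -> R -> R) (x : R) (N : nat) :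
  (forall k, continuous (u k) x) -> continuous (fun y => sum_n (fun k => u k y) N) x.
Proof.
  intros H; induction N as [|N IH].
  - apply (continuous_ext (u O)); [intros y; rewrite sum_O; reflexivity | apply H].
  - apply (continuous_ext (fun y => sum_n (fun k => u k y) N + u (S N) y)).
    + intros y; rewrite sum_Sn; reflexivity.
    + apply (continuous_plus (V := R_NormedModule)); [exact IH | apply H].
Qed.

Lemma continuous_Series (u : nat -> R -> R) (b : nat -> R) (x : R) :
  (forall k y, Rabs (u k y) <= b k) -> ex_series b -> (forall k, continuous (u k) x) ->
  continuous (fun y => Series (fun k => u k y)) x.
Proof.
  intros H Hb Hc.
  refine (filterlim_switch_1 (U := R_UniformSpace) eventually _ (locally x) _
    (fun N y => sum_n (fun k => u k y) N) (fun y => Series (fun k => u k y))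
    (fun N => sum_n (fun k => u k x) N) _ (sum_n_cvu u b H Hb) _ _).
  - intros N; apply continuous_sum_n, Hc.
  - apply Series_correct, (ex_series_dom _ b); [intros; apply H | exact Hb].
Qed.

Lemma is_RInt_sum_n (u : nat -> R -> R) (a b : R) (N : nat) :
  (forall k, ex_RInt (u k) a b) ->
  is_RInt (fun y => sum_n (fun k => u k y) N) a b (sum_n (fun k => RInt (u k) a b) N).
Proof.
  intros H; induction N as [|N IH].
  - apply (is_RInt_ext (u O)); [intros y _; rewrite sum_O; reflexivity|].
    rewrite sum_O; apply (RInt_correct (V := R_CompleteNormedModule)), H.
  - apply (is_RInt_ext (fun y => plus (sum_n (fun k => u k y) N) (u (S N) y))).
    + intros y _; rewrite sum_Sn; reflexivity.
    + rewrite sum_Sn. apply (is_RInt_plus (V := R_NormedModule)); [exact IH|].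
      apply (RInt_correct (V := R_CompleteNormedModule)), H.
Qed.

Lemma RInt_Series (u : nat -> R -> R) (c : nat -> R) (a b : R) :
  (forall k y, Rabs (u k y) <= c k) -> ex_series c -> (forall k y, continuous (u k) y) ->
  RInt (fun y => Series (fun k => u k y)) a b = Series (fun k => RInt (u k) a b).
Proof.
  intros H Hc Hu.
  destruct (filterlim_RInt (V := R_CompleteNormedModule)
    (fun N y => sum_n (fun k => u k y) N) a b eventually _
    (fun y => Series (fun k => u k y)) (sum_n (fun k => RInt (u k) a b)))
    as [l [Hl1 Hl2]].
  - intros N; apply is_RInt_sum_n; intros k.
    apply (ex_RInt_continuous (V := R_CompleteNormedModule)); intros; apply Hu.
  - apply (sum_n_cvu u c H Hc).
  - rewrite (is_RInt_unique _ _ _ _ Hl2). symmetry; apply is_series_unique, Hl1.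
Qed.

(** * A summable weight on the integers and dominated two-sided sums *)

Definition wgt (j : Z) : R := / (1 + IZR j ^ 2).

Lemma wgt_pos (j : Z) : 0 < wgt j.
Proof. apply Rinv_0_lt_compat; pose proof (pow2_ge_0 (IZR j)); lra. Qed.

(* [3 atan] is a bounded discrete primitive dominating [wgt]. *)
Lemma wgt_telescope (j : Z) : wgt j <= 3 * atan (IZR (j + 1)) - 3 * atan (IZR j).
Proof.
  destruct (MVT_gen atan (IZR j) (IZR (j + 1)) (fun x => / (1 + x ^ 2))) as [c [Hc Heq]].
  - intros x _. apply is_derive_Reals.
    apply derivable_pt_lim_atan.
  - intros x _. apply derivable_continuous_pt, derivable_pt_atan.
  - rewrite plus_IZR in *. rewrite Rmin_left, Rmax_right in Hc by lra.
    replace (3 * atan (IZR j + 1) - 3 * atan (IZR j)) with (3 * / (1 + c ^ 2)) by lra.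
    unfold wgt. set (y := IZR j) in *.
    pose proof (pow2_ge_0 c); pose proof (pow2_ge_0 y).
    replace (/ (1 + y ^ 2)) with (3 * / (3 * (1 + y ^ 2))) by (field; apply Rgt_not_eq; lra).
    apply Rmult_le_compat_l; [lra|]. apply Rinv_le_contravar; [lra|].
    assert ((c - y) * (c - y) <= 1) by (apply Rle_trans with (1 * 1); [apply Rmult_le_compat|]; lra).
    (* The mean value point c is within 1 of y; with this square it follows that c^2 <= 2 + 2 y^2,
       so 1 + c^2 <= 3 (1 + y^2). This is where the factor 3 is spent. *)
    pose proof (pow2_ge_0 (c - 2 * y)). nra.
Qed.

(** Sums along an increasing or a decreasing run of integers telescope to three times a difference
    of two arctangents, which is below 3 pi wherever the run starts. Independence of the starting
    point is what later makes the bounds uniform in the row m. *)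
Lemma wgt_partial_bound (a : nat -> Z) (s : Z) :
  (s = 1 \/ s = -1)%Z -> (forall k, a (S k) = a k + s)%Z ->
  forall N, sum_n (fun k => wgt (a k)) N <= 3 * PI.
Proof.
  intros Hs Ha N.
  pose proof (fun j => atan_bound (IZR j)) as B.
  assert (G : sum_n (fun k => wgt (a k)) N <=
    if Z.eq_dec s 1 then 3 * atan (IZR (a N + 1)) - 3 * atan (IZR (a O))
    else 3 * atan (IZR (a O + 1)) - 3 * atan (IZR (a N))).
  { induction N as [|N IH].
    - rewrite sum_O; destruct (Z.eq_dec s 1); apply wgt_telescope.
    - rewrite sum_Sn; unfold plus; simpl.
      pose proof (wgt_telescope (a (S N))) as T.
      rewrite Ha in T |- *. destruct (Z.eq_dec s 1) as [-> | Hn].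
      + lra.
      + destruct Hs as [Hs | ->]; [contradiction|].
        replace (a N + -1 + 1)%Z with (a N) in T by ring. lra. }
  destruct (Z.eq_dec s 1).
  - pose proof (B (a N + 1)%Z); pose proof (B (a O)); lra.
  - pose proof (B (a O + 1)%Z); pose proof (B (a N)); lra.
Qed.

Lemma wgt_series (a : nat -> Z) (s : Z) :
  (s = 1 \/ s = -1)%Z -> (forall k, a (S k) = a k + s)%Z ->
  ex_series (fun k => wgt (a k)) /\ Series (fun k => wgt (a k)) <= 3 * PI.
Proof.
  intros Hs Ha. pose proof (wgt_partial_bound a s Hs Ha) as B.
  assert (Hinc : forall n, sum_n (fun k => wgt (a k)) n <= sum_n (fun k => wgt (a k)) (S n)).
  { intros n; rewrite sum_Sn; unfold plus; simpl. pose proof (wgt_pos (a (S n))); lra. }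
  destruct (ex_finite_lim_seq_incr _ _ Hinc B) as [l Hl].
  assert (E : is_series (fun k => wgt (a k)) l) by exact Hl.
  split; [exists l; exact E|].
  rewrite (is_series_unique _ _ E).
  apply (is_lim_seq_le _ (fun _ => 3 * PI) l (3 * PI) B Hl (is_lim_seq_const _)).
Qed.

Lemma wgt_series_down (m : Z) :
  ex_series (fun k => wgt (m - Z.of_nat k)) /\ Series (fun k => wgt (m - Z.of_nat k)) <= 3 * PI.
Proof. apply (wgt_series (fun k => m - Z.of_nat k)%Z (-1)); [auto | intros; lia]. Qed.

Lemma wgt_series_up (m : Z) :
  ex_series (fun k => wgt (m - - Z.of_nat (S k))) /\
  Series (fun k => wgt (m - - Z.of_nat (S k))) <= 3 * PI.
Proof. apply (wgt_series (fun k => m - - Z.of_nat (S k))%Z 1); [auto | intros; lia]. Qed.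

(** The shift by m matches row m of the operator, whose n-th term carries the Fourier coefficient of
    index m - n. *)
Definition dominated (m : Z) (K : R) (a : Z -> C) : Prop :=
  forall n, Cmod (a n) <= K * wgt (m - n).

Section Dominated.
Variables (m : Z) (K : R).

Lemma ex_dom_down : ex_series (fun k => K * wgt (m - Z.of_nat k)).
Proof. apply (ex_series_scal (V := R_NormedModule) K), wgt_series_down. Qed.

Lemma ex_dom_up : ex_series (fun k => K * wgt (m - - Z.of_nat (S k))).
Proof. apply (ex_series_scal (V := R_NormedModule) K), wgt_series_up. Qed.

Lemma dominated_K_pos (a : Z -> C) : dominated m K a -> 0 <= K.
Proof.
  intros H; specialize (H m). pose proof (Cmod_ge_0 (a m)). pose proof (wgt_pos (m - m)). nra.
Qed.

Lemma dom_Re (a : Z -> C) (n : Z) : dominated m K a -> Rabs (Re (a n)) <= K * wgt (m - n).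
Proof. intros H; eapply Rle_trans; [apply re_le_Cmod | apply H]. Qed.

Lemma dom_Im (a : Z -> C) (n : Z) : dominated m K a -> Rabs (Im (a n)) <= K * wgt (m - n).
Proof. intros H; eapply Rle_trans; [apply im_le_Cmod | apply H]. Qed.

(** 12 pi = 4 times 3 pi: real and imaginary parts, each over two half-lines. *)
Lemma Zsum_bound (a : Z -> C) : dominated m K a -> Cmod (Zsum a) <= 12 * PI * K.
Proof.
  intros H. pose proof (dominated_K_pos a H) as HK.
  eapply Rle_trans; [apply Cmod_le_ReIm|]; unfold Zsum, Re, Im; cbn [fst snd].
  destruct (wgt_series_down m) as [E1 B1]; destruct (wgt_series_up m) as [E2 B2].
  assert (D1 := ex_dom_down); assert (D2 := ex_dom_up).
  assert (S1 : Series (fun k => K * wgt (m - Z.of_nat k)) <= K * (3 * PI))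
    by (rewrite Series_scal_l; apply Rmult_le_compat_l; assumption).
  assert (S2 : Series (fun k => K * wgt (m - - Z.of_nat (S k))) <= K * (3 * PI))
    by (rewrite Series_scal_l; apply Rmult_le_compat_l; assumption).
  pose proof (Series_abs_le (fun k => Re (a (Z.of_nat k))) _ (fun k => dom_Re a _ H) D1).
  pose proof (Series_abs_le (fun k => Re (a (- Z.of_nat (S k))%Z)) _ (fun k => dom_Re a _ H) D2).
  pose proof (Series_abs_le (fun k => Im (a (Z.of_nat k))) _ (fun k => dom_Im a _ H) D1).
  pose proof (Series_abs_le (fun k => Im (a (- Z.of_nat (S k))%Z)) _ (fun k => dom_Im a _ H) D2).
  match goal with |- Rabs (?a + ?b) + Rabs (?c + ?d) <= _ =>
    pose proof (Rabs_triang a b); pose proof (Rabs_triang c d) end.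
  unfold Re, Im in *; lra.
Qed.

(** [Series] is total and additive only on convergent series; the two dominations supply convergence
    of all eight half-series. The constants may differ, since only convergence is used. *)
Lemma Zsum_minus (a b : Z -> C) (K' : R) : dominated m K a -> dominated m K' b ->
  Zsum (fun n => a n - b n)%C = (Zsum a - Zsum b)%C.
Proof.
  intros Ha Hb.
  assert (P : forall (K0 : R) (u : nat -> R) (g : nat -> Z),
    (forall k, Rabs (u k) <= K0 * wgt (m - g k)) ->
    ex_series (fun k => wgt (m - g k)) -> ex_series u).
  { intros K0 u g Hu Hg; apply (ex_series_dom u _ Hu).
    apply (ex_series_scal (V := R_NormedModule) K0), Hg. }
  pose proof (proj1 (wgt_series_down m)) as W1; pose proof (proj1 (wgt_series_up m)) as W2.
  assert (B : forall (K0 : R) (c : Z -> C), dominated m K0 c ->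
     ex_series (fun k => Re (c (Z.of_nat k))) /\ ex_series (fun k => Im (c (Z.of_nat k))) /\
     ex_series (fun k => Re (c (- Z.of_nat (S k))%Z)) /\
     ex_series (fun k => Im (c (- Z.of_nat (S k))%Z))).
  { intros K0 c Hc; repeat split.
    - apply (P K0 _ Z.of_nat); [intros k; eapply Rle_trans; [apply re_le_Cmod | apply Hc] | exact W1].
    - apply (P K0 _ Z.of_nat); [intros k; eapply Rle_trans; [apply im_le_Cmod | apply Hc] | exact W1].
    - apply (P K0 _ (fun k => - Z.of_nat (S k))%Z);
        [intros k; eapply Rle_trans; [apply re_le_Cmod | apply Hc] | exact W2].
    - apply (P K0 _ (fun k => - Z.of_nat (S k))%Z);
        [intros k; eapply Rle_trans; [apply im_le_Cmod | apply Hc] | exact W2]. }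
  destruct (B K a Ha) as [a1 [a2 [a3 a4]]]. destruct (B K' b Hb) as [b1 [b2 [b3 b4]]].
  apply C_ext; unfold Zsum.
  - etransitivity; [exact (f_equal2 Rplus (Series_minus _ _ a1 b1) (Series_minus _ _ a3 b3))|].
    unfold Cminus, Cplus, Copp, Re; cbn [fst snd]; ring.
  - etransitivity; [exact (f_equal2 Rplus (Series_minus _ _ a2 b2) (Series_minus _ _ a4 b4))|].
    unfold Cminus, Cplus, Copp, Im; cbn [fst snd]; ring.
Qed.

Variable a : Z -> R -> C.
Hypothesis Ha : forall x, dominated m K (fun n => a n x).
Hypothesis Ca : forall n x, continuous (a n) x.

Lemma continuous_Zsum (x : R) : continuous (fun y => Zsum (fun n => a n y)) x.
Proof.
  assert (D1 := ex_dom_down); assert (D2 := ex_dom_up).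
  apply continuous_C_pair; simpl; apply (continuous_plus (V := R_NormedModule)).
  - apply (continuous_Series (fun k y => Re (a (Z.of_nat k) y)) _ x
      (fun k y => dom_Re _ _ (Ha y)) D1). intros; apply continuous_Re, Ca.
  - apply (continuous_Series (fun k y => Re (a (- Z.of_nat (S k))%Z y)) _ x
      (fun k y => dom_Re _ _ (Ha y)) D2). intros; apply continuous_Re, Ca.
  - apply (continuous_Series (fun k y => Im (a (Z.of_nat k) y)) _ x
      (fun k y => dom_Im _ _ (Ha y)) D1). intros; apply continuous_Im, Ca.
  - apply (continuous_Series (fun k y => Im (a (- Z.of_nat (S k))%Z y)) _ x
      (fun k y => dom_Im _ _ (Ha y)) D2). intros; apply continuous_Im, Ca.
Qed.

Lemma CInt_Zsum (p q : R) :
  CInt (fun x => Zsum (fun n => a n x)) p q = Zsum (fun n => CInt (a n) p q).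
Proof.
  assert (D1 := ex_dom_down); assert (D2 := ex_dom_up).
  assert (X : forall u v : R -> R, (forall x, continuous u x) -> (forall x, continuous v x) ->
    RInt (fun x => u x + v x) p q = RInt u p q + RInt v p q).
  { intros u v Hu Hv. apply (RInt_plus (V := R_CompleteNormedModule));
      apply (ex_RInt_continuous (V := R_CompleteNormedModule)); auto. }
  apply C_ext; unfold CInt, Zsum; simpl Re; simpl Im; rewrite X; try f_equal.
  - apply (RInt_Series (fun k y => Re (a (Z.of_nat k) y)) _ p q
      (fun k y => dom_Re _ _ (Ha y)) D1). intros; apply continuous_Re, Ca.
  - apply (RInt_Series (fun k y => Re (a (- Z.of_nat (S k))%Z y)) _ p q
      (fun k y => dom_Re _ _ (Ha y)) D2). intros; apply continuous_Re, Ca.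
  - intros x. apply (continuous_Series (fun k y => Re (a (Z.of_nat k) y)) _ x
      (fun k y => dom_Re _ _ (Ha y)) D1). intros; apply continuous_Re, Ca.
  - intros x. apply (continuous_Series (fun k y => Re (a (- Z.of_nat (S k))%Z y)) _ x
      (fun k y => dom_Re _ _ (Ha y)) D2). intros; apply continuous_Re, Ca.
  - apply (RInt_Series (fun k y => Im (a (Z.of_nat k) y)) _ p q
      (fun k y => dom_Im _ _ (Ha y)) D1). intros; apply continuous_Im, Ca.
  - apply (RInt_Series (fun k y => Im (a (- Z.of_nat (S k))%Z y)) _ p q
      (fun k y => dom_Im _ _ (Ha y)) D2). intros; apply continuous_Im, Ca.
  - intros x. apply (continuous_Series (fun k y => Im (a (Z.of_nat k) y)) _ x
      (fun k y => dom_Im _ _ (Ha y)) D1). intros; apply continuous_Im, Ca.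
  - intros x. apply (continuous_Series (fun k y => Im (a (- Z.of_nat (S k))%Z y)) _ x
      (fun k y => dom_Im _ _ (Ha y)) D2). intros; apply continuous_Im, Ca.
Qed.

End Dominated.

(** * Parametric integrals and Fourier coefficients *)

Definition jointly_continuous {U : UniformSpace} (K : R -> R -> U) : Prop :=
  forall x y, continuous (fun p : R * R => K (fst p) (snd p)) (x, y).

Lemma continuous_pair_diag {U V W : UniformSpace} (g : U -> V) (h : U -> W) (x : U) :
  continuous g x -> continuous h x -> continuous (fun t => (g t, h t)) x.
Proof.
  intros H1 H2.
  eapply filterlim_filter_le_2; [|apply (filterlim_pair g h H1 H2)].
  intros P [d Hd].
  exists (ball (g x) d) (ball (h x) d); try apply locally_ball.
  intros u v Hu Hv; apply Hd; split; assumption.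
Qed.

Lemma jc_2d (K : R -> R -> R) (x y : R) :
  jointly_continuous K -> continuity_2d_pt K x y.
Proof. intros H; apply continuity_2d_pt_filterlim, (H x y). Qed.

Lemma jc_swap {U : UniformSpace} (K : R -> R -> U) :
  jointly_continuous K -> jointly_continuous (fun x y => K y x).
Proof.
  intros H x y.
  apply (continuous_comp (fun p : R * R => (snd p, fst p))
    (fun q : R * R => K (fst q) (snd q))).
  - apply continuous_pair_diag; [apply continuous_snd | apply continuous_fst].
  - apply (H y x).
Qed.

Lemma jc_left {U : UniformSpace} (K : R -> R -> U) (x y : R) :
  jointly_continuous K -> continuous (K x) y.
Proof.
  intros H.
  apply (continuous_comp (fun t : R => (x, t)) (fun q : R * R => K (fst q) (snd q))).
  - apply continuous_pair_diag; [apply continuous_const | apply continuous_id].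
  - apply (H x y).
Qed.

Lemma jc_right {U : UniformSpace} (K : R -> R -> U) (x y : R) :
  jointly_continuous K -> continuous (fun t => K t y) x.
Proof. intros H; apply (jc_left (fun a b => K b a) y x), jc_swap, H. Qed.

Lemma jc_fst {U : UniformSpace} (g : R -> U) :
  (forall x, continuous g x) -> jointly_continuous (fun x _ : R => g x).
Proof.
  intros H x y. apply (continuous_comp (fun p : R * R => fst p) g); [apply continuous_fst | apply H].
Qed.

Lemma jc_snd {U : UniformSpace} (g : R -> U) :
  (forall x, continuous g x) -> jointly_continuous (fun _ y : R => g y).
Proof. intros H; apply (jc_swap (fun x _ => g x)), jc_fst, H. Qed.

Lemma jc_diff {U : UniformSpace} (g : R -> U) :
  (forall x, continuous g x) -> jointly_continuous (fun x y : R => g (x - y)).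
Proof.
  intros H x y. apply (continuous_comp (fun p : R * R => fst p - snd p) g); [|apply H].
  apply (continuous_minus (V := R_NormedModule)); [apply continuous_fst | apply continuous_snd].
Qed.

Lemma jc_Rmult (K L : R -> R -> R) : jointly_continuous K -> jointly_continuous L ->
  jointly_continuous (fun x y => K x y * L x y).
Proof. intros HK HL x y; apply (continuous_mult (K := R_AbsRing)); [apply HK | apply HL]. Qed.

Lemma jc_Rplus (K L : R -> R -> R) : jointly_continuous K -> jointly_continuous L ->
  jointly_continuous (fun x y => K x y + L x y).
Proof. intros HK HL x y; apply (continuous_plus (V := R_NormedModule)); [apply HK | apply HL]. Qed.

Lemma jc_Rminus (K L : R -> R -> R) : jointly_continuous K -> jointly_continuous L ->
  jointly_continuous (fun x y => K x y - L x y).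
Proof. intros HK HL x y; apply (continuous_minus (V := R_NormedModule)); [apply HK | apply HL]. Qed.

Lemma jc_Cmult (K L : R -> R -> C) : jointly_continuous K -> jointly_continuous L ->
  jointly_continuous (fun x y => (K x y * L x y)%C).
Proof.
  intros HK HL x y.
  apply (continuous_Cmult (fun p : R * R => K (fst p) (snd p)) (fun p => L (fst p) (snd p)));
    [apply HK | apply HL].
Qed.

Lemma continuous_RInt_param_le (K : R -> R -> R) (c d x : R) :
  c <= d -> jointly_continuous K -> continuous (fun t => RInt (K t) c d) x.
Proof.
  intros Hcd HK.
  assert (E : forall t, ex_RInt (K t) c d).
  { intros t; apply (ex_RInt_continuous (V := R_CompleteNormedModule)); intros; apply jc_left, HK. }
  apply (proj2 (filterlim_locally (U := R_UniformSpace) _ _)); intros e.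
  (* The extra 1 keeps the quotient meaningful when c = d and makes the final inequality strict. *)
  assert (He : 0 < e / (d - c + 1)) by (apply Rdiv_lt_0_compat; [apply cond_pos | lra]).
  destruct (uniform_continuity_2d_1d' K c d x (fun y _ => jc_2d K x y HK) (mkposreal _ He))
    as [r Hr].
  exists r; intros y Hy.
  change (Rabs (y - x) < r) in Hy.
  change (Rabs (minus (RInt (K y) c d) (RInt (K x) c d)) < e).
  rewrite <- (RInt_minus (V := R_CompleteNormedModule) (K y) (K x) c d (E y) (E x)).
  apply Rle_lt_trans with ((d - c) * (e / (d - c + 1))).
  - apply abs_RInt_le_const; [exact Hcd | |].
    + apply (ex_RInt_minus (V := R_NormedModule)); apply E.
    + intros t Ht. left.
      pose proof (cond_pos r). apply Rabs_lt_between in Hy.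
      apply (Hr t x t y); auto; try lra.
      rewrite Rminus_diag, Rabs_R0; exact H.
  - apply Rlt_le_trans with ((d - c + 1) * (e / (d - c + 1))).
    + apply Rmult_lt_compat_r; lra.
    + right; field; lra.
Qed.

Lemma continuous_RInt_param (K : R -> R -> R) (c d x : R) :
  jointly_continuous K -> continuous (fun t => RInt (K t) c d) x.
Proof.
  intros HK; destruct (Rle_dec c d) as [H | H].
  - apply continuous_RInt_param_le; assumption.
  - apply (continuous_ext (fun t => opp (RInt (K t) d c))).
    + intros t; apply (opp_RInt_swap (V := R_CompleteNormedModule)).
      apply (ex_RInt_continuous (V := R_CompleteNormedModule)); intros; apply jc_left, HK.
    + apply (continuous_opp (V := R_NormedModule)), continuous_RInt_param_le; [lra | exact HK].
Qed.

Lemma continuous_CInt_param (K : R -> R -> C) (c d x : R) :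
  jointly_continuous K -> continuous (fun t => CInt (K t) c d) x.
Proof.
  intros HK; apply continuous_C_pair; simpl.
  - apply (continuous_RInt_param (fun t y => Re (K t y))).
    intros u v; apply (continuous_Re (fun p : R * R => K (fst p) (snd p))), HK.
  - apply (continuous_RInt_param (fun t y => Im (K t y))).
    intros u v; apply (continuous_Im (fun p : R * R => K (fst p) (snd p))), HK.
Qed.

(* Both sides, as functions of the upper limit [b] of the [x]-integral, have derivative
   [RInt (K b) c d]. *)
Lemma RInt_fubini (K : R -> R -> R) (a b c d : R) :
  a < b -> jointly_continuous K ->
  RInt (fun x => RInt (fun y => K x y) c d) a b = RInt (fun y => RInt (fun x => K x y) a b) c d.
Proof.
  intros Hab HK.
  assert (D0 : forall t y, is_derive (fun z => RInt (fun x => K x y) a z) t (K t y)).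
  { intros t y; apply (is_derive_RInt (V := R_NormedModule) (fun x => K x y) _ a).
    - apply filter_forall; intros z; apply (RInt_correct (V := R_CompleteNormedModule)).
      apply (ex_RInt_continuous (V := R_CompleteNormedModule)); intros; apply jc_right, HK.
    - apply jc_right, HK. }
  assert (D1 : forall t, is_derive (fun t => RInt (fun x => RInt (K x) c d) a t) t (RInt (K t) c d)).
  { intros t; apply (is_derive_RInt (V := R_NormedModule) (fun x => RInt (K x) c d) _ a).
    - apply filter_forall; intros z; apply (RInt_correct (V := R_CompleteNormedModule)).
      apply (ex_RInt_continuous (V := R_CompleteNormedModule)); intros.
      apply continuous_RInt_param, HK.
    - apply continuous_RInt_param, HK. }
  assert (D2 : forall t, is_derive (fun t => RInt (fun y => RInt (fun x => K x y) a t) c d) t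
                           (RInt (K t) c d)).
  { intros t.
    replace (RInt (K t) c d)
      with (RInt (fun y => Derive (fun z => RInt (fun x => K x y) a z) t) c d)
      by (apply RInt_ext; intros y _; apply is_derive_unique, D0).
    apply (is_derive_RInt_param (fun z y => RInt (fun x => K x y) a z) c d t).
    - apply filter_forall; intros z y _; eexists; apply D0.
    - intros y _. apply (continuity_2d_pt_ext K).
      + intros u v; symmetry; apply is_derive_unique, D0.
      + apply jc_2d, HK.
    - apply filter_forall; intros z.
      apply (ex_RInt_continuous (V := R_CompleteNormedModule)); intros y _.
      apply (continuous_RInt_param (fun y x => K x y)), jc_swap, HK. }
  set (P := fun t => RInt (fun x => RInt (K x) c d) a t
                     - RInt (fun y => RInt (fun x => K x y) a t) c d).
  assert (E : P a = P b).
  { apply (eq_is_derive (V := R_NormedModule)); [|exact Hab].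
    intros t _.
    pose proof (is_derive_minus (V := R_NormedModule) _ _ _ _ _ (D1 t) (D2 t)) as D.
    rewrite minus_eq_zero in D; exact D. }
  assert (P a = 0).
  { unfold P. rewrite RInt_point.
    rewrite (RInt_ext _ (fun _ => 0)) by (intros; apply (RInt_point (V := R_CompleteNormedModule))).
    rewrite RInt_const. unfold scal, mult, zero; simpl; unfold mult; simpl; ring. }
  apply Rminus_diag_uniq; change (P b = 0); congruence.
Qed.

(** * Decay and symmetry of the Fourier coefficients in the periodic variable *)

Section Fourier.
Variables (f : R -> R -> R) (Rs : R).
Hypothesis f_smooth : smooth2 f.
Hypothesis f_per : forall x y, f x (y + 2 * PI) = f x y.
Hypothesis f_supp : forall x y, Rs < Rabs x -> f x y = 0.

Lemma Cexp_im (t : R) : Cexp (0%R, t) = (cos t, sin t).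
Proof. unfold Cexp; simpl; rewrite exp_0; f_equal; ring. Qed.

Lemma continuous_phase (k x : R) : continuous (fun y => Cexp (0%R, (k * y)%R)) x.
Proof.
  apply continuous_Cexp, continuous_C_pair; simpl; [apply continuous_const|].
  apply (continuous_scal_r k (fun y : R => y)), continuous_id.
Qed.

Lemma continuous_RtoC_f (x y : R) : continuous (fun t => RtoC (f x t)) y.
Proof. apply continuous_RtoC, jc_left; intros u v; apply (f_smooth nil). Qed.

Lemma fcoef_continuous (j : Z) (x : R) : continuous (fcoef f j) x.
Proof.
  apply (continuous_CInt_param (fun x y => (Cexp (0%R, (- IZR j * y)%R) * RtoC (f x y))%C)).
  apply jc_Cmult.
  - apply jc_snd; intros y; apply continuous_phase.
  - intros u v; apply (continuous_RtoC (fun p : R * R => f (fst p) (snd p))), (f_smooth nil).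
Qed.

Lemma CInt_zero (a b : R) : CInt (fun _ => RtoC 0) a b = RtoC 0.
Proof.
  unfold CInt; simpl. rewrite RInt_const. unfold scal; simpl; unfold mult; simpl.
  rewrite Rmult_0_r; reflexivity.
Qed.

Lemma fcoef_support (j : Z) (x : R) : Rs < Rabs x -> fcoef f j x = RtoC 0.
Proof.
  intros H; unfold fcoef. rewrite <- (CInt_zero 0 (2 * PI)); apply CInt_ext; intros y _.
  rewrite f_supp by exact H. apply Cmult_0_r.
Qed.

(** This is the reality of f. It turns the products f_{n+1} f_{-1-n} in the first-order term of F
    into f_{n+1} times its own conjugate, so that each mode contributes a Hermitian form. *)
Lemma fcoef_conj (j : Z) (x : R) : Cconj (fcoef f j x) = fcoef f (- j) x.
Proof.
  unfold fcoef; rewrite <- CInt_conj.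
  - apply CInt_ext; intros y _. rewrite !Cexp_im, opp_IZR.
    replace (- - IZR j * y) with (- (- IZR j * y)) by ring.
    rewrite cos_neg, sin_neg. unfold Cconj, Cmult, RtoC; simpl; f_equal; ring.
  - intros y; apply continuous_Cmult; [apply continuous_phase | apply continuous_RtoC_f].
Qed.

(** Both derivatives are convertible to [pderiv] along lists of [false], the flag that selects the
    variable y, so [f_smooth] applies to them directly. *)
Let f1 (x y : R) := Derive (fun t => f x t) y.
Let f2 (x y : R) := Derive (fun t => f1 x t) y.

Lemma f1_derive (x y : R) : is_derive (fun t => f x t) y (f1 x y).
Proof. apply Derive_correct, (f_smooth nil). Qed.

Lemma f2_derive (x y : R) : is_derive (fun t => f1 x t) y (f2 x y).
Proof. apply Derive_correct, (f_smooth (cons false nil)). Qed.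

Lemma f2_continuous : jointly_continuous f2.
Proof. intros x y; apply (f_smooth (cons false (cons false nil))). Qed.

Lemma f1_periodic (x : R) : f1 x (2 * PI) = f1 x 0.
Proof.
  symmetry; unfold f1 at 1. apply is_derive_unique.
  apply (is_derive_ext (fun t => f x (t + 2 * PI))); [intros t; apply f_per|].
  replace (f1 x (2 * PI)) with (1 * f1 x (0 + 2 * PI)) by (rewrite Rplus_0_l; ring).
  apply (is_derive_comp (fun t => f x t) (fun t => t + 2 * PI)); [apply f1_derive|].
  auto_derive; [exact I | ring].
Qed.

Lemma f_periodic0 (x : R) : f x (2 * PI) = f x 0.
Proof. rewrite <- (f_per x 0), Rplus_0_l; reflexivity. Qed.

(* Two integrations by parts at once: [c (f2 + j^2 f)] is the derivative of [c f1 - c' f]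
   whenever [c'' = - j^2 c]. *)
Lemma fourier_by_parts (x j : R) (c c' : R -> R) :
  (forall y, is_derive c y (c' y)) -> (forall y, is_derive c' y (- j ^ 2 * c y)) ->
  c (2 * PI) = c 0 -> c' (2 * PI) = c' 0 ->
  j ^ 2 * RInt (fun y => c y * f x y) 0 (2 * PI) = - RInt (fun y => c y * f2 x y) 0 (2 * PI).
Proof.
  intros Hc Hc' Pc Pc'.
  assert (Cc : forall y, continuous c y)
    by (intros y; apply (ex_derive_continuous (V := R_NormedModule)); eexists; apply Hc).
  assert (Cf : forall y, continuous (f x) y) by (intros y; apply jc_left; intros u v; apply (f_smooth nil)).
  assert (C2 : forall y, continuous (f2 x) y) by (intros y; apply jc_left, f2_continuous).
  assert (D : is_RInt (fun y => c y * f2 x y + j ^ 2 * (c y * f x y)) 0 (2 * PI)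
    (minus (c (2 * PI) * f1 x (2 * PI) - c' (2 * PI) * f x (2 * PI))
           (c 0 * f1 x 0 - c' 0 * f x 0))).
  { apply (is_RInt_derive (V := R_CompleteNormedModule)
      (fun y => c y * f1 x y - c' y * f x y)).
    - intros y _.
      replace (c y * f2 x y + j ^ 2 * (c y * f x y))
        with (minus (plus (c' y * f1 x y) (c y * f2 x y))
                    (plus ((- j ^ 2 * c y) * f x y) (c' y * f1 x y)))
        by (unfold minus, plus, opp; simpl; ring).
      apply (is_derive_minus (V := R_NormedModule)).
      + apply (is_derive_mult (K := R_AbsRing) c (f1 x)); [apply Hc | apply f2_derive | apply Rmult_comm].
      + apply (is_derive_mult (K := R_AbsRing) c' (fun t => f x t)); [apply Hc' | apply f1_derive | apply Rmult_comm].
    - intros y _. apply (continuous_plus (V := R_NormedModule)).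
      + apply (continuous_mult (K := R_AbsRing)); auto.
      + apply (continuous_scal_r (V := R_NormedModule) (j ^ 2) (fun y => c y * f x y)).
        apply (continuous_mult (K := R_AbsRing)); auto. }
  rewrite Pc, Pc', f1_periodic, f_periodic0, minus_eq_zero in D.
  apply (is_RInt_unique (V := R_CompleteNormedModule)) in D.
  assert (E1 : ex_RInt (fun y => c y * f2 x y) 0 (2 * PI)).
  { apply (ex_RInt_continuous (V := R_CompleteNormedModule)); intros.
    apply (continuous_mult (K := R_AbsRing)); auto. }
  assert (E2 : ex_RInt (fun y => c y * f x y) 0 (2 * PI)).
  { apply (ex_RInt_continuous (V := R_CompleteNormedModule)); intros.
    apply (continuous_mult (K := R_AbsRing)); auto. }
  assert (X1 : RInt (fun y => c y * f2 x y + j ^ 2 * (c y * f x y)) 0 (2 * PI) =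
    RInt (fun y => c y * f2 x y) 0 (2 * PI) + RInt (fun y => j ^ 2 * (c y * f x y)) 0 (2 * PI))
    by exact (RInt_plus (V := R_CompleteNormedModule) _ _ _ _ E1
      (ex_RInt_scal (V := R_CompleteNormedModule) _ _ _ (j ^ 2) E2)).
  assert (X2 : RInt (fun y => j ^ 2 * (c y * f x y)) 0 (2 * PI) =
    j ^ 2 * RInt (fun y => c y * f x y) 0 (2 * PI))
    by exact (RInt_scal (V := R_CompleteNormedModule) _ _ _ (j ^ 2) E2).
  change (RInt (fun y => c y * f2 x y + j ^ 2 * (c y * f x y)) 0 (2 * PI) = 0) in D.
  lra.
Qed.

(** In the factor 1 + j^2 the 1 comes from the trivial bound by the integral of |f|, the j^2 from
    the double integration by parts, which costs the integral of |f2|. *)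
Lemma fourier_mode_bound (x : R) (j : Z) (c c' : R -> R) :
  (forall y, is_derive c y (c' y)) -> (forall y, is_derive c' y (- IZR j ^ 2 * c y)) ->
  c (2 * PI) = c 0 -> c' (2 * PI) = c' 0 -> (forall y, Rabs (c y) <= 1) ->
  (1 + IZR j ^ 2) * Rabs (RInt (fun y => c y * f x y) 0 (2 * PI)) <=
  RInt (fun y => Rabs (f x y)) 0 (2 * PI) + RInt (fun y => Rabs (f2 x y)) 0 (2 * PI).
Proof.
  intros Hc Hc' Pc Pc' Bc.
  assert (Cc : forall y, continuous c y)
    by (intros y; apply (ex_derive_continuous (V := R_NormedModule)); eexists; apply Hc).
  assert (B : forall u : R -> R, (forall y, continuous u y) ->
    Rabs (RInt (fun y => c y * u y) 0 (2 * PI)) <= RInt (fun y => Rabs (u y)) 0 (2 * PI)).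
  { intros u Hu. pose proof PI_RGT_0.
    assert (E : ex_RInt (fun y => c y * u y) 0 (2 * PI)).
    { apply (ex_RInt_continuous (V := R_CompleteNormedModule)); intros.
      apply (continuous_mult (K := R_AbsRing)); auto. }
    assert (Ca : forall v : R -> R, (forall y, continuous v y) -> ex_RInt (fun y => Rabs (v y)) 0 (2 * PI)).
    { intros v Hv. apply (ex_RInt_continuous (V := R_CompleteNormedModule)); intros.
      apply (continuous_comp v Rabs); [apply Hv | apply continuous_Rabs]. }
    eapply Rle_trans; [apply abs_RInt_le; [lra | exact E]|].
    apply RInt_le; [lra | apply (Ca (fun y => c y * u y)) | apply Ca, Hu |].
    - intros y; apply (continuous_mult (K := R_AbsRing)); auto.
    - intros y _; rewrite Rabs_mult. pose proof (Bc y); pose proof (Rabs_pos (u y)); nra. }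
  pose proof (fourier_by_parts x (IZR j) c c' Hc Hc' Pc Pc') as P.
  assert (B1 := B (f x) (fun y => jc_left f x y (fun u v => proj1 (f_smooth nil) u v))).
  assert (B2 := B (f2 x) (fun y => jc_left f2 x y f2_continuous)).
  assert (X : IZR j ^ 2 * Rabs (RInt (fun y => c y * f x y) 0 (2 * PI))
     = Rabs (RInt (fun y => c y * f2 x y) 0 (2 * PI))).
  { rewrite <- (Rabs_Ropp (RInt (fun y => c y * f2 x y) 0 (2 * PI))), <- P, Rabs_mult.
    rewrite (Rabs_pos_eq (IZR j ^ 2)) by apply pow2_ge_0. reflexivity. }
  lra.
Qed.

Lemma fcoef_decay : exists B, 0 <= B /\ forall j x, Cmod (fcoef f j x) <= B * wgt j.
Proof.
  set (h := fun x => RInt (fun y => Rabs (f x y)) 0 (2 * PI) + RInt (fun y => Rabs (f2 x y)) 0 (2 * PI)).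
  assert (Ch : forall x, continuous h x).
  { intros x; apply (continuous_plus (V := R_NormedModule)).
    - apply (continuous_RInt_param (fun x y => Rabs (f x y))). intros u v.
      apply (continuous_comp (fun p : R * R => f (fst p) (snd p)) Rabs);
        [apply (f_smooth nil) | apply continuous_Rabs].
    - apply (continuous_RInt_param (fun x y => Rabs (f2 x y))). intros u v.
      apply (continuous_comp (fun p : R * R => f2 (fst p) (snd p)) Rabs);
        [apply f2_continuous | apply continuous_Rabs]. }
  (* For negative [Rs] the support condition kills every coefficient, and there is no interval on
     which to maximise [h]. *)
  destruct (Rlt_dec Rs 0) as [Hn | Hp].
  { exists 0; split; [lra|]; intros j x. rewrite fcoef_support by (pose proof (Rabs_pos x); lra).
    rewrite Cmod_0; lra. }
  destruct (continuity_ab_maj h (- Rs) Rs) as [M [HM _]]; [lra | |].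
  { intros x _; apply continuity_pt_filterlim, Ch. }
  (* [h M] is the maximum of [h] over the support; the factor 2 adds the cosine and sine parts. *)
  exists (Rmax 0 (2 * h M)); split; [apply Rmax_l|]; intros j x.
  destruct (Rlt_dec Rs (Rabs x)) as [Hx | Hx].
  { rewrite fcoef_support, Cmod_0 by exact Hx.
    apply Rmult_le_pos; [apply Rmax_l | left; apply wgt_pos]. }
  assert (Hm : h x <= h M) by (apply HM, Rabs_le_between; lra).
  set (J := IZR j) in *.
  assert (R1 := fourier_mode_bound x j (fun y => cos (J * y)) (fun y => - J * sin (J * y))).
  assert (R2 := fourier_mode_bound x j (fun y => sin (J * y)) (fun y => J * cos (J * y))).
  assert (PS : forall n : Z, sin (IZR n * (2 * PI)) = 0).
  { intros n; apply sin_eq_0_1; exists (2 * n)%Z; rewrite mult_IZR; ring. }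
  assert (PC : forall n : Z, cos (IZR n * (2 * PI)) = 1).
  { intros n. replace (IZR n * (2 * PI)) with (2 * (IZR n * PI)) by ring.
    rewrite cos_2a_sin, (sin_eq_0_1 (IZR n * PI)) by (exists n; reflexivity). ring. }
  fold J in R1, R2.
  assert (B1 : (1 + J ^ 2) * Rabs (RInt (fun y => cos (J * y) * f x y) 0 (2 * PI)) <= h x).
  { apply R1.
    - intros y; auto_derive; [exact I | ring].
    - intros y; auto_derive; [exact I | ring].
    - unfold J; rewrite PC, (Rmult_0_r (IZR j)), cos_0; reflexivity.
    - unfold J; rewrite PS, (Rmult_0_r (IZR j)), sin_0; reflexivity.
    - intros y; apply Rabs_le, COS_bound. }
  assert (B2 : (1 + J ^ 2) * Rabs (RInt (fun y => sin (J * y) * f x y) 0 (2 * PI)) <= h x).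
  { apply R2.
    - intros y; auto_derive; [exact I | ring].
    - intros y; auto_derive; [exact I | ring].
    - unfold J; rewrite PS, (Rmult_0_r (IZR j)), sin_0; reflexivity.
    - unfold J; rewrite PC, (Rmult_0_r (IZR j)), cos_0; reflexivity.
    - intros y; apply Rabs_le, SIN_bound. }
  assert (HJ : 0 < 1 + J ^ 2) by (pose proof (pow2_ge_0 J); lra).
  assert (E1 : Re (fcoef f j x) = RInt (fun y => cos (J * y) * f x y) 0 (2 * PI)).
  { unfold fcoef, CInt; cbn [Re fst]. apply RInt_ext; intros y _. rewrite Cexp_im; simpl.
    fold J; replace (- J * y) with (- (J * y)) by ring. rewrite cos_neg; ring. }
  assert (E2 : Rabs (Im (fcoef f j x)) = Rabs (RInt (fun y => sin (J * y) * f x y) 0 (2 * PI))).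
  { rewrite <- Rabs_Ropp; f_equal.
    unfold fcoef, CInt; cbn [Im snd].
    rewrite <- (RInt_opp (V := R_CompleteNormedModule)).
    - apply RInt_ext; intros y _. rewrite Cexp_im; simpl.
      fold J; replace (- J * y) with (- (J * y)) by ring.
      rewrite sin_neg; unfold opp; simpl; ring.
    - apply (ex_RInt_Im (fun y => (Cexp (0%R, (- IZR j * y)%R) * RtoC (f x y))%C)).
      intros y; apply continuous_Cmult; [apply continuous_phase | apply continuous_RtoC_f]. }
  assert (T : (1 + J ^ 2) * Cmod (fcoef f j x) <= 2 * h x).
  { apply Rle_trans with ((1 + J ^ 2) * (Rabs (Re (fcoef f j x)) + Rabs (Im (fcoef f j x)))).
    - apply Rmult_le_compat_l; [lra | apply Cmod_le_ReIm].
    - rewrite E1, E2; lra. }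
  unfold wgt; fold J. pose proof (Rmax_r 0 (2 * h M)).
  apply Rmult_le_reg_l with (1 + J ^ 2); [exact HJ|].
  replace ((1 + J ^ 2) * (Rmax 0 (2 * h M) * / (1 + J ^ 2))) with (Rmax 0 (2 * h M)) by (field; lra).
  lra.
Qed.

End Fourier.

(** * The kernels *)

Lemma Cexp_line (c : C) (t : R) :
  Cexp (c * RtoC t)%C = (exp (Re c * t) * cos (Im c * t), exp (Re c * t) * sin (Im c * t)).
Proof.
  destruct c as [c1 c2]; unfold Cexp, Cmult, RtoC; simpl.
  replace (c1 * t - c2 * 0) with (c1 * t) by ring.
  replace (c1 * 0 + c2 * t) with (c2 * t) by ring. reflexivity.
Qed.

Lemma Cexp_line_derive_Re (w c : C) (t : R) :
  is_derive (fun t => Re (w * Cexp (c * RtoC t))%C) t (Re (w * (c * Cexp (c * RtoC t)))%C).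
Proof.
  apply (is_derive_ext (fun t => Re w * (exp (Re c * t) * cos (Im c * t))
                               - Im w * (exp (Re c * t) * sin (Im c * t)))).
  - intros s; rewrite Cexp_line; reflexivity.
  - rewrite Cexp_line; destruct w as [w1 w2], c as [c1 c2]; simpl.
    auto_derive; [exact I|]. ring.
Qed.

Lemma Cexp_line_derive_Im (w c : C) (t : R) :
  is_derive (fun t => Im (w * Cexp (c * RtoC t))%C) t (Im (w * (c * Cexp (c * RtoC t)))%C).
Proof.
  apply (is_derive_ext (fun t => Re w * (exp (Re c * t) * sin (Im c * t))
                               + Im w * (exp (Re c * t) * cos (Im c * t)))).
  - intros s; rewrite Cexp_line; reflexivity.
  - rewrite Cexp_line; destruct w as [w1 w2], c as [c1 c2]; simpl.
    auto_derive; [exact I|]. ring.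
Qed.

Lemma mvt_bound (g g' : R -> R) (t M : R) :
  0 <= t -> (forall s, is_derive g s (g' s)) -> (forall s, 0 <= s <= t -> Rabs (g' s) <= M) ->
  Rabs (g t - g 0) <= M * t.
Proof.
  intros Ht Hg HM.
  destruct (MVT_gen g 0 t g') as [c [Hc ->]].
  - intros; apply Hg.
  - intros x _; apply continuity_pt_filterlim.
    apply (ex_derive_continuous (V := R_NormedModule)); eexists; apply Hg.
  - rewrite Rmin_left, Rmax_right in Hc by lra.
    rewrite Rminus_0_r, Rabs_mult, (Rabs_pos_eq t) by exact Ht.
    apply Rmult_le_compat_r; [exact Ht | apply HM, Hc].
Qed.

(* [(e^{-at}-1)/a] is minus the integral of [e^{-as}] over [0,t]: this removes the division
   by [a], so that the bound is uniform as [a] tends to 0. *)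
Lemma expm1_div_lipschitz (a b : C) (t m : R) :
  a <> RtoC 0 -> b <> RtoC 0 -> Cmod a <= m -> Cmod b <= m -> 0 <= t ->
  Cmod (/ a * (Cexp (- a * RtoC t) - RtoC 1) - / b * (Cexp (- b * RtoC t) - RtoC 1))%C
    <= 6 * exp (m * t) * exp (2 * m * t) * t * t * Cmod (a - b)%C.
Proof.
  intros Ha Hb Ma Mb Ht.
  assert (Hm : 0 <= m) by (eapply Rle_trans; [apply Cmod_ge_0 | exact Ma]).
  (* The first exponential bounds exp(-as), the second comes from |a - b| <= 2m. Integrating over
     [0, t] and adding the two components then gives the factor 6 and the second t of the
     statement. *)
  set (L := 3 * exp (m * t) * exp (2 * m * t) * t * Cmod (a - b)%C).
  assert (HL : forall s, 0 <= s <= t ->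
    Cmod (Cexp (- b * RtoC s) - Cexp (- a * RtoC s))%C <= L).
  { intros s Hs. pose proof (Cmod_ge_0 (a - b)%C) as Hp.
    assert (Hab : Cmod (a - b)%C <= 2 * m)
      by (eapply Rle_trans; [apply Cmod_triangle_minus | lra]).
    assert (E1 : Cmod (Cexp (- a * RtoC s)) <= exp (m * t)).
    { eapply Rle_trans; [apply Cmod_Cexp_le|]. apply exp_le_mono.
      rewrite Cmod_mult, Cmod_opp, Cmod_R, Rabs_pos_eq by lra.
      apply Rmult_le_compat; try lra; apply Cmod_ge_0. }
    assert (E2 : Cmod (- b * RtoC s - - a * RtoC s)%C = Cmod (a - b)%C * s).
    { replace (- b * RtoC s - - a * RtoC s)%C with ((a - b) * RtoC s)%C by ring.
      rewrite Cmod_mult, Cmod_R, Rabs_pos_eq by lra; reflexivity. }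
    eapply Rle_trans; [apply Cexp_diff_bound|]. rewrite E2.
    assert (E3 : Cmod (a - b)%C * s <= 2 * m * t) by (apply Rmult_le_compat; lra).
    assert (E4 : Cmod (a - b)%C * s <= Cmod (a - b)%C * t) by (apply Rmult_le_compat_l; lra).
    assert (E5 := exp_le_mono _ _ E3).
    unfold L. apply Rle_trans with (exp (m * t) * (3 * (Cmod (a - b)%C * t) * exp (2 * m * t)));
      [|right; ring].
    apply Rmult_le_compat; [apply Cmod_ge_0 | | exact E1 |].
    - apply Rmult_le_pos; [nra | left; apply exp_pos].
    - apply Rmult_le_compat; [nra | left; apply exp_pos | lra | exact E5]. }
  set (G := fun s => (/ a * Cexp (- a * RtoC s) - / b * Cexp (- b * RtoC s))%C).
  assert (HG : (/ a * (Cexp (- a * RtoC t) - RtoC 1) - / b * (Cexp (- b * RtoC t) - RtoC 1))%C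
    = (G t - G 0)%C).
  { unfold G. replace (- a * RtoC 0)%C with (RtoC 0) by ring.
    replace (- b * RtoC 0)%C with (RtoC 0) by ring. rewrite Cexp_0; ring. }
  (* Differentiating [G] cancels both inverses, which is the whole gain: no lower bound on |a| or
     |b| enters. *)
  assert (D : forall s,
    (/ a * (- a * Cexp (- a * RtoC s)) - / b * (- b * Cexp (- b * RtoC s)))%C =
    (Cexp (- b * RtoC s) - Cexp (- a * RtoC s))%C) by (intros s; field; auto).
  rewrite HG. eapply Rle_trans; [apply Cmod_le_ReIm|].
  assert (BR : Rabs (Re (G t) - Re (G 0)) <= L * t).
  { apply (mvt_bound (fun s => Re (G s))
      (fun s => Re (Cexp (- b * RtoC s) - Cexp (- a * RtoC s))%C)); [exact Ht | |].
    - intros s. rewrite <- D.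
      exact (is_derive_minus (V := R_NormedModule) _ _ _ _ _
        (Cexp_line_derive_Re (/ a) (- a) s) (Cexp_line_derive_Re (/ b) (- b) s)).
    - intros s Hs; eapply Rle_trans; [apply re_le_Cmod | apply HL, Hs]. }
  assert (BI : Rabs (Im (G t) - Im (G 0)) <= L * t).
  { apply (mvt_bound (fun s => Im (G s))
      (fun s => Im (Cexp (- b * RtoC s) - Cexp (- a * RtoC s))%C)); [exact Ht | |].
    - intros s. rewrite <- D.
      exact (is_derive_minus (V := R_NormedModule) _ _ _ _ _
        (Cexp_line_derive_Im (/ a) (- a) s) (Cexp_line_derive_Im (/ b) (- b) s)).
    - intros s Hs; eapply Rle_trans; [apply im_le_Cmod | apply HL, Hs]. }
  change (Re (G t - G 0)%C) with (Re (G t) - Re (G 0)).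
  change (Im (G t - G 0)%C) with (Im (G t) - Im (G 0)).
  unfold L in *; lra.
Qed.

Section Kernels.
Variables (beta Rs : R).
Hypothesis Hbeta : 0 < beta < 1 / 2.
Hypothesis HRs : 0 <= Rs.

(** At mu = 0 the radicands are at least 4 beta for n >= 1, at least 3 - 2 beta for n <= -2, and
    equal to 1 - 2 beta for k_0. Half of the gap is kept; the other half absorbs Re mu^2, so that
    all principal roots stay away from the cut on the complex disc |mu| <= [mu_gap]. *)
Definition mu_gap : R := Rmin (4 * beta) (1 - 2 * beta) / 2.

Lemma mu_gap_bounds : 0 < mu_gap < 1 / 2 /\ 2 * mu_gap <= 4 * beta /\ 2 * mu_gap <= 1 - 2 * beta.
Proof.
  unfold mu_gap.
  pose proof (Rmin_l (4 * beta) (1 - 2 * beta)); pose proof (Rmin_r (4 * beta) (1 - 2 * beta)).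
  assert (0 < Rmin (4 * beta) (1 - 2 * beta)) by (apply Rmin_pos; lra). lra.
Qed.

(* The kernels other than [H_{-1}] are all [e^{-z|x|}/(2z)] with [z = kroot]. *)
Definition kroot (mu : C) (n : Z) : C :=
  if Z.eq_dec n 0 then (- Ci * k0 mu beta)%C else km mu beta n.

Lemma mode_gap (n : Z) : n <> 0%Z -> n <> (-1)%Z ->
  2 * mu_gap <= (beta + IZR n) ^ 2 - (1 - beta) ^ 2.
Proof.
  intros H0 H1. destruct mu_gap_bounds as [G1 [G2 G3]].
  destruct (Z_lt_le_dec 0 n) as [Hn | Hn].
  - assert (1 <= IZR n) by (apply IZR_le; lia). nra.
  - assert (IZR n <= -2) by (apply IZR_le; lia). nra.
Qed.

Lemma Re_mu2 (mu : C) : Cmod mu <= mu_gap -> Rabs (Re (mu * mu)%C) <= mu_gap.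
Proof.
  intros H. eapply Rle_trans; [apply re_le_Cmod|]. rewrite Cmod_mult.
  pose proof (Cmod_ge_0 mu). destruct mu_gap_bounds. nra.
Qed.

Lemma k0_arg (mu : C) : Cmod mu <= mu_gap -> mu_gap <= Re (RtoC (1 - 2 * beta) - mu * mu)%C.
Proof.
  intros H; apply Re_mu2, Rabs_le_between in H. destruct mu_gap_bounds as [G1 [G2 G3]].
  change (mu_gap <= (1 - 2 * beta) - Re (mu * mu)%C). lra.
Qed.

Lemma km_arg (mu : C) (n : Z) : Cmod mu <= mu_gap -> n <> 0%Z -> n <> (-1)%Z ->
  mu_gap <= Re (RtoC ((beta + IZR n) ^ 2 - (1 - beta) ^ 2) + mu * mu)%C.
Proof.
  intros H H0 H1; apply Re_mu2, Rabs_le_between in H. pose proof (mode_gap n H0 H1).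
  change (mu_gap <= ((beta + IZR n) ^ 2 - (1 - beta) ^ 2) + Re (mu * mu)%C). lra.
Qed.

Let c := sqrt mu_gap.

Lemma c_pos : 0 < c.
Proof. apply sqrt_lt_R0, mu_gap_bounds. Qed.

(** The radicand has real part at least [mu_gap], so its principal root has real part at least c.
    The bound is the same for all modes, which makes the kernel estimates uniform in n. *)
Lemma kroot_lower (mu : C) (n : Z) : Cmod mu <= mu_gap -> n <> (-1)%Z -> c <= Cmod (kroot mu n).
Proof.
  intros H H1; unfold kroot; destruct (Z.eq_dec n 0) as [-> | H0].
  - rewrite Cmod_mult, Cmod_opp, Cmod_Ci, Rmult_1_l.
    eapply Rle_trans; [apply Csqrt_Re_ge, (k0_arg mu H)|].
    eapply Rle_trans; [apply Rle_abs | apply re_le_Cmod].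
  - eapply Rle_trans; [apply Csqrt_Re_ge, (km_arg mu n H H0 H1)|].
    eapply Rle_trans; [apply Rle_abs | apply re_le_Cmod].
Qed.

Lemma kroot_nonzero (mu : C) (n : Z) : Cmod mu <= mu_gap -> n <> (-1)%Z -> kroot mu n <> RtoC 0.
Proof.
  intros H H1; apply Cmod_gt_0. pose proof (kroot_lower mu n H H1); pose proof c_pos; lra.
Qed.

Lemma mu2_diff (mu mu' : C) : Cmod mu <= mu_gap -> Cmod mu' <= mu_gap ->
  Cmod (mu * mu - mu' * mu')%C <= Cmod (mu - mu')%C.
Proof.
  intros H H'. replace (mu * mu - mu' * mu')%C with ((mu - mu') * (mu + mu'))%C by ring.
  rewrite Cmod_mult. pose proof (Cmod_ge_0 (mu - mu')%C). pose proof (Cmod_triangle mu mu').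
  destruct mu_gap_bounds. nra.
Qed.

(** The difference of squares is kept on the right: at mu' = 0 it yields k_0(mu) - kappa = O(mu^2)
    rather than O(mu), as the O(eps) errors of the amplitudes require. *)
Lemma k0_lipschitz (mu mu' : C) : Cmod mu <= mu_gap -> Cmod mu' <= mu_gap ->
  2 * c * Cmod (k0 mu beta - k0 mu' beta)%C <= Cmod (mu * mu - mu' * mu')%C.
Proof.
  intros H H'.
  eapply Rle_trans; [apply Csqrt_lipschitz; [apply mu_gap_bounds | apply k0_arg, H | apply k0_arg, H']|].
  right. rewrite Cmod_minus_sym. f_equal; ring.
Qed.

Lemma kroot_lipschitz (mu mu' : C) (n : Z) :
  Cmod mu <= mu_gap -> Cmod mu' <= mu_gap -> n <> (-1)%Z ->
  2 * c * Cmod (kroot mu n - kroot mu' n)%C <= Cmod (mu - mu')%C.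
Proof.
  intros H H' H1. eapply Rle_trans; [|apply mu2_diff; [exact H | exact H']].
  unfold kroot; destruct (Z.eq_dec n 0) as [-> | H0].
  - replace (- Ci * k0 mu beta - - Ci * k0 mu' beta)%C with (- Ci * (k0 mu beta - k0 mu' beta))%C by ring.
    rewrite Cmod_mult, Cmod_opp, Cmod_Ci, Rmult_1_l. apply k0_lipschitz; assumption.
  - eapply Rle_trans;
      [apply Csqrt_lipschitz; [apply mu_gap_bounds | apply km_arg; assumption | apply km_arg; assumption]|].
    right; f_equal; ring.
Qed.

Lemma k0_upper (mu : C) : Cmod mu <= mu_gap -> Cmod (k0 mu beta) <= 2.
Proof.
  intros H. assert (E : Cmod (k0 mu beta) * Cmod (k0 mu beta) <= 4).
  { rewrite <- Cmod_mult; unfold k0; rewrite Csqrt_sqr.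
    eapply Rle_trans; [apply Cmod_triangle_minus|].
    rewrite Cmod_R, Cmod_mult, Rabs_pos_eq by lra.
    pose proof (Cmod_ge_0 mu); destruct mu_gap_bounds; nra. }
  pose proof (Cmod_ge_0 (k0 mu beta)); nra.
Qed.

(** The propagating mode n = 0 is bounded through |k_0| <= 2 and t <= 2 Rs. For the other modes
    |k_n| is unbounded in n, and the sign of Re k_n is used instead: the exponential has modulus at
    most 1. *)
Lemma kroot_exp_bound (mu : C) (n : Z) (t : R) :
  Cmod mu <= mu_gap -> n <> (-1)%Z -> 0 <= t <= 2 * Rs ->
  Cmod (Cexp (- kroot mu n * RtoC t)) <= exp (4 * Rs).
Proof.
  intros H H1 Ht; rewrite Cmod_Cexp; apply exp_le_mono.
  unfold kroot; destruct (Z.eq_dec n 0) as [-> | H0].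
  - eapply Rle_trans; [apply Rle_abs|]. eapply Rle_trans; [apply re_le_Cmod|].
    rewrite !Cmod_mult, !Cmod_opp, Cmod_mult, Cmod_opp, Cmod_Ci, Cmod_R, Rabs_pos_eq by lra.
    pose proof (k0_upper mu H); pose proof (Cmod_ge_0 (k0 mu beta)); nra.
  - pose proof (Csqrt_Re_ge _ _ (km_arg mu n H H0 H1)) as K.
    change (Csqrt (RtoC ((beta + IZR n) ^ 2 - (1 - beta) ^ 2) + mu * mu)%C) with (km mu beta n) in K.
    pose proof c_pos; unfold c in *.
    replace (Re (- km mu beta n * RtoC t)%C) with (- (Re (km mu beta n) * t))
      by (unfold Cmult, Copp, RtoC, Re; simpl; ring).
    assert (0 <= Re (km mu beta n) * t) by (apply Rmult_le_pos; lra). lra.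
Qed.

Lemma Hker_kroot (mu : C) (n : Z) (x : R) : Cmod mu <= mu_gap -> n <> (-1)%Z ->
  Hker mu beta n x = (/ (RtoC 2 * kroot mu n) * Cexp (- kroot mu n * RtoC (Rabs x)))%C.
Proof.
  intros H H1; pose proof (kroot_nonzero mu n H H1) as N; revert N.
  unfold Hker, kroot; destruct (Z.eq_dec n 0) as [-> | H0].
  - intros N. f_equal; [|f_equal; ring].
    assert (k0 mu beta <> RtoC 0) by (intros E; apply N; rewrite E; ring).
    assert (E : (Ci * Ci = - RtoC 1)%C)
      by (unfold Ci, Cmult, Copp, RtoC; simpl; f_equal; ring).
    assert (Ci <> RtoC 0) by (unfold Ci, RtoC; injection; lra).
    replace (Ci / (RtoC 2 * k0 mu beta))%C
      with ((Ci * Ci) / (RtoC 2 * (Ci * k0 mu beta)))%C.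
    + rewrite E; field; auto.
    + field; auto.
  - destruct (Z.eq_dec n (-1)); [contradiction | reflexivity].
Qed.

Lemma Hker_m1 (mu : C) (x : R) : mu <> RtoC 0 -> Hker mu beta (-1) x =
  (/ RtoC 2 * (/ mu * (Cexp (- mu * RtoC (Rabs x)) - RtoC 1)))%C.
Proof. intros H; unfold Hker; simpl. field; auto. Qed.

Lemma Hker_bound : exists B, 0 < B /\ forall mu n x, Cmod mu <= mu_gap -> Rabs x <= 2 * Rs ->
  Cmod (Hker mu beta n x) <= B.
Proof.
  pose proof c_pos as Hc.
  set (B1 := exp (4 * Rs) / (2 * c)). set (B2 := 3 * Rs * exp (2 * Rs)).
  assert (P1 : 0 < B1) by (apply Rdiv_lt_0_compat; [apply exp_pos | lra]).
  assert (P2 : 0 <= B2) by (apply Rmult_le_pos; [lra | left; apply exp_pos]).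
  exists (B1 + B2); split; [lra|]. intros mu n x H Hx.
  pose proof (Rabs_pos x) as Hx0.
  destruct (Z.eq_dec n (-1)) as [-> | H1].
  - destruct (Ceq_dec mu (RtoC 0)) as [-> | N].
    (* At mu = 0 the second factor vanishes, so the kernel is 0 whatever the inverse of 0 is. *)
    + unfold Hker; simpl. replace (- RtoC 0 * RtoC (Rabs x))%C with (RtoC 0) by ring.
      rewrite Cexp_0. replace (RtoC 1 - RtoC 1)%C with (RtoC 0) by ring.
      rewrite Cmult_0_r, Cmod_0; lra.
    + rewrite Hker_m1 by exact N.
      rewrite !Cmod_mult, !Cmod_inv, Cmod_R, Rabs_pos_eq; try lra; try exact N;
        try (intros E; apply RtoC_inj in E; lra).
      pose proof (Cexp_minus_1_bound (- mu * RtoC (Rabs x))%C) as E.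
      rewrite Cmod_mult, Cmod_opp, Cmod_R, Rabs_Rabsolu in E.
      apply Cmod_gt_0 in N. destruct mu_gap_bounds as [[G1 G2] _].
      assert (X : exp (Cmod mu * Rabs x) <= exp (2 * Rs)) by (apply exp_le_mono; nra).
      apply Rle_trans with (/ 2 * (/ Cmod mu * (3 * (Cmod mu * Rabs x) * exp (2 * Rs)))).
      * apply Rmult_le_compat_l; [lra|].
        apply Rmult_le_compat_l; [left; apply Rinv_0_lt_compat; lra|].
        eapply Rle_trans; [exact E|]. apply Rmult_le_compat_l; [nra | exact X].
      * replace (/ 2 * (/ Cmod mu * (3 * (Cmod mu * Rabs x) * exp (2 * Rs))))
          with (3 / 2 * Rabs x * exp (2 * Rs)) by (field; lra).
        pose proof (exp_pos (2 * Rs)). unfold B2 in *. nra.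
  - rewrite Hker_kroot by assumption.
    pose proof (kroot_lower mu n H H1) as L.
    pose proof (kroot_exp_bound mu n (Rabs x) H H1 (conj Hx0 Hx)) as U.
    rewrite Cmod_mult, Cmod_inv.
    2:{ apply Cmult_neq_0; [intros E; apply RtoC_inj in E; lra | apply kroot_nonzero; assumption]. }
    rewrite Cmod_mult, Cmod_R, Rabs_pos_eq by lra.
    apply Rle_trans with B1; [|lra]. unfold B1, Rdiv. rewrite Rmult_comm.
    apply Rmult_le_compat; [apply Cmod_ge_0 | left; apply Rinv_0_lt_compat; lra | exact U |].
    apply Rinv_le_contravar; lra.
Qed.

Lemma Hker_lipschitz : exists L, 0 <= L /\ forall mu mu' n x,
  Cmod mu <= mu_gap -> Cmod mu' <= mu_gap -> mu <> RtoC 0 -> mu' <> RtoC 0 -> Rabs x <= 2 * Rs ->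
  Cmod (Hker mu beta n x - Hker mu' beta n x)%C <= L * Cmod (mu - mu')%C.
Proof.
  pose proof c_pos as Hc. destruct mu_gap_bounds as [[G1 G2] _].
  set (L2 := 6 * exp (2 * Rs) * exp (4 * Rs) * (2 * Rs) * (2 * Rs)).
  (* Lipschitz constant of the exponential factor with respect to [kroot]: |x| <= 2 Rs accounts for
     6 Rs, and the exponent |k - k'| |x| stays below 2 Rs / c because |mu - mu'| <= 1. *)
  set (EE := exp (4 * Rs) * (6 * Rs * exp (2 * Rs / c))).
  (* Product rule for exp(-k|x|) / (2k); the last division by 2c passes from differences of [kroot]
     to differences of mu. *)
  set (L1 := (/ (2 * c * c) * exp (4 * Rs) + / (2 * c) * EE) / (2 * c)).
  assert (P2 : 0 <= L2).
  { unfold L2. pose proof (exp_pos (2 * Rs)); pose proof (exp_pos (4 * Rs)).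
    repeat apply Rmult_le_pos; lra. }
  assert (PE : 0 <= EE).
  { unfold EE. pose proof (exp_pos (4 * Rs)); pose proof (exp_pos (2 * Rs / c)).
    repeat apply Rmult_le_pos; lra. }
  assert (I1 : 0 < / (2 * c * c)) by (apply Rinv_0_lt_compat; nra).
  assert (I2 : 0 < / (2 * c)) by (apply Rinv_0_lt_compat; lra).
  assert (P1 : 0 <= L1).
  { unfold L1, Rdiv. pose proof (exp_pos (4 * Rs)). apply Rmult_le_pos; [nra | lra]. }
  exists (L1 + L2); split; [lra|]. intros mu mu' n x H H' N N' Hx.
  pose proof (Rabs_pos x) as Hx0. set (d := Cmod (mu - mu')%C).
  assert (Hd : 0 <= d) by apply Cmod_ge_0.
  destruct (Z.eq_dec n (-1)) as [-> | H1].
  - rewrite !Hker_m1 by assumption.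
    assert (M1 : Cmod mu <= 1) by lra. assert (M1' : Cmod mu' <= 1) by lra.
    pose proof (expm1_div_lipschitz mu mu' (Rabs x) 1 N N' M1 M1' Hx0) as E.
    fold d in E.
    match goal with |- Cmod (?a * ?u - ?a * ?v)%C <= _ =>
      replace (a * u - a * v)%C with (a * (u - v))%C by ring end.
    rewrite Cmod_mult, Cmod_inv, Cmod_R, (Rabs_pos_eq 2) by
      (try lra; intros E'; apply RtoC_inj in E'; lra).
    assert (X1 : exp (1 * Rabs x) <= exp (2 * Rs)) by (apply exp_le_mono; lra).
    assert (X2 : exp (2 * 1 * Rabs x) <= exp (4 * Rs)) by (apply exp_le_mono; lra).
    assert (X : 6 * exp (1 * Rabs x) * exp (2 * 1 * Rabs x) * Rabs x * Rabs x <= L2).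
    { pose proof (exp_pos (1 * Rabs x)); pose proof (exp_pos (2 * 1 * Rabs x)).
      unfold L2. repeat apply Rmult_le_compat; try lra; repeat apply Rmult_le_pos; lra. }
    match type of E with ?u <= _ => assert (0 <= u) by apply Cmod_ge_0; assert (u <= L2 * d) end.
    { eapply Rle_trans; [exact E|]. apply Rmult_le_compat_r; assumption. }
    nra.
  - rewrite !Hker_kroot by assumption.
    pose proof (kroot_lower mu n H H1) as l. pose proof (kroot_lower mu' n H' H1) as l'.
    pose proof (kroot_nonzero mu n H H1) as z. pose proof (kroot_nonzero mu' n H' H1) as z'.
    pose proof (kroot_lipschitz mu mu' n H H' H1) as Lz.
    pose proof (kroot_exp_bound mu n (Rabs x) H H1 (conj Hx0 Hx)) as U.
    pose proof (kroot_exp_bound mu' n (Rabs x) H' H1 (conj Hx0 Hx)) as U'.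
    set (k := kroot mu n) in *. set (k' := kroot mu' n) in *. fold d in Lz.
    set (e := Cmod (k - k')%C) in *. assert (He : 0 <= e) by apply Cmod_ge_0.
    assert (T2 : RtoC 2 <> RtoC 0) by (intros E; apply RtoC_inj in E; lra).
    assert (Hed : e <= d / (2 * c)).
    { unfold Rdiv. apply Rmult_le_reg_l with (2 * c); [lra|].
      replace (2 * c * (d * / (2 * c))) with d by (field; lra). exact Lz. }
    assert (Hd1 : d <= 1) by (unfold d; eapply Rle_trans; [apply Cmod_triangle_minus | lra]).
    assert (He1 : e * Rabs x <= 2 * Rs / c).
    { apply Rle_trans with (1 / (2 * c) * (2 * Rs)).
      - apply Rmult_le_compat; try lra. eapply Rle_trans; [exact Hed|].
        unfold Rdiv; apply Rmult_le_compat_r; lra.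
      - unfold Rdiv. replace (1 * / (2 * c) * (2 * Rs)) with (Rs * / c) by (field; lra).
        apply Rmult_le_compat_r; [left; apply Rinv_0_lt_compat; lra | lra]. }
    apply Rle_trans with ((/ (2 * c * c) * e) * exp (4 * Rs) + / (2 * c) * (EE * e)).
    + apply Cmod_mult_diff; [exact U | | |].
      * rewrite Cmod_inv, Cmod_mult, Cmod_R, Rabs_pos_eq; [|lra | apply Cmult_neq_0; assumption].
        apply Rinv_le_contravar; lra.
      * replace (/ (RtoC 2 * k) - / (RtoC 2 * k'))%C with (/ (RtoC 2 * k * k') * (k' - k))%C
          by (field; auto).
        apply Cmod_mult_le; [|rewrite Cmod_minus_sym; apply Rle_refl].
        assert (c * c <= Cmod k * Cmod k') by (apply Rmult_le_compat; lra).
        rewrite Cmod_inv, !Cmod_mult, Cmod_R, Rabs_pos_eq; [|lra | repeat apply Cmult_neq_0; assumption].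
        apply Rinv_le_contravar; nra.
      * eapply Rle_trans; [apply Cexp_diff_bound|].
        replace (- k * RtoC (Rabs x) - - k' * RtoC (Rabs x))%C with ((k' - k) * RtoC (Rabs x))%C by ring.
        rewrite Cmod_mult, Cmod_R, Rabs_Rabsolu, (Cmod_minus_sym k' k). fold e.
        apply Rle_trans with (exp (4 * Rs) * (3 * (e * (2 * Rs)) * exp (2 * Rs / c)));
          [|unfold EE; right; ring].
        assert (0 <= e * Rabs x) by (apply Rmult_le_pos; lra).
        apply Rmult_le_compat; [apply Cmod_ge_0 | | exact U' |].
        -- apply Rmult_le_pos; [lra | left; apply exp_pos].
        -- apply Rmult_le_compat; [lra | left; apply exp_pos | nra | apply exp_le_mono, He1].
    + apply Rle_trans with (L1 * d); [|nra].
      unfold L1. replace ((/ (2 * c * c) * exp (4 * Rs) + / (2 * c) * EE) / (2 * c) * d)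
        with ((/ (2 * c * c) * exp (4 * Rs) + / (2 * c) * EE) * (d / (2 * c))) by (unfold Rdiv; ring).
      replace (/ (2 * c * c) * e * exp (4 * Rs) + / (2 * c) * (EE * e))
        with ((/ (2 * c * c) * exp (4 * Rs) + / (2 * c) * EE) * e) by ring.
      apply Rmult_le_compat_l; [|exact Hed].
      pose proof (exp_pos (4 * Rs)); nra.
Qed.

Lemma Hker_continuous (mu : C) (n : Z) (x : R) : continuous (Hker mu beta n) x.
Proof.
  assert (E : forall a : C, continuous (fun x => Cexp (a * RtoC (Rabs x))%C) x).
  { intros a; apply continuous_Cexp, continuous_Cmult; [apply continuous_const|].
    apply continuous_RtoC, continuous_Rabs. }
  unfold Hker; destruct (Z.eq_dec n 0); [|destruct (Z.eq_dec n (-1))];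
    apply continuous_Cmult; try apply continuous_const; try apply E.
  apply continuous_Cminus; [apply E | apply continuous_const].
Qed.

Lemma Hker_even (mu : C) (n : Z) (x : R) : Hker mu beta n (- x) = Hker mu beta n x.
Proof. unfold Hker; rewrite Rabs_Ropp; reflexivity. Qed.

Lemma Hker_real (mu : R) (n : Z) (x : R) : Cmod (RtoC mu) <= mu_gap -> n <> 0%Z ->
  Im (Hker (RtoC mu) beta n x) = 0.
Proof.
  intros H H0.
  assert (R0 : forall z w : C, Im z = 0 -> Im w = 0 -> Im (z * w)%C = 0)
    by (intros z w E1 E2; rewrite Im_mult, E1, E2; ring).
  assert (RI : forall z : C, Im z = 0 -> Im (/ z)%C = 0).
  { intros [a b]; simpl; intros ->. unfold Rdiv; ring. }
  assert (RE : forall z : C, Im z = 0 -> Im (Cexp z) = 0).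
  { intros [a b]; simpl; intros ->. rewrite sin_0; ring. }
  assert (RM : forall z w : C, Im z = 0 -> Im w = 0 -> Im (z - w)%C = 0).
  { intros [a b] [a' b']; simpl; intros -> ->; ring. }
  assert (RN : forall z : C, Im z = 0 -> Im (- z)%C = 0).
  { intros [a b]; simpl; intros ->; ring. }
  unfold Hker; destruct (Z.eq_dec n 0); [contradiction|].
  destruct (Z.eq_dec n (-1)) as [E | H1].
  - apply R0; [apply RI, R0; reflexivity|]. apply RM; [|reflexivity].
    apply RE, R0; [apply RN|]; reflexivity.
  - pose proof (km_arg (RtoC mu) n H H0 H1) as A.
    assert (K : Im (km (RtoC mu) beta n) = 0).
    { unfold km. rewrite <- RtoC_mult, <- RtoC_plus in *. rewrite Csqrt_RtoC; [reflexivity|].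
      simpl in A. destruct mu_gap_bounds; lra. }
    apply R0; [apply RI, R0; [reflexivity | exact K]|].
    apply RE, R0; [apply RN; exact K | reflexivity].
Qed.

Lemma k0_real (mu : R) : Cmod (RtoC mu) <= mu_gap ->
  k0 (RtoC mu) beta = RtoC (sqrt (1 - 2 * beta - mu * mu)) /\ 0 < sqrt (1 - 2 * beta - mu * mu).
Proof.
  intros H. pose proof (k0_arg (RtoC mu) H) as A. destruct mu_gap_bounds.
  rewrite <- RtoC_mult, <- RtoC_minus in A; simpl in A.
  split; [|apply sqrt_lt_R0; lra].
  unfold k0. rewrite <- RtoC_mult, <- RtoC_minus. apply Csqrt_RtoC; lra.
Qed.

(** The cosine is even, so the absolute value disappears: the imaginary part is smooth and separates
    through the addition formula, which the real part sin(k|x|) does not. *)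
Lemma Hker_0_Im (mu : R) (x : R) : Cmod (RtoC mu) <= mu_gap ->
  Im (Hker (RtoC mu) beta 0 x) =
  cos (sqrt (1 - 2 * beta - mu * mu) * x) / (2 * sqrt (1 - 2 * beta - mu * mu)).
Proof.
  intros H; destruct (k0_real mu H) as [E P]. unfold Hker; destruct (Z.eq_dec 0 0) as [_ | N]; [|contradiction]. rewrite E.
  set (k := sqrt (1 - 2 * beta - mu * mu)) in *.
  assert (CA : cos (k * Rabs x) = cos (k * x)).
  { unfold Rabs; destruct (Rcase_abs x); [|reflexivity].
    replace (k * - x) with (- (k * x)) by ring. apply cos_neg. }
  rewrite <- CA.
  replace (Ci * RtoC k * RtoC (Rabs x))%C with ((0, (k * Rabs x)%R) : C)
    by (unfold Ci, Cmult, RtoC; simpl; f_equal; ring).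
  rewrite Cexp_im.
  replace (Ci / (RtoC 2 * RtoC k))%C with ((0, (/ (2 * k))%R) : C).
  - simpl. unfold Rdiv; ring.
  - rewrite <- RtoC_mult. unfold Cdiv. rewrite <- RtoC_inv by lra.
    unfold Ci, Cmult, RtoC; simpl; f_equal; field; lra.
Qed.

(** gamma is quadratic in mu, and the factor |mu| + |mu'| is retained: when both points are O(eps)
    the variation of gamma is O(eps) relative to |mu - mu'|. *)
Lemma gam_diff (mu mu' : C) :
  Cmod (gam mu beta - gam mu' beta)%C <= Cmod (mu - mu')%C * (Cmod mu + Cmod mu').
Proof.
  unfold gam.
  match goal with |- Cmod (?a * ?u - ?a * ?v)%C <= _ =>
    replace (a * u - a * v)%C with (a * ((mu' - mu) * (mu + mu')))%C by ring end.
  rewrite !Cmod_mult, Cmod_R, (Cmod_minus_sym mu' mu).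
  pose proof PI2_3_2. assert (I : 0 < / (4 * PI) <= 1).
  { split; [apply Rinv_0_lt_compat; lra|]. rewrite <- Rinv_1. apply Rinv_le_contravar; lra. }
  rewrite Rabs_pos_eq by lra.
  pose proof (Cmod_ge_0 (mu - mu')%C); pose proof (Cmod_triangle mu mu').
  pose proof (Cmod_ge_0 (mu + mu')%C).
  apply Rle_trans with (1 * (Cmod (mu - mu')%C * Cmod (mu + mu')%C)).
  - apply Rmult_le_compat_r; [nra | lra].
  - nra.
Qed.

Lemma gam_bound (mu : C) : Cmod mu <= mu_gap -> Cmod (gam mu beta) <= 1.
Proof.
  intros H. unfold gam. rewrite Cmod_mult, Cmod_R.
  pose proof PI2_3_2. assert (I : 0 < / (4 * PI) <= / 2).
  { split; [apply Rinv_0_lt_compat; lra|]. apply Rinv_le_contravar; lra. }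
  rewrite Rabs_pos_eq by lra.
  assert (X : Cmod (RtoC ((1 - beta) ^ 2) - mu * mu)%C <= 2).
  { eapply Rle_trans; [apply Cmod_triangle_minus|]. rewrite Cmod_R, Cmod_mult, Rabs_pos_eq by nra.
    pose proof (Cmod_ge_0 mu); destruct mu_gap_bounds; nra. }
  pose proof (Cmod_ge_0 (RtoC ((1 - beta) ^ 2) - mu * mu)%C). nra.
Qed.

End Kernels.

(** * The integral operator and its resolvent *)

Section Convolution.
Variable Rs : R.
Hypothesis HRs : 0 <= Rs.

Lemma conv_jc (h a : R -> C) : (forall x, continuous h x) -> (forall x, continuous a x) ->
  jointly_continuous (fun x xi => (h (x - xi)%R * a xi)%C).
Proof. intros Hh Ha; apply jc_Cmult; [apply (jc_diff h), Hh | apply jc_snd, Ha]. Qed.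

Lemma conv_continuous (h a : R -> C) (x : R) :
  (forall x, continuous h x) -> (forall x, continuous a x) -> continuous (conv Rs h a) x.
Proof.
  intros Hh Ha. apply (continuous_CInt_param (fun x xi => (h (x - xi)%R * a xi)%C)).
  apply conv_jc; assumption.
Qed.

(** With x and xi both in [-Rs, Rs] the kernel is sampled only on [-2 Rs, 2 Rs]; hence the range in
    every kernel hypothesis. *)
Lemma conv_bound (h a : R -> C) (x B M : R) :
  (forall x, continuous h x) -> (forall x, continuous a x) ->
  (forall x, Rabs x <= 2 * Rs -> Cmod (h x) <= B) -> (forall x, Cmod (a x) <= M) ->
  Rabs x <= Rs -> Cmod (conv Rs h a x) <= 4 * Rs * (B * M).
Proof.
  intros Hh Ha HB HM Hx. replace (4 * Rs * (B * M)) with (2 * (Rs - - Rs) * (B * M)) by ring.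
  apply CInt_bound; [lra | intros y; apply (jc_left _ x y (conv_jc h a Hh Ha)) |].
  intros y Hy; apply Cmod_mult_le; [apply HB | apply HM].
  apply Rabs_le_between in Hx; apply Rabs_le; lra.
Qed.

Lemma conv_diff (h h' a a' : R -> C) (x B M D d : R) :
  (forall x, continuous h x) -> (forall x, continuous a x) ->
  (forall x, continuous h' x) -> (forall x, continuous a' x) ->
  (forall x, Rabs x <= 2 * Rs -> Cmod (h' x) <= B) -> (forall x, Cmod (a x) <= M) ->
  (forall x, Rabs x <= 2 * Rs -> Cmod (h x - h' x)%C <= D) ->
  (forall x, Cmod (a x - a' x)%C <= d) ->
  Rabs x <= Rs -> Cmod (conv Rs h a x - conv Rs h' a' x)%C <= 4 * Rs * (D * M + B * d).
Proof.
  intros Hh Ha Hh' Ha' HB HM HD Hd Hx.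
  replace (4 * Rs * (D * M + B * d)) with (2 * (Rs - - Rs) * (D * M + B * d)) by ring.
  apply CInt_diff_bound; [lra | | |].
  - intros y; apply (jc_left _ x y (conv_jc h a Hh Ha)).
  - intros y; apply (jc_left _ x y (conv_jc h' a' Hh' Ha')).
  - intros y Hy.
    assert (Rabs (x - y) <= 2 * Rs)
      by (apply Rabs_le_between in Hx; apply Rabs_le; lra).
    apply Cmod_mult_diff; auto.
Qed.

End Convolution.

Definition bnd (M : R) (A : Z -> R -> C) : Prop := forall n x, Cmod (A n x) <= M.

Definition adiff (A B : Z -> R -> C) : Z -> R -> C := fun n x => (A n x - B n x)%C.

(** Iterating M -> a + M/2 from any a priori bound converges to the fixed point 2a. This plays the
    part of the contraction principle without setting up a normed space: a priori bounds, uniqueness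
    (a = 0) and stability of solutions are all instances. *)
Lemma bnd_contraction (A : Z -> R -> C) (a : R) :
  (exists M, bnd M A) -> (forall M, bnd M A -> bnd (a + M / 2) A) -> bnd (2 * a) A.
Proof.
  intros [M HM] Hc n x.
  assert (B : forall k, bnd (2 * a + (M - 2 * a) * (1 / 2) ^ k) A).
  { induction k as [|k IH].
    - intros m y; simpl. replace (2 * a + (M - 2 * a) * 1) with M by ring. apply HM.
    - intros m y. eapply Rle_trans; [apply (Hc _ IH)|]. simpl; right; field. }
  assert (L : is_lim_seq (fun k => 2 * a + (M - 2 * a) * (1 / 2) ^ k) (2 * a)).
  { replace (Finite (2 * a)) with (Finite (2 * a + (M - 2 * a) * 0)) by (f_equal; ring).
    apply is_lim_seq_plus'; [apply is_lim_seq_const|].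
    apply (is_lim_seq_scal_l (fun k => (1 / 2) ^ k) (M - 2 * a) 0), is_lim_seq_geom.
    rewrite Rabs_pos_eq; lra. }
  apply (is_lim_seq_le (fun _ => Cmod (A n x)) _ (Cmod (A n x)) (2 * a)
    (fun k => B k n x) (is_lim_seq_const _) L).
Qed.

Section Operator.
Variables (Rs B CH : R) (phi : Z -> R -> C).
Hypothesis HRs : 0 <= Rs.
Hypothesis HCH : 0 <= CH.
Hypothesis phi_decay : forall j x, Cmod (phi j x) <= B * wgt j.
Hypothesis phi_continuous : forall j x, continuous (phi j) x.
Hypothesis phi_support : forall j x, Rs < Rabs x -> phi j x = RtoC 0.

Definition good_kernel (H : Z -> R -> C) : Prop :=
  (forall n x, continuous (H n) x) /\ (forall n x, Rabs x <= 2 * Rs -> Cmod (H n x) <= CH).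

(** The operator stripped of its prefactor 2 gamma, so that mu enters only through the kernel family
    [H] and the scalar [c] of [sol], which can be perturbed separately. *)
Definition Sop (H A : Z -> R -> C) (m : Z) (x : R) : C :=
  Zsum (fun n => (conv Rs (H n) (A n) x * phi (m - n) x)%C).

(** The product of 12 pi (two-sided sum), 4 Rs (convolution) and B (Fourier decay); times [CH] it
    bounds the norm of [Sop]. *)
Definition opc : R := 48 * PI * Rs * B.

Lemma B_pos : 0 <= B.
Proof.
  pose proof (phi_decay 0 0) as H. pose proof (Cmod_ge_0 (phi 0%Z 0)). pose proof (wgt_pos 0). nra.
Qed.

Lemma opc_pos : 0 <= opc.
Proof.
  pose proof B_pos; pose proof PI_RGT_0; unfold opc.
  apply Rmult_le_pos; [apply Rmult_le_pos|]; lra.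
Qed.

Lemma Sop_dominated (H A : Z -> R -> C) (M : R) (m : Z) (x : R) :
  good_kernel H -> admissible Rs A -> bnd M A ->
  dominated m (4 * Rs * (CH * M) * B) (fun n => (conv Rs (H n) (A n) x * phi (m - n) x)%C).
Proof.
  intros [Hc Hb] [_ [Ac _]] HM n.
  assert (M0 : 0 <= M) by (eapply Rle_trans; [apply Cmod_ge_0 | apply (HM 0%Z 0)]).
  destruct (Rlt_dec Rs (Rabs x)) as [Hx | Hx].
  - rewrite phi_support, Cmult_0_r, Cmod_0 by exact Hx.
    pose proof B_pos. pose proof (wgt_pos (m - n)). repeat apply Rmult_le_pos; lra.
  - rewrite Rmult_assoc. apply Cmod_mult_le; [|apply phi_decay].
    apply conv_bound; auto; lra.
Qed.

Lemma Sop_bound (H A : Z -> R -> C) (M : R) :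
  good_kernel H -> admissible Rs A -> bnd M A -> bnd (opc * CH * M) (Sop H A).
Proof.
  intros HH HA HM m x.
  eapply Rle_trans; [apply (Zsum_bound m), (Sop_dominated H A M m x HH HA HM)|].
  unfold opc; right; ring.
Qed.

Lemma Sop_continuous (H A : Z -> R -> C) (m : Z) (x : R) :
  good_kernel H -> admissible Rs A -> continuous (Sop H A m) x.
Proof.
  intros HH HA. destruct HA as [[M HM] HA'].
  apply (continuous_Zsum m (4 * Rs * (CH * M) * B)
    (fun n x => (conv Rs (H n) (A n) x * phi (m - n) x)%C)).
  - intros y; apply (Sop_dominated H A M m y HH (conj (ex_intro _ M HM) HA') HM).
  - intros n y; apply continuous_Cmult; [|apply phi_continuous].
    apply conv_continuous; [apply HH | apply HA'].
Qed.

Lemma Sop_support (H A : Z -> R -> C) (m : Z) (x : R) : Rs < Rabs x -> Sop H A m x = RtoC 0.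
Proof.
  intros Hx. apply Cmod_eq_0, Rle_antisym; [|apply Cmod_ge_0].
  replace 0 with (12 * PI * 0) by ring. apply (Zsum_bound m); intros n.
  rewrite phi_support, Cmult_0_r, Cmod_0 by exact Hx; lra.
Qed.

(** Kernel and sequence vary together. The difference is formed inside the sum and only then
    estimated term by term, so the common factor [phi] supplies the summable weight once. *)
Lemma Sop_diff (H H' A A' : Z -> R -> C) (D d M : R) :
  good_kernel H -> good_kernel H' -> admissible Rs A -> admissible Rs A' -> bnd M A ->
  (forall n x, Rabs x <= 2 * Rs -> Cmod (H n x - H' n x)%C <= D) -> bnd d (adiff A A') ->
  bnd (opc * (D * M + CH * d)) (adiff (Sop H A) (Sop H' A')).
Proof.
  intros HH HH' HA HA' HM HD Hd m x.
  destruct (HA') as [[M' HM'] _].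
  assert (M0 : 0 <= M) by (eapply Rle_trans; [apply Cmod_ge_0 | apply (HM 0%Z 0)]).
  assert (d0 : 0 <= d) by (eapply Rle_trans; [apply Cmod_ge_0 | apply (Hd 0%Z 0)]).
  assert (D0 : 0 <= D).
  { eapply Rle_trans; [apply Cmod_ge_0 | apply (HD 0%Z 0)]. rewrite Rabs_R0; lra. }
  unfold adiff, Sop.
  rewrite <- (Zsum_minus m _ _ _ _ (Sop_dominated H A M m x HH HA HM)
    (Sop_dominated H' A' M' m x HH' HA' HM')).
  replace (opc * (D * M + CH * d)) with (12 * PI * (4 * Rs * (D * M + CH * d) * B))
    by (unfold opc; ring).
  apply (Zsum_bound m); intros n.
  replace (conv Rs (H n) (A n) x * phi (m - n)%Z x - conv Rs (H' n) (A' n) x * phi (m - n)%Z x)%C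
    with ((conv Rs (H n) (A n) x - conv Rs (H' n) (A' n) x) * phi (m - n)%Z x)%C by ring.
  destruct (Rlt_dec Rs (Rabs x)) as [Hx | Hx].
  - rewrite phi_support, Cmult_0_r, Cmod_0 by exact Hx.
    pose proof B_pos; pose proof (wgt_pos (m - n)).
    assert (0 <= D * M + CH * d) by nra. repeat apply Rmult_le_pos; lra.
  - rewrite Rmult_assoc. apply Cmod_mult_le; [|apply phi_decay].
    apply conv_diff; try lra; try apply HH; try apply HH'; try apply HA; try apply HA'.
    + intros y; apply HM.
    + intros y; apply HD.
    + intros y; apply Hd.
Qed.

Definition sol (c : C) (H g A : Z -> R -> C) : Prop :=
  forall m x, (A m x - c * Sop H A m x)%C = g m x.

Lemma adiff_bnd (A A' : Z -> R -> C) (M M' : R) :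
  bnd M A -> bnd M' A' -> bnd (M + M') (adiff A A').
Proof.
  intros H H' n x. eapply Rle_trans; [apply Cmod_triangle_minus|].
  apply Rplus_le_compat; [apply H | apply H'].
Qed.

Section Contraction.
Variables (c : C) (H g : Z -> R -> C).
Hypothesis HH : good_kernel H.
Hypothesis small : Cmod c * (opc * CH) <= 1 / 2.
Hypothesis Hg : admissible Rs g.

Lemma c_Sop_bound (A : Z -> R -> C) (M : R) (m : Z) (x : R) :
  admissible Rs A -> bnd M A -> Cmod (c * Sop H A m x)%C <= Cmod c * (opc * CH) * M.
Proof.
  intros HA HM. rewrite Cmod_mult. pose proof (Sop_bound H A M HH HA HM m x).
  rewrite Rmult_assoc. apply Rmult_le_compat_l; [apply Cmod_ge_0 | assumption].
Qed.

Lemma c_Sop_diff (A A' : Z -> R -> C) (d : R) (m : Z) (x : R) :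
  admissible Rs A -> admissible Rs A' -> bnd d (adiff A A') ->
  Cmod (c * Sop H A m x - c * Sop H A' m x)%C <= Cmod c * (opc * CH) * d.
Proof.
  intros HA HA' Hd.
  replace (c * Sop H A m x - c * Sop H A' m x)%C with (c * (Sop H A m x - Sop H A' m x))%C by ring.
  rewrite Cmod_mult. destruct HA as [[M HM] HA0].
  assert (Z0 : forall n x, Rabs x <= 2 * Rs -> Cmod (H n x - H n x)%C <= 0).
  { intros n y _. replace (H n y - H n y)%C with (RtoC 0) by ring. rewrite Cmod_0; lra. }
  pose proof (Sop_diff H H A A' 0 d M HH HH (conj (ex_intro _ M HM) HA0) HA' HM Z0 Hd m x) as E.
  rewrite Rmult_assoc. apply Rmult_le_compat_l; [apply Cmod_ge_0|].
  eapply Rle_trans; [exact E | right; ring].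
Qed.

Lemma sol_unique (A A' : Z -> R -> C) : admissible Rs A -> admissible Rs A' ->
  sol c H g A -> sol c H g A' -> forall n x, A' n x = A n x.
Proof.
  intros HA HA' SA SA' n x.
  assert (E : bnd (2 * 0) (adiff A' A)).
  { apply bnd_contraction.
    - destruct HA as [[M HM] _], HA' as [[M' HM'] _].
      exists (M' + M); apply adiff_bnd; assumption.
    - intros M HM m y. unfold adiff.
      replace (A' m y - A m y)%C with (c * Sop H A' m y - c * Sop H A m y)%C.
      + eapply Rle_trans; [apply (c_Sop_diff A' A M m y HA' HA HM)|].
        assert (0 <= M) by (eapply Rle_trans; [apply Cmod_ge_0 | apply (HM m y)]). nra.
      + specialize (SA m y); specialize (SA' m y). rewrite <- SA in SA'.
        replace (A' m y) with ((A' m y - c * Sop H A' m y) + c * Sop H A' m y)%C by ring.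
        rewrite SA'; ring. }
  specialize (E n x). unfold adiff in E.
  assert (E0 : (A' n x - A n x)%C = RtoC 0).
  { apply Cmod_eq_0, Rle_antisym; [lra | apply Cmod_ge_0]. }
  replace (A' n x) with ((A' n x - A n x) + A n x)%C by ring. rewrite E0; ring.
Qed.

Lemma sol_bound (A : Z -> R -> C) (G : R) :
  admissible Rs A -> sol c H g A -> bnd G g -> bnd (2 * G) A.
Proof.
  intros HA SA HG. apply bnd_contraction; [apply HA|].
  intros M HM m x.
  replace (A m x) with (g m x + c * Sop H A m x)%C by (rewrite <- (SA m x); ring).
  eapply Rle_trans; [apply Cmod_triangle|]. apply Rplus_le_compat; [apply HG|].
  eapply Rle_trans; [apply (c_Sop_bound A M m x HA HM)|].
  assert (0 <= M) by (eapply Rle_trans; [apply Cmod_ge_0 | apply (HM m x)]). nra.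
Qed.

Lemma sol_order0 (A : Z -> R -> C) (G : R) :
  admissible Rs A -> sol c H g A -> bnd G g -> bnd (Cmod c * (opc * CH) * (2 * G)) (adiff A g).
Proof.
  intros HA SA HG m x. unfold adiff.
  replace (A m x - g m x)%C with (c * Sop H A m x)%C by (rewrite <- (SA m x); ring).
  apply c_Sop_bound; [exact HA | apply sol_bound; assumption].
Qed.

(** Inserting the zeroth-order error back into A = g + c S A squares the small factor. Only Im F
    needs this second order. *)
Lemma sol_order1 (A : Z -> R -> C) (G : R) (m : Z) (x : R) :
  admissible Rs A -> sol c H g A -> bnd G g ->
  Cmod (A m x - (g m x + c * Sop H g m x))%C <=
    Cmod c * (opc * CH) * (Cmod c * (opc * CH) * (2 * G)).
Proof.
  intros HA SA HG.
  replace (A m x - (g m x + c * Sop H g m x))%C with (c * Sop H A m x - c * Sop H g m x)%C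
    by (rewrite <- (SA m x); ring).
  apply c_Sop_diff; [exact HA | exact Hg | apply sol_order0; assumption].
Qed.

Fixpoint picard (k : nat) : Z -> R -> C :=
  match k with
  | O => g
  | S k' => fun m x => (g m x + c * Sop H (picard k') m x)%C
  end.

Lemma picard_admissible (k : nat) : admissible Rs (picard k).
Proof.
  induction k as [|k IH]; [exact Hg|].
  destruct Hg as [[G HG] [gc gs]]. pose proof IH as IH'. destruct IH as [[M HM] _].
  split; [|split].
  - exists (G + Cmod c * (opc * CH) * M); intros n x; simpl.
    eapply Rle_trans; [apply Cmod_triangle|].
    apply Rplus_le_compat; [apply HG | apply c_Sop_bound; assumption].
  - intros n x; simpl. apply continuous_Cplus; [apply gc|].
    apply continuous_Cmult; [apply continuous_const | apply Sop_continuous; assumption].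
  - intros n x Hx; simpl. rewrite gs, Sop_support by exact Hx; ring.
Qed.

(** Increments of the Picard iteration, starting with [g] itself, so that the N-th iterate is
    exactly a partial sum: the Neumann series in disguise. *)
Definition pstep (k : nat) : Z -> R -> C :=
  match k with O => g | S k' => adiff (picard (S k')) (picard k') end.

Lemma pstep_bound (G : R) : bnd G g -> forall k, bnd (G * (1 / 2) ^ k) (pstep k).
Proof.
  intros HG. assert (G0 : 0 <= G) by (eapply Rle_trans; [apply Cmod_ge_0 | apply (HG 0%Z 0)]).
  induction k as [|[|k] IH]; intros m x.
  - simpl; rewrite Rmult_1_r; apply HG.
  - unfold pstep, adiff; simpl.
    replace (g m x + c * Sop H g m x - g m x)%C with (c * Sop H g m x)%C by ring.
    eapply Rle_trans; [apply (c_Sop_bound g G m x Hg HG)|]. nra.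
  - unfold pstep, adiff.
    change (picard (S (S k)) m x - picard (S k) m x)%C with
      ((g m x + c * Sop H (picard (S k)) m x) - (g m x + c * Sop H (picard k) m x))%C.
    replace ((g m x + c * Sop H (picard (S k)) m x) - (g m x + c * Sop H (picard k) m x))%C
      with (c * Sop H (picard (S k)) m x - c * Sop H (picard k) m x)%C by ring.
    eapply Rle_trans;
      [apply (c_Sop_diff _ _ _ m x (picard_admissible (S k)) (picard_admissible k) IH)|].
    replace (G * (1 / 2) ^ S (S k)) with (1 / 2 * (G * (1 / 2) ^ S k)) by (simpl; ring).
    apply Rmult_le_compat_r; [|exact small].
    apply Rmult_le_pos; [exact G0 | apply pow_le; lra].
Qed.

Lemma picard_sum (N : nat) (n : Z) (x : R) :
  picard N n x = (sum_n (fun k => Re (pstep k n x)) N, sum_n (fun k => Im (pstep k n x)) N).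
Proof.
  induction N as [|N IH].
  - rewrite !sum_O; destruct (g n x) eqn:E; simpl; rewrite E; reflexivity.
  - rewrite !sum_Sn.
    replace (picard (S N) n x) with (picard N n x + pstep (S N) n x)%C
      by (unfold pstep, adiff; ring).
    rewrite IH; reflexivity.
Qed.

Lemma sol_exists : exists A, admissible Rs A /\ sol c H g A.
Proof.
  destruct (Hg) as [[G HG] _].
  assert (G0 : 0 <= G) by (eapply Rle_trans; [apply Cmod_ge_0 | apply (HG 0%Z 0)]).
  set (b := fun k => G * (1 / 2) ^ k).
  assert (Hb : ex_series b).
  { apply (ex_series_scal (V := R_NormedModule) G), ex_series_geom; rewrite Rabs_pos_eq; lra. }
  pose proof (pstep_bound G HG) as PB.
  assert (PR : forall n k x, Rabs (Re (pstep k n x)) <= b k)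
    by (intros; eapply Rle_trans; [apply re_le_Cmod | apply PB]).
  assert (BIm : forall n k x, Rabs (Im (pstep k n x)) <= b k)
    by (intros; eapply Rle_trans; [apply im_le_Cmod | apply PB]).
  assert (PC : forall k n x, continuous (pstep k n) x).
  { intros [|k] n x; [apply Hg|]. unfold pstep, adiff.
    apply continuous_Cminus; [apply (picard_admissible (S k)) | apply picard_admissible]. }
  set (A := fun n x => ((Series (fun k => Re (pstep k n x)), Series (fun k => Im (pstep k n x))) : C)).
  set (tl := fun N => Series b - sum_n b N).
  (* Twice the geometric tail, once for each component; the bound is uniform in both the mode and x,
     so it can be fed to the operator. *)
  assert (T : forall N, bnd (2 * tl N) (adiff A (picard N))).
  { intros N n x. unfold adiff; rewrite picard_sum.
    eapply Rle_trans; [apply Cmod_le_ReIm|].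
    pose proof (Series_tail_bound (fun k => Re (pstep k n x)) b N (fun k => PR n k x) Hb) as T1.
    pose proof (Series_tail_bound (fun k => Im (pstep k n x)) b N (fun k => BIm n k x) Hb) as T2.
    fold (tl N) in T1, T2. replace (2 * tl N) with (tl N + tl N) by ring. apply Rplus_le_compat; [exact T1 | exact T2]. }
  assert (HA : admissible Rs A).
  { split; [|split].
    - destruct (picard_admissible 0) as [[M HM] _]. exists (M + 2 * tl 0%nat); intros n x.
      eapply Rle_trans; [apply (Cmod_le_plus _ (picard 0 n x))|].
      apply Rplus_le_compat; [apply HM | apply T].
    - intros n x; apply continuous_C_pair; simpl.
      + apply (continuous_Series (fun k y => Re (pstep k n y)) b x (PR n) Hb).
        intros k; apply continuous_Re, PC.
      + apply (continuous_Series (fun k y => Im (pstep k n y)) b x (BIm n) Hb).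
        intros k; apply continuous_Im, PC.
    - intros n x Hx.
      assert (P0 : forall k, pstep k n x = RtoC 0).
      { intros [|k]; [apply Hg, Hx|]. unfold pstep, adiff.
        destruct (picard_admissible (S k)) as [_ [_ Z1]], (picard_admissible k) as [_ [_ Z2]].
        rewrite Z1, Z2 by exact Hx; ring. }
      assert (S0 : Series (fun _ => 0) = 0).
      { rewrite (Series_ext _ (fun k => 0 * b k)) by (intros; ring). rewrite Series_scal_l; ring. }
      apply C_ext; (etransitivity; [|exact S0]);
        apply Series_ext; intros k; rewrite P0; reflexivity. }
  exists A; split; [exact HA|]. intros m x.
  (* The residual of the limit is compared with the identity between consecutive iterates N and N +
     1; both discrepancies are tails of the geometric series and tend to 0. *)
  assert (L0 : forall N, Cmod ((A m x - c * Sop H A m x) - g m x)%C <= 2 * tl (S N) + tl N).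
  { intros N.
    replace ((A m x - c * Sop H A m x) - g m x)%C
      with ((A m x - picard (S N) m x) - (c * Sop H A m x - c * Sop H (picard N) m x))%C
      by (simpl; ring).
    eapply Rle_trans; [apply Cmod_triangle_minus|].
    apply Rplus_le_compat; [apply (T (S N))|].
    eapply Rle_trans; [apply (c_Sop_diff _ _ _ m x HA (picard_admissible N) (T N))|].
    assert (0 <= 2 * tl N) by (eapply Rle_trans; [apply Cmod_ge_0 | apply (T N m x)]). nra. }
  assert (LT : is_lim_seq tl 0).
  { replace (Finite 0) with (Finite (Series b - Series b)) by (f_equal; ring).
    apply is_lim_seq_minus'; [apply is_lim_seq_const|]. apply (Series_correct b Hb). }
  assert (LL : is_lim_seq (fun N => 2 * tl (S N) + tl N) 0).
  { replace (Finite 0) with (Finite (2 * 0 + 0)) by (f_equal; ring).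
    apply is_lim_seq_plus'; [|exact LT].
    apply (is_lim_seq_scal_l (fun N => tl (S N)) 2 0), is_lim_seq_incr_1 with (u := tl), LT. }
  assert (E : Cmod ((A m x - c * Sop H A m x) - g m x)%C <= 0)
    by exact (is_lim_seq_le (fun _ => Cmod ((A m x - c * Sop H A m x) - g m x)%C) _ _ 0
      L0 (is_lim_seq_const _) LL).
  assert (E0 : ((A m x - c * Sop H A m x) - g m x)%C = RtoC 0).
  { apply Cmod_eq_0, Rle_antisym; [exact E | apply Cmod_ge_0]. }
  replace (A m x - c * Sop H A m x)%C with (((A m x - c * Sop H A m x) - g m x) + g m x)%C by ring.
  rewrite E0; ring.
Qed.

End Contraction.

(** Subtract the equations: A - A' = c (S A - S' A') + (c - c') S' A'. The unknown difference
    reappears with coefficient at most 1/2 and is absorbed by [bnd_contraction]. The factor 4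
    combines this step with the a priori bound 2G. *)
Lemma sol_perturb (c c' : C) (H H' g A A' : Z -> R -> C) (G D : R) :
  good_kernel H -> good_kernel H' -> admissible Rs g -> bnd G g ->
  Cmod c * (opc * CH) <= 1 / 2 -> Cmod c' * (opc * CH) <= 1 / 2 ->
  admissible Rs A -> admissible Rs A' -> sol c H g A -> sol c' H' g A' ->
  (forall n x, Rabs x <= 2 * Rs -> Cmod (H n x - H' n x)%C <= D) ->
  bnd (4 * G * opc * (Cmod c * D + Cmod (c - c')%C * CH)) (adiff A A').
Proof.
  intros HH HH' Hg HG sm sm' HA HA' SA SA' HD.
  pose proof (sol_bound c H g HH sm A G HA SA HG) as BA.
  pose proof (sol_bound c' H' g HH' sm' A' G HA' SA' HG) as BA'.
  replace (4 * G * opc * (Cmod c * D + Cmod (c - c')%C * CH))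
    with (2 * (Cmod c * (opc * (D * (2 * G))) + Cmod (c - c')%C * (opc * CH * (2 * G)))) by ring.
  apply bnd_contraction.
  { exists (2 * G + 2 * G). apply adiff_bnd; assumption. }
  intros M HM m x.
  assert (M0 : 0 <= M) by (eapply Rle_trans; [apply Cmod_ge_0 | apply (HM m x)]).
  unfold adiff.
  replace (A m x - A' m x)%C
    with (c * (Sop H A m x - Sop H' A' m x) + (c - c') * Sop H' A' m x)%C.
  2:{ replace (A m x) with (g m x + c * Sop H A m x)%C by (rewrite <- (SA m x); ring).
      replace (A' m x) with (g m x + c' * Sop H' A' m x)%C by (rewrite <- (SA' m x); ring). ring. }
  eapply Rle_trans; [apply Cmod_triangle|]. rewrite !Cmod_mult.
  pose proof (Sop_diff H H' A A' D M (2 * G) HH HH' HA HA' BA HD HM m x) as E1.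
  pose proof (Sop_bound H' A' (2 * G) HH' HA' BA' m x) as E2.
  unfold adiff in E1.
  apply (Rmult_le_compat_l _ _ _ (Cmod_ge_0 c)) in E1.
  apply (Rmult_le_compat_l _ _ _ (Cmod_ge_0 (c - c')%C)) in E2.
  assert (Cmod c * (opc * CH) * M <= 1 / 2 * M) by (apply Rmult_le_compat_r; assumption).
  replace (Cmod c * (opc * (D * (2 * G) + CH * M)))
    with (Cmod c * (opc * (D * (2 * G))) + Cmod c * (opc * CH) * M) in E1 by ring.
  lra.
Qed.

End Operator.

(** * Imaginary part of the quadratic form of an even kernel *)

(* Equations produced by [RInt_ext] live in the carrier of a normed module, which [ring] does
   not recognise as [R]. *)
Ltac ring_R := match goal with |- @eq _ ?u ?v => change (@eq R u v); ring end.

(** Four terms: cosine and sine, each paired with the real and imaginary part of [a]. It serves both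
    the inner and the outer integral. *)
Lemma RInt_lin4 (u1 u2 u3 u4 : R -> R) (a1 a2 a3 a4 a b : R) :
  (forall x, continuous u1 x) -> (forall x, continuous u2 x) ->
  (forall x, continuous u3 x) -> (forall x, continuous u4 x) ->
  RInt (fun t => a1 * u1 t + a2 * u2 t + a3 * u3 t + a4 * u4 t) a b =
  a1 * RInt u1 a b + a2 * RInt u2 a b + a3 * RInt u3 a b + a4 * RInt u4 a b.
Proof.
  intros H1 H2 H3 H4.
  assert (E : forall u k, (forall x, continuous u x) ->
    is_RInt (fun t => k * u t) a b (k * RInt u a b)).
  { intros u k Hu. apply (is_RInt_scal (V := R_NormedModule) u).
    apply (RInt_correct (V := R_CompleteNormedModule)).
    apply (ex_RInt_continuous (V := R_CompleteNormedModule)); auto. }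
  apply (is_RInt_unique (V := R_CompleteNormedModule)).
  exact (is_RInt_plus (V := R_NormedModule) _ _ _ _ _ _
    (is_RInt_plus (V := R_NormedModule) _ _ _ _ _ _
      (is_RInt_plus (V := R_NormedModule) _ _ _ _ _ _ (E u1 a1 H1) (E u2 a2 H2))
      (E u3 a3 H3)) (E u4 a4 H4)).
Qed.

Section QuadraticForm.
Variables (Rs : R) (h a : R -> C).
Hypothesis HRs : 0 < Rs.
Hypothesis h_continuous : forall x, continuous h x.
Hypothesis h_even : forall x, h (- x) = h x.
Hypothesis a_continuous : forall x, continuous a x.

(* The real part of an even kernel is symmetric, so that its contribution
   [Re h (x - xi) * Im (a xi * Cconj (a x))] is antisymmetric in [(x, xi)] and drops out. *)
Lemma Im_quadratic_form :
  Im (CInt (fun x => (conv Rs h a x * Cconj (a x))%C) (- Rs) Rs) =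
  RInt (fun x => RInt (fun xi => Im (h (x - xi)) * (Re (a x) * Re (a xi) + Im (a x) * Im (a xi)))
    (- Rs) Rs) (- Rs) Rs.
Proof.
  assert (p_c : forall x, continuous (fun t => Re (a t)) x) by (intros; apply continuous_Re, a_continuous).
  assert (q_c : forall x, continuous (fun t => Im (a t)) x) by (intros; apply continuous_Im, a_continuous).
  assert (hr_c : forall x, continuous (fun t => Re (h t)) x) by (intros; apply continuous_Re, h_continuous).
  assert (hi_c : forall x, continuous (fun t => Im (h t)) x) by (intros; apply continuous_Im, h_continuous).
  set (K1 := fun x xi => Im (h (x - xi)) * (Re (a x) * Re (a xi) + Im (a x) * Im (a xi))).
  set (K2 := fun x xi => Re (h (x - xi)) * (Re (a x) * Im (a xi) - Im (a x) * Re (a xi))).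
  pose proof (jc_fst (fun t => Re (a t)) p_c) as p1; pose proof (jc_snd (fun t => Re (a t)) p_c) as p2.
  pose proof (jc_fst (fun t => Im (a t)) q_c) as q1; pose proof (jc_snd (fun t => Im (a t)) q_c) as q2.
  assert (J1 : jointly_continuous K1)
    by exact (jc_Rmult _ _ (jc_diff (fun t => Im (h t)) hi_c)
      (jc_Rplus _ _ (jc_Rmult _ _ p1 p2) (jc_Rmult _ _ q1 q2))).
  assert (J2 : jointly_continuous K2)
    by exact (jc_Rmult _ _ (jc_diff (fun t => Re (h t)) hr_c)
      (jc_Rminus _ _ (jc_Rmult _ _ p1 q2) (jc_Rmult _ _ q1 p2))).
  (* Fubini exchanges the two integrations, and evenness of [h] gives K2 t x = - K2 x t; the
     integral therefore equals its own opposite. *)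
  assert (E2 : RInt (fun x => RInt (K2 x) (- Rs) Rs) (- Rs) Rs = 0).
  { assert (F : RInt (fun x => RInt (fun xi => K2 x xi) (- Rs) Rs) (- Rs) Rs =
      RInt (fun xi => RInt (fun x => K2 x xi) (- Rs) Rs) (- Rs) Rs)
      by (apply RInt_fubini; [lra | exact J2]).
    assert (N : RInt (fun xi => RInt (fun x => K2 x xi) (- Rs) Rs) (- Rs) Rs =
      - RInt (fun x => RInt (K2 x) (- Rs) Rs) (- Rs) Rs).
    { transitivity (RInt (fun x => - RInt (K2 x) (- Rs) Rs) (- Rs) Rs).
      - apply RInt_ext; intros x _.
        transitivity (RInt (fun t => - K2 x t) (- Rs) Rs).
        + apply RInt_ext; intros t _; unfold K2.
          replace (x - t) with (- (t - x)) by ring. rewrite h_even; ring_R.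
        + apply (RInt_opp (V := R_CompleteNormedModule) (K2 x)).
          apply (ex_RInt_continuous (V := R_CompleteNormedModule)); intros; apply jc_left, J2.
      - apply (RInt_opp (V := R_CompleteNormedModule) (fun x => RInt (K2 x) (- Rs) Rs)).
        apply (ex_RInt_continuous (V := R_CompleteNormedModule)); intros.
        apply continuous_RInt_param, J2. }
    change (RInt (fun x => RInt (K2 x) (- Rs) Rs) (- Rs) Rs =
      RInt (fun xi => RInt (fun x => K2 x xi) (- Rs) Rs) (- Rs) Rs) in F.
    lra. }
  transitivity (RInt (fun x => RInt (K1 x) (- Rs) Rs + RInt (K2 x) (- Rs) Rs) (- Rs) Rs).
  - unfold CInt at 1; cbn [Im snd]. apply RInt_ext; intros x _.
    transitivity (RInt (fun xi => K1 x xi + K2 x xi) (- Rs) Rs).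
    + change (Im (conv Rs h a x * Cconj (a x))%C = RInt (fun xi => K1 x xi + K2 x xi) (- Rs) Rs).
      unfold conv. rewrite Cmult_comm, <- CInt_scal.
      * unfold CInt; cbn [Im snd]. apply RInt_ext; intros xi _.
        change (Im (Cconj (a x) * (h (x - xi)%R * a xi))%C = K1 x xi + K2 x xi).
        unfold K1, K2. rewrite !Im_mult, !Re_mult, re_conj, im_conj. ring.
      * intros xi. apply (jc_left _ x xi (conv_jc h a h_continuous a_continuous)).
    + apply (RInt_plus (V := R_CompleteNormedModule) (K1 x) (K2 x));
        apply (ex_RInt_continuous (V := R_CompleteNormedModule)); intros; apply jc_left; assumption.
  - transitivity (RInt (fun x => RInt (K1 x) (- Rs) Rs) (- Rs) Rs
                  + RInt (fun x => RInt (K2 x) (- Rs) Rs) (- Rs) Rs).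
    + apply (RInt_plus (V := R_CompleteNormedModule));
        apply (ex_RInt_continuous (V := R_CompleteNormedModule)); intros;
        apply continuous_RInt_param; assumption.
    + rewrite E2, Rplus_0_r; reflexivity.
Qed.

(** The addition formula for cos(kx - k xi) separates the double integral into (I1^2 + I2^2 + I3^2 +
    I4^2) / (2k). The transforms at k and -k are (I1 + I4, I3 - I2) and (I1 - I4, I3 + I2), so their
    squared moduli add up to twice the sum of squares; hence 1/(4k). *)
Lemma cos_quadratic_form (k : R) :
  (forall x, Im (h x) = cos (k * x) / (2 * k)) ->
  Im (CInt (fun x => (conv Rs h a x * Cconj (a x))%C) (- Rs) Rs) =
  / (4 * k) * (Cmod (CInt (fun x => (Cexp (0%R, (- k * x)%R) * a x)%C) (- Rs) Rs) ^ 2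
             + Cmod (CInt (fun x => (Cexp (0%R, (- - k * x)%R) * a x)%C) (- Rs) Rs) ^ 2).
Proof.
  intros Hk. rewrite Im_quadratic_form.
  assert (p_c : forall x, continuous (fun t => Re (a t)) x) by (intros; apply continuous_Re, a_continuous).
  assert (q_c : forall x, continuous (fun t => Im (a t)) x) by (intros; apply continuous_Im, a_continuous).
  assert (c_c : forall x, continuous (fun t => cos (k * t)) x).
  { intros x; apply (ex_derive_continuous (V := R_NormedModule) (fun t => cos (k * t))). auto_derive; exact I. }
  assert (s_c : forall x, continuous (fun t => sin (k * t)) x).
  { intros x; apply (ex_derive_continuous (V := R_NormedModule) (fun t => sin (k * t))). auto_derive; exact I. }
  set (u1 := fun t => cos (k * t) * Re (a t)). set (u2 := fun t => sin (k * t) * Re (a t)).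
  set (u3 := fun t => cos (k * t) * Im (a t)). set (u4 := fun t => sin (k * t) * Im (a t)).
  assert (C1 : forall x, continuous u1 x) by (intros; apply (continuous_mult (K := R_AbsRing)); auto).
  assert (C2 : forall x, continuous u2 x) by (intros; apply (continuous_mult (K := R_AbsRing)); auto).
  assert (C3 : forall x, continuous u3 x) by (intros; apply (continuous_mult (K := R_AbsRing)); auto).
  assert (C4 : forall x, continuous u4 x) by (intros; apply (continuous_mult (K := R_AbsRing)); auto).
  set (I1 := RInt u1 (- Rs) Rs). set (I2 := RInt u2 (- Rs) Rs).
  set (I3 := RInt u3 (- Rs) Rs). set (I4 := RInt u4 (- Rs) Rs).
  assert (F : forall s : R, s = 1 \/ s = -1 ->
    CInt (fun x => (Cexp (0%R, (- (s * k) * x)%R) * a x)%C) (- Rs) Rs = (I1 + s * I4, I3 - s * I2)).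
  { intros s Hs. unfold CInt.
    assert (Ex : forall x, Cexp (0, - (s * k) * x) = (cos (k * x), - s * sin (k * x))).
    { intros x; rewrite Cexp_im. destruct Hs as [-> | ->].
      - replace (- (1 * k) * x) with (- (k * x)) by ring. rewrite cos_neg, sin_neg; f_equal; ring.
      - replace (- (-1 * k) * x) with (k * x) by ring. f_equal; ring. }
    f_equal.
    - transitivity (RInt (fun t => 1 * u1 t + 0 * u2 t + 0 * u3 t + s * u4 t) (- Rs) Rs).
      + apply RInt_ext; intros x _; rewrite Ex, Re_mult; unfold u1, u4; simpl; ring_R.
      + rewrite RInt_lin4 by assumption; unfold I1, I4; ring_R.
    - transitivity (RInt (fun t => 0 * u1 t + - s * u2 t + 1 * u3 t + 0 * u4 t) (- Rs) Rs).
      + apply RInt_ext; intros x _; rewrite Ex, Im_mult; unfold u2, u3; simpl; ring_R.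
      + rewrite RInt_lin4 by assumption; unfold I2, I3; ring_R. }
  pose proof (F 1 (or_introl eq_refl)) as F1. pose proof (F (-1) (or_intror eq_refl)) as F2.
  replace (1 * k) with k in F1 by ring. replace (-1 * k) with (- k) in F2 by ring.
  rewrite F1, F2, !Cmod2_alt; simpl Re; simpl Im.
  transitivity (RInt (fun x => (/ (2 * k) * I1) * u1 x + (/ (2 * k) * I2) * u2 x
                             + (/ (2 * k) * I3) * u3 x + (/ (2 * k) * I4) * u4 x) (- Rs) Rs).
  - apply RInt_ext; intros x _.
    transitivity (RInt (fun xi => (/ (2 * k) * u1 x) * u1 xi + (/ (2 * k) * u2 x) * u2 xi
                      + (/ (2 * k) * u3 x) * u3 xi + (/ (2 * k) * u4 x) * u4 xi) (- Rs) Rs).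
    + apply RInt_ext; intros xi _. rewrite Hk.
      replace (k * (x - xi)) with (k * x - k * xi) by ring. rewrite cos_minus.
      unfold u1, u2, u3, u4, Rdiv; ring_R.
    + rewrite RInt_lin4 by assumption. fold I1 I2 I3 I4; ring_R.
  - rewrite RInt_lin4 by assumption. fold I1 I2 I3 I4.
    replace (/ (4 * k)) with (/ 2 * / (2 * k)) by (rewrite <- Rinv_mult; f_equal; ring).
    match goal with |- @eq _ ?u ?v => change (@eq R u v) end. set (kk := / (2 * k)). field.
Qed.

End QuadraticForm.

(** * Estimates for the scattering data *)

Section Scattering.
Variables (f : R -> R -> R) (Rs beta B CH L : R).
Hypothesis f_smooth : smooth2 f.
Hypothesis f_supp : forall x y, Rs < Rabs x -> f x y = 0.
Hypothesis HRs : 0 < Rs.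
Hypothesis Hbeta : 0 < beta < 1 / 2.
Hypothesis HB : forall j x, Cmod (fcoef f j x) <= B * wgt j.
Hypothesis HCH : 0 < CH.
Hypothesis Hbound : forall mu n x, Cmod mu <= mu_gap beta -> Rabs x <= 2 * Rs ->
  Cmod (Hker mu beta n x) <= CH.
Hypothesis HL : 0 <= L.
Hypothesis Hlip : forall mu mu' n x,
  Cmod mu <= mu_gap beta -> Cmod mu' <= mu_gap beta -> mu <> RtoC 0 -> mu' <> RtoC 0 ->
  Rabs x <= 2 * Rs ->
  Cmod (Hker mu beta n x - Hker mu' beta n x)%C <= L * Cmod (mu - mu')%C.

Let phi := fcoef f.
Let opK := opc Rs B.

Lemma phi_continuous (j : Z) (x : R) : continuous (phi j) x.
Proof. apply fcoef_continuous, f_smooth. Qed.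

Lemma phi_support (j : Z) (x : R) : Rs < Rabs x -> phi j x = RtoC 0.
Proof. apply (fcoef_support f Rs f_supp). Qed.

Lemma B_nonneg : 0 <= B.
Proof. exact (B_pos B phi HB). Qed.

Lemma opK_pos : 0 <= opK.
Proof. apply (opc_pos Rs B phi); [lra | exact HB]. Qed.

(** The term 4 opK CH forces the contraction factor below 1/2, given |c| <= 2 eps; the added 4 keeps
    the inverse finite and gives eps <= 1/4. *)
Definition eps_max : R := / (4 * opK * CH + 4).

Lemma eps_max_pos : 0 < eps_max.
Proof. apply Rinv_0_lt_compat. pose proof opK_pos; nra. Qed.

Lemma eps_small (eps : R) : 0 <= eps <= eps_max -> 2 * eps * (opK * CH) <= 1 / 2 /\ eps <= 1 / 4.
Proof.
  intros [H0 H]. pose proof opK_pos as P.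
  assert (P2 : 0 <= opK * CH) by (apply Rmult_le_pos; lra).
  assert (E : eps * (4 * opK * CH + 4) <= 1).
  { apply Rle_trans with (eps_max * (4 * opK * CH + 4)).
    - apply Rmult_le_compat_r; [nra | exact H].
    - unfold eps_max; right; field. apply Rgt_not_eq; nra. }
  nra.
Qed.

Definition cfac (eps : R) (mu : C) : C := (RtoC eps * (RtoC 2 * gam mu beta))%C.

Lemma cfac_bound (eps : R) (mu : C) :
  0 <= eps -> Cmod mu <= mu_gap beta -> Cmod (cfac eps mu) <= 2 * eps.
Proof.
  intros He Hm. unfold cfac. rewrite !Cmod_mult, !Cmod_R, !Rabs_pos_eq by lra.
  pose proof (gam_bound beta Hbeta mu Hm). pose proof (Cmod_ge_0 (gam mu beta)). nra.
Qed.

Lemma cfac_small (eps : R) (mu : C) :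
  0 <= eps <= eps_max -> Cmod mu <= mu_gap beta -> Cmod (cfac eps mu) * (opK * CH) <= 1 / 2.
Proof.
  intros He Hm. destruct (eps_small eps He) as [E _].
  pose proof (cfac_bound eps mu (proj1 He) Hm). pose proof opK_pos.
  assert (0 <= opK * CH) by (apply Rmult_le_pos; lra). nra.
Qed.

Lemma Hker_good (mu : C) : Cmod mu <= mu_gap beta -> good_kernel Rs CH (Hker mu beta).
Proof.
  intros Hm; split; [intros n x; apply Hker_continuous|].
  intros n x Hx; apply Hbound; assumption.
Qed.

Lemma solves_sol (eps : R) (mu : C) (g A : Z -> R -> C) :
  solves f Rs eps mu beta g A <-> sol Rs phi (cfac eps mu) (Hker mu beta) g A.
Proof.
  split; intros H m x; rewrite <- (H m x); unfold cfac, Top, Sop, phi; ring.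
Qed.

(** [resolv] is chosen among admissible solutions that are unique as such. Existence by Picard
    iteration and uniqueness by contraction make that predicate inhabited, after which the choice
    can be used like any solution. *)
Lemma resolv_spec (eps : R) (mu : C) (g : Z -> R -> C) :
  0 <= eps <= eps_max -> Cmod mu <= mu_gap beta -> admissible Rs g ->
  admissible Rs (resolv f Rs eps mu beta g) /\
  sol Rs phi (cfac eps mu) (Hker mu beta) g (resolv f Rs eps mu beta g).
Proof.
  intros He Hm Hg.
  assert (X : exists A, admissible Rs A /\ solves f Rs eps mu beta g A /\
    forall A', admissible Rs A' -> solves f Rs eps mu beta g A' -> forall n x, A' n x = A n x).
  { destruct (sol_exists Rs B CH phi (Rlt_le _ _ HRs) (Rlt_le _ _ HCH) HB phi_continuous phi_support
      (cfac eps mu) (Hker mu beta) g (Hker_good mu Hm) (cfac_small eps mu He Hm) Hg)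
      as [A [HA SA]].
    exists A; split; [exact HA|]. split; [apply solves_sol, SA|].
    intros A' HA' SA'. apply solves_sol in SA'.
    exact (sol_unique Rs B CH phi (Rlt_le _ _ HRs) (Rlt_le _ _ HCH) HB phi_support
      (cfac eps mu) (Hker mu beta) g (Hker_good mu Hm) (cfac_small eps mu He Hm)
      A A' HA HA' SA SA'). }
  destruct (epsilon_spec (inhabits (fun _ _ => RtoC 0)) _ X) as [R1 [R2 _]].
  split; [exact R1 | apply solves_sol; exact R2].
Qed.

Lemma fcoef_le_B (j : Z) (x : R) : Cmod (phi j x) <= B.
Proof.
  eapply Rle_trans; [apply HB|]. rewrite <- (Rmult_1_r B) at 2.
  apply Rmult_le_compat_l; [exact B_nonneg|]. unfold wgt. rewrite <- Rinv_1.
  pose proof (pow2_ge_0 (IZR j)). apply Rinv_le_contravar; lra.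
Qed.

Lemma g2_bound : bnd B (g2 f).
Proof. intros n x; apply fcoef_le_B. Qed.

Lemma g2_admissible : admissible Rs (g2 f).
Proof.
  split; [exists B; apply g2_bound | split].
  - intros n x; apply (phi_continuous (n + 1)).
  - intros n x Hx; apply (phi_support (n + 1)), Hx.
Qed.

Lemma phase_bound (s : R) (mu : C) (x : R) :
  Rabs s <= 1 -> Cmod mu <= mu_gap beta -> Rabs x <= Rs ->
  Cmod (Cexp (RtoC s * Ci * k0 mu beta * RtoC x)%C) <= exp (2 * Rs).
Proof.
  intros Hs Hm Hx. eapply Rle_trans; [apply Cmod_Cexp_le|]. apply exp_le_mono.
  rewrite !Cmod_mult, !Cmod_R, Cmod_Ci, Rmult_1_r.
  pose proof (k0_upper beta Hbeta mu Hm). pose proof (Cmod_ge_0 (k0 mu beta)).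
  pose proof (Rabs_pos x); pose proof (Rabs_pos s).
  apply Rmult_le_compat; [apply Rmult_le_pos; assumption | assumption | nra | assumption].
Qed.

Lemma phase_continuous (s : R) (mu : C) (x : R) :
  continuous (fun x => Cexp (RtoC s * Ci * k0 mu beta * RtoC x)%C) x.
Proof.
  apply continuous_Cexp, continuous_Cmult; [apply continuous_const|].
  apply continuous_RtoC, continuous_id.
Qed.

Definition G1 : R := exp (2 * Rs) * B.

(** The incident phase is written with an explicit sign s = 1, so that one family of phase lemmas
    serves the source and the test factors of P and R. *)
Lemma g1_phase (mu : C) (n : Z) (x : R) :
  g1 f mu beta n x = (Cexp (RtoC 1 * Ci * k0 mu beta * RtoC x) * phi n x)%C.
Proof. unfold g1, phi. f_equal. f_equal. ring. Qed.

Lemma g1_bound (mu : C) : Cmod mu <= mu_gap beta -> bnd G1 (g1 f mu beta).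
Proof.
  intros Hm n x. rewrite g1_phase.
  destruct (Rlt_dec Rs (Rabs x)) as [Hx | Hx].
  - rewrite phi_support, Cmult_0_r, Cmod_0 by exact Hx.
    apply Rmult_le_pos; [left; apply exp_pos | exact B_nonneg].
  - apply Cmod_mult_le; [|apply fcoef_le_B].
    apply phase_bound; [rewrite Rabs_R1; lra | exact Hm | lra].
Qed.

Lemma g1_admissible (mu : C) : Cmod mu <= mu_gap beta -> admissible Rs (g1 f mu beta).
Proof.
  intros Hm; split; [exists G1; apply g1_bound, Hm | split].
  - intros n x. apply (continuous_ext (fun x => (Cexp (RtoC 1 * Ci * k0 mu beta * RtoC x) * phi n x)%C)).
    + intros t; symmetry; apply g1_phase.
    + apply continuous_Cmult; [apply phase_continuous | apply phi_continuous].
  - intros n x Hx. rewrite g1_phase, phi_support by exact Hx. apply Cmult_0_r.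
Qed.

Lemma avg_bound (h : R -> C) (M : R) :
  (forall x, continuous h x) -> (forall x, Rabs x <= Rs -> Cmod (h x) <= M) ->
  Cmod (avg Rs h) <= 4 * Rs * M.
Proof.
  intros Hc HM. replace (4 * Rs * M) with (2 * (Rs - - Rs) * M) by ring.
  apply CInt_bound; [lra | exact Hc|]. intros x Hx; apply HM, Rabs_le; lra.
Qed.

Lemma avg_diff (h h' : R -> C) (M : R) :
  (forall x, continuous h x) -> (forall x, continuous h' x) ->
  (forall x, Rabs x <= Rs -> Cmod (h x - h' x)%C <= M) ->
  Cmod (avg Rs h - avg Rs h')%C <= 4 * Rs * M.
Proof.
  intros Hc Hc' HM. replace (4 * Rs * M) with (2 * (Rs - - Rs) * M) by ring.
  apply CInt_diff_bound; [lra | exact Hc | exact Hc' |]. intros x Hx; apply HM, Rabs_le; lra.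
Qed.

Lemma FF_bound (eps : R) (mu : C) : 0 <= eps <= eps_max -> Cmod mu <= mu_gap beta ->
  Cmod (FF f Rs eps mu beta) <= 4 * Rs * (2 * B).
Proof.
  intros He Hm. destruct (resolv_spec eps mu (g2 f) He Hm g2_admissible) as [HA SA].
  apply avg_bound; [apply HA|]. intros x _.
  apply (sol_bound Rs B CH phi (Rlt_le _ _ HRs) (Rlt_le _ _ HCH) HB phi_support
    _ _ _ (Hker_good mu Hm) (cfac_small eps mu He Hm) _ B HA SA g2_bound).
Qed.

(** The source [g2] does not depend on mu, so mu acts only through eps T; this is the origin of the
    factor eps. *)
Lemma FF_lipschitz (eps : R) (mu mu' : C) : 0 <= eps <= eps_max ->
  Cmod mu <= mu_gap beta -> Cmod mu' <= mu_gap beta -> mu <> RtoC 0 -> mu' <> RtoC 0 ->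
  Cmod (FF f Rs eps mu beta - FF f Rs eps mu' beta)%C <=
    32 * Rs * B * opK * (L + CH) * eps * Cmod (mu - mu')%C.
Proof.
  intros He Hm Hm' N N'.
  destruct (resolv_spec eps mu (g2 f) He Hm g2_admissible) as [HA SA].
  destruct (resolv_spec eps mu' (g2 f) He Hm' g2_admissible) as [HA' SA'].
  assert (E : bnd _ _) by exact
   (sol_perturb Rs B CH phi (Rlt_le _ _ HRs) (Rlt_le _ _ HCH) HB phi_support
    (cfac eps mu) (cfac eps mu') (Hker mu beta) (Hker mu' beta) (g2 f) _ _ B
    (L * Cmod (mu - mu')%C) (Hker_good mu Hm) (Hker_good mu' Hm') g2_admissible g2_bound
    (cfac_small eps mu He Hm) (cfac_small eps mu' He Hm') HA HA' SA SA'
    (fun n x Hx => Hlip mu mu' n x Hm Hm' N N' Hx)).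
  eapply Rle_trans.
  { eapply avg_diff;
      [exact (proj1 (proj2 HA) (-1)%Z) | exact (proj1 (proj2 HA') (-1)%Z) | intros x _; apply (E (-1)%Z x)]. }
  fold opK. set (d := Cmod (mu - mu')%C). assert (d0 : 0 <= d) by apply Cmod_ge_0.
  assert (C1 : Cmod (cfac eps mu) <= 2 * eps) by (apply cfac_bound; [apply He | exact Hm]).
  assert (C2 : Cmod (cfac eps mu - cfac eps mu')%C <= 2 * eps * d).
  { unfold cfac.
    replace (RtoC eps * (RtoC 2 * gam mu beta) - RtoC eps * (RtoC 2 * gam mu' beta))%C
      with (RtoC (2 * eps) * (gam mu beta - gam mu' beta))%C by (rewrite RtoC_mult; ring).
    rewrite Cmod_mult, Cmod_R, Rabs_pos_eq by lra.
    apply Rmult_le_compat_l; [lra|].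
    eapply Rle_trans; [apply (gam_diff beta Hbeta)|]. fold d.
    destruct (mu_gap_bounds beta Hbeta). nra. }
  pose proof opK_pos; pose proof B_nonneg.
  assert (C3 : Cmod (cfac eps mu) * (L * d) + Cmod (cfac eps mu - cfac eps mu')%C * CH
     <= 2 * eps * (L + CH) * d).
  { apply Rle_trans with ((2 * eps) * (L * d) + (2 * eps * d) * CH); [|right; ring].
    apply Rplus_le_compat; (apply Rmult_le_compat_r; [|assumption]); [apply Rmult_le_pos; lra | lra]. }
  apply Rle_trans with (4 * Rs * (4 * B * opK * (2 * eps * (L + CH) * d))); [|right; ring].
  apply Rmult_le_compat_l; [lra|]. apply Rmult_le_compat_l; [|exact C3].
  apply Rmult_le_pos; lra.
Qed.

Lemma resolv_avg_order0 (eps : R) (mu : C) (g : Z -> R -> C) (w : R -> C) (G E : R) (n : Z) :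
  0 <= eps <= eps_max -> Cmod mu <= mu_gap beta -> admissible Rs g -> bnd G g ->
  (forall x, continuous w x) -> (forall x, Rabs x <= Rs -> Cmod (w x) <= E) ->
  Cmod (avg Rs (fun x => resolv f Rs eps mu beta g n x * w x)
        - avg Rs (fun x => g n x * w x))%C <= 16 * Rs * opK * CH * G * E * eps.
Proof.
  intros He Hm Hg HG Hw HE.
  destruct (resolv_spec eps mu g He Hm Hg) as [HA SA].
  assert (X : bnd _ _) by exact (sol_order0 Rs B CH phi (Rlt_le _ _ HRs) (Rlt_le _ _ HCH) HB phi_support
    _ _ _ (Hker_good mu Hm) (cfac_small eps mu He Hm) _ G HA SA HG).
  fold opK in X.
  assert (G0 : 0 <= G) by (eapply Rle_trans; [apply Cmod_ge_0 | apply (HG 0%Z 0)]).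
  assert (E0 : 0 <= E) by (eapply Rle_trans; [apply Cmod_ge_0 | apply (HE 0); rewrite Rabs_R0; lra]).
  replace (16 * Rs * opK * CH * G * E * eps)
    with (4 * Rs * ((2 * eps * (opK * CH) * (2 * G)) * E)) by ring.
  apply avg_diff.
  - intros x; apply continuous_Cmult; [apply HA | apply Hw].
  - intros x; apply continuous_Cmult; [apply Hg | apply Hw].
  - intros x Hx.
    replace (resolv f Rs eps mu beta g n x * w x - g n x * w x)%C
      with ((resolv f Rs eps mu beta g n x - g n x) * w x)%C by ring.
    apply Cmod_mult_le; [|apply HE, Hx].
    eapply Rle_trans; [apply (X n x)|].
    pose proof (cfac_bound eps mu (proj1 He) Hm). pose proof opK_pos.
    assert (0 <= opK * CH) by (apply Rmult_le_pos; lra).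
    apply Rmult_le_compat_r; [lra|]. apply Rmult_le_compat_r; assumption.
Qed.

Lemma Series_only_first (a : nat -> R) : (forall k, a (S k) = 0) -> Series a = a O.
Proof.
  intros H. rewrite (Series_ext a (fun k => a O * 0 ^ k)).
  - rewrite Series_scal_l, Series_geom by (rewrite Rabs_R0; lra). field.
  - intros [|k]; [simpl; ring | rewrite H; simpl; ring].
Qed.

(** By reality of f the integrand is the quadratic form of H_n at f_{n+1}. For n <> 0 the kernel is
    real and even and the form is real; for n = 0 the cosine kernel yields the two squares. *)
Lemma Im_avg_mode (mu : R) (n : Z) : Cmod (RtoC mu) <= mu_gap beta ->
  Im (CInt (fun x => (conv Rs (Hker (RtoC mu) beta n) (phi (n + 1)) x * phi (-1 - n) x)%C) (- Rs) Rs) =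
  let k := sqrt (1 - 2 * beta - mu * mu) in
  if Z.eq_dec n 0
  then / (4 * k) * (Cmod (ftilde f Rs 1 k) ^ 2 + Cmod (ftilde f Rs 1 (- k)) ^ 2)
  else 0.
Proof.
  intros Hm; cbv zeta; set (k := sqrt (1 - 2 * beta - mu * mu)).
  assert (E : CInt (fun x => (conv Rs (Hker (RtoC mu) beta n) (phi (n + 1)) x * phi (-1 - n) x)%C) (- Rs) Rs
    = CInt (fun x => (conv Rs (Hker (RtoC mu) beta n) (phi (n + 1)) x * Cconj (phi (n + 1) x))%C) (- Rs) Rs).
  { apply CInt_ext; intros x _. f_equal. unfold phi.
    rewrite (fcoef_conj f f_smooth). f_equal; lia. }
  rewrite E. destruct (Z.eq_dec n 0) as [-> | N].
  - apply (cos_quadratic_form Rs (Hker (RtoC mu) beta 0) (phi 1) HRs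
      (Hker_continuous beta _ 0) (Hker_even beta _ 0) (phi_continuous 1) k).
    intros x; apply (Hker_0_Im beta Hbeta mu x Hm).
  - rewrite (Im_quadratic_form Rs (Hker (RtoC mu) beta n) (phi (n + 1)) HRs
      (Hker_continuous beta _ n) (Hker_even beta _ n) (phi_continuous (n + 1))).
    assert (Z0 : forall a b, RInt (fun _ => 0) a b = 0).
    { intros a b; rewrite RInt_const; unfold scal; simpl; unfold mult; simpl; ring. }
    transitivity (RInt (fun _ => 0) (- Rs) Rs); [|apply Z0]. apply RInt_ext; intros x _.
    transitivity (RInt (fun _ => 0) (- Rs) Rs); [|apply Z0]. apply RInt_ext; intros xi _.
    rewrite (Hker_real beta Hbeta mu n _ Hm N). ring_R.
Qed.

Lemma Im_avg_Sop (mu : R) : Cmod (RtoC mu) <= mu_gap beta ->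
  let k := sqrt (1 - 2 * beta - mu * mu) in
  Im (avg Rs (Sop Rs phi (Hker (RtoC mu) beta) (g2 f) (-1)%Z)) =
  / (4 * k) * (Cmod (ftilde f Rs 1 k) ^ 2 + Cmod (ftilde f Rs 1 (- k)) ^ 2).
Proof.
  intros Hm k. pose proof (Hker_good (RtoC mu) Hm) as HK.
  unfold avg, Sop.
  rewrite (CInt_Zsum (-1) (4 * Rs * (CH * B) * B)
    (fun n x => (conv Rs (Hker (RtoC mu) beta n) (g2 f n) x * phi (-1 - n) x)%C)).
  - unfold Zsum; cbn [Im snd].
    (* [Zsum] puts n = 0 at the head of its nonnegative half; of the imaginary parts only that term
       survives, and the other half is a series of zeros. *)
    rewrite Series_only_first.
    + rewrite (Series_ext _ (fun _ => 0 * 0)).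
      * rewrite Series_scal_l, Rmult_0_l, Rplus_0_r. exact (Im_avg_mode mu 0 Hm).
      * intros j. etransitivity; [exact (Im_avg_mode mu (- Z.of_nat (S j)) Hm)|]. cbv zeta.
        destruct (Z.eq_dec (- Z.of_nat (S j)) 0); [lia | ring].
    + intros j. etransitivity; [exact (Im_avg_mode mu (Z.of_nat (S j)) Hm)|]. cbv zeta.
      destruct (Z.eq_dec (Z.of_nat (S j)) 0); [lia | reflexivity].
  - intros x. apply (Sop_dominated Rs B CH phi); auto using phi_support, g2_admissible, g2_bound; lra.
  - intros n x. apply continuous_Cmult; [|apply phi_continuous].
    apply conv_continuous; [apply HK | apply (phi_continuous (n + 1))].
Qed.

Lemma gam_real (mu : R) : gam (RtoC mu) beta = RtoC (((1 - beta) ^ 2 - mu * mu) / (4 * PI)).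
Proof.
  unfold gam. rewrite <- !RtoC_mult, <- RtoC_minus, <- RtoC_mult. f_equal. unfold Rdiv; ring.
Qed.

(** To first order F is the mean of f_0 plus 2 eps gamma times the mean of S g2. The first mean is
    real since f_0 is, and 2 gamma times 1/(4k) is the gamma/(2k) displayed. The remainder is the
    second-order error of [sol_order1], averaged. *)
Lemma FF_Im (eps mu : R) : 0 <= eps <= eps_max -> Cmod (RtoC mu) <= mu_gap beta ->
  let k := sqrt (1 - 2 * beta - mu * mu) in
  Rabs (Im (FF f Rs eps (RtoC mu) beta) -
    eps * (((1 - beta) ^ 2 - mu * mu) / (4 * PI)) / (2 * k) *
      (Cmod (ftilde f Rs 1 k) ^ 2 + Cmod (ftilde f Rs 1 (- k)) ^ 2))
  <= 32 * Rs * (opK * CH) ^ 2 * B * eps ^ 2.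
Proof.
  intros He Hm k.
  destruct (resolv_spec eps (RtoC mu) (g2 f) He Hm g2_admissible) as [HA SA].
  set (S2 := Sop Rs phi (Hker (RtoC mu) beta) (g2 f) (-1)%Z).
  set (c := cfac eps (RtoC mu)).
  assert (Sc : forall x, continuous S2 x).
  { intros x. apply (Sop_continuous Rs B CH phi (Rlt_le _ _ HRs) (Rlt_le _ _ HCH) HB phi_continuous
      phi_support _ _ (-1) x (Hker_good (RtoC mu) Hm) g2_admissible). }
  assert (gc : forall x, continuous (g2 f (-1)%Z) x) by apply g2_admissible.
  assert (X : Cmod (FF f Rs eps (RtoC mu) beta
      - avg Rs (fun x => (g2 f (-1)%Z x + c * S2 x)%C))%C
      <= 4 * Rs * (2 * eps * (opK * CH) * (2 * eps * (opK * CH) * (2 * B)))).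
  { apply avg_diff.
    - apply HA.
    - intros x; apply continuous_Cplus; [apply gc|].
      apply continuous_Cmult; [apply continuous_const | apply Sc].
    - intros x _.
      pose proof (sol_order1 Rs B CH phi (Rlt_le _ _ HRs) (Rlt_le _ _ HCH) HB phi_support
        _ _ _ (Hker_good (RtoC mu) Hm) (cfac_small eps (RtoC mu) He Hm) g2_admissible _ B (-1)%Z x
        HA SA g2_bound) as Y.
      eapply Rle_trans; [exact Y|]. fold opK.
      pose proof (cfac_bound eps (RtoC mu) (proj1 He) Hm) as Cb. pose proof opK_pos; pose proof B_nonneg.
      pose proof (Cmod_ge_0 (cfac eps (RtoC mu))).
      assert (P : 0 <= opK * CH) by (apply Rmult_le_pos; lra).
      assert (Q : Cmod (cfac eps (RtoC mu)) * (opK * CH) <= 2 * eps * (opK * CH))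
        by (apply Rmult_le_compat_r; assumption).
      assert (Q0 : 0 <= Cmod (cfac eps (RtoC mu)) * (opK * CH)) by (apply Rmult_le_pos; assumption).
      apply Rmult_le_compat; [exact Q0 | | exact Q |].
      + apply Rmult_le_pos; lra.
      + apply Rmult_le_compat_r; [lra | exact Q]. }
  assert (V : Im (avg Rs (fun x => (g2 f (-1)%Z x + c * S2 x)%C)) =
    eps * (((1 - beta) ^ 2 - mu * mu) / (4 * PI)) / (2 * k) *
      (Cmod (ftilde f Rs 1 k) ^ 2 + Cmod (ftilde f Rs 1 (- k)) ^ 2)).
  { unfold avg. rewrite CInt_plus, CInt_scal.
    - change (Im (avg Rs (g2 f (-1)%Z)) + Im (c * avg Rs S2)%C =
        eps * (((1 - beta) ^ 2 - mu * mu) / (4 * PI)) / (2 * k) *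
        (Cmod (ftilde f Rs 1 k) ^ 2 + Cmod (ftilde f Rs 1 (- k)) ^ 2)).
      assert (Z0 : Im (avg Rs (g2 f (-1)%Z)) = 0).
      { assert (R0 : Cconj (avg Rs (g2 f (-1)%Z)) = avg Rs (g2 f (-1)%Z)).
        { unfold avg; rewrite <- CInt_conj by exact gc. apply CInt_ext; intros x _.
          unfold g2. apply (fcoef_conj f f_smooth 0). }
        apply (f_equal Im) in R0. rewrite im_conj in R0. lra. }
      rewrite Z0. unfold c, cfac. rewrite gam_real, <- !RtoC_mult, Im_mult.
      unfold S2. rewrite (Im_avg_Sop mu Hm). fold k. simpl Re. simpl Im.
      destruct (k0_real beta Hbeta mu Hm) as [_ Pk]. fold k in Pk.
      pose proof PI_RGT_0. field. split; lra.
    - exact Sc.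
    - exact gc.
    - intros x; apply continuous_Cmult; [apply continuous_const | apply Sc]. }
  rewrite <- V.
  match goal with |- Rabs (Im ?u - Im ?v) <= _ => change (Im u - Im v) with (Im (u - v)%C) end.
  eapply Rle_trans; [apply im_le_Cmod|]. eapply Rle_trans; [exact X | right; ring].
Qed.

(** * Leading order of the amplitudes in terms of Fourier transforms *)

Definition fhat (n : Z) (t : R) : C := avg Rs (fun x => (Cexp (0%R, (t * x)%R) * phi n x)%C).

Lemma fhat_continuous (n : Z) (t x : R) : continuous (fun x => (Cexp (0%R, (t * x)%R) * phi n x)%C) x.
Proof. apply continuous_Cmult; [apply continuous_phase | apply phi_continuous]. Qed.

Lemma Cmod_phase (t : R) : Cmod (Cexp (0%R, t)) = 1.
Proof. rewrite Cmod_Cexp; apply exp_0. Qed.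

Lemma fhat_bound (n : Z) (t : R) : Cmod (fhat n t) <= 4 * Rs * B.
Proof.
  apply avg_bound; [intros; apply fhat_continuous|].
  intros x _. rewrite Cmod_mult, Cmod_phase, Rmult_1_l. apply fcoef_le_B.
Qed.

(** [fhat n t] is [ftilde n] at -t. Conjugation therefore identifies the transform of f_{-1}, which
    is what Q produces, with the conjugate of d_+, a transform of f_1. *)
Lemma fhat_conj (n : Z) (t : R) : Cconj (fhat n t) = fhat (- n) (- t).
Proof.
  unfold fhat, avg. rewrite <- CInt_conj by (intros; apply fhat_continuous).
  apply CInt_ext; intros x _. rewrite Cmult_conj. unfold phi at 1.
  rewrite (fcoef_conj f f_smooth), !Cexp_im.
  replace (- t * x) with (- (t * x)) by ring. rewrite cos_neg, sin_neg. reflexivity.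
Qed.

(** 4 Rs comes from averaging, 3 Rs exp(8 Rs) from the difference of two phases with |t - t'| <= 8,
    and B from f_n. The range 8 covers s' k_mu against s' kappa for |s'| <= 2, where |k_mu - kappa|
    <= 4. *)
Definition fhat_lip : R := 12 * Rs * Rs * exp (8 * Rs) * B.

Lemma fhat_lip_pos : 0 <= fhat_lip.
Proof.
  pose proof (exp_pos (8 * Rs)); pose proof B_nonneg. unfold fhat_lip.
  apply Rmult_le_pos; [|assumption]. apply Rmult_le_pos; [nra | lra].
Qed.

Lemma fhat_lipschitz (n : Z) (t t' : R) : Rabs (t - t') <= 8 ->
  Cmod (fhat n t - fhat n t')%C <= fhat_lip * Rabs (t - t').
Proof.
  intros Ht. set (d := Rabs (t - t')) in *. assert (d0 : 0 <= d) by apply Rabs_pos.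
  replace (fhat_lip * d) with (4 * Rs * ((1 * (3 * (d * Rs) * exp (8 * Rs))) * B))
    by (unfold fhat_lip; ring).
  apply avg_diff; try (intros; apply fhat_continuous).
  intros x Hx.
  replace (Cexp (0%R, (t * x)%R) * phi n x - Cexp (0%R, (t' * x)%R) * phi n x)%C
    with ((Cexp (0%R, (t * x)%R) - Cexp (0%R, (t' * x)%R)) * phi n x)%C by ring.
  apply Cmod_mult_le; [|apply fcoef_le_B].
  eapply Rle_trans; [apply Cexp_diff_bound|]. rewrite Cmod_phase.
  assert (E : Cmod ((0%R, (t * x)%R) - (0%R, (t' * x)%R))%C = d * Rabs x).
  { replace ((0%R, (t * x)%R) - (0%R, (t' * x)%R))%C with (Ci * RtoC ((t - t') * x))%C
      by (unfold Ci, RtoC, Cminus, Cplus, Copp, Cmult; simpl; f_equal; ring).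
    rewrite Cmod_mult, Cmod_Ci, Cmod_R, Rabs_mult; unfold d; ring. }
  rewrite E. pose proof (Rabs_pos x). pose proof (exp_pos (d * Rabs x)).
  assert (X : d * Rabs x <= d * Rs) by (apply Rmult_le_compat_l; assumption).
  assert (X2 : d * Rs <= 8 * Rs) by (apply Rmult_le_compat_r; lra).
  assert (X0 : 0 <= d * Rabs x) by (apply Rmult_le_pos; assumption).
  apply Rmult_le_compat_l; [lra|].
  apply Rmult_le_compat; [lra | lra | lra | apply exp_le_mono; lra].
Qed.

Let kappa := sqrt (1 - 2 * beta).
Let kmu (mu : R) := sqrt (1 - 2 * beta - mu * mu).
Let cg := sqrt (mu_gap beta).

Lemma k0_phase (mu s x : R) : Cmod (RtoC mu) <= mu_gap beta ->
  Cexp (RtoC s * Ci * k0 (RtoC mu) beta * RtoC x)%C = Cexp (0%R, (s * kmu mu * x)%R).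
Proof.
  intros Hm; destruct (k0_real beta Hbeta mu Hm) as [-> _]. f_equal.
  unfold Ci, RtoC, Cmult; simpl; f_equal; unfold kmu; ring.
Qed.

Lemma kmu_kappa (mu : R) : Cmod (RtoC mu) <= mu_gap beta ->
  Rabs (kmu mu - kappa) <= / (2 * cg) * (mu * mu) /\ cg <= kmu mu /\ cg <= kappa /\
  Rabs (kmu mu - kappa) <= 4.
Proof.
  intros Hm.
  assert (H0 : Cmod (RtoC 0) <= mu_gap beta)
    by (rewrite Cmod_0; destruct (mu_gap_bounds beta Hbeta); lra).
  pose proof (c_pos beta Hbeta) as Pc. fold cg in Pc.
  assert (E0 : k0 (RtoC 0) beta = RtoC kappa).
  { destruct (k0_real beta Hbeta 0 H0) as [-> _]. unfold kappa; do 2 f_equal; ring. }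
  destruct (k0_real beta Hbeta mu Hm) as [E Pk]. fold (kmu mu) in E, Pk.
  pose proof (k0_lipschitz beta Hbeta (RtoC mu) (RtoC 0) Hm H0) as Lk. fold cg in Lk.
  rewrite E0, E, <- !RtoC_mult, <- !RtoC_minus, !Cmod_R, Rmult_0_l, Rminus_0_r in Lk.
  rewrite (Rabs_pos_eq (mu * mu)) in Lk by nra.
  assert (U1 := k0_upper beta Hbeta (RtoC mu) Hm). assert (U0 := k0_upper beta Hbeta (RtoC 0) H0).
  rewrite E, Cmod_R in U1. rewrite E0, Cmod_R in U0.
  assert (L1 := kroot_lower beta Hbeta (RtoC mu) 0 Hm ltac:(discriminate)).
  assert (L0 := kroot_lower beta Hbeta (RtoC 0) 0 H0 ltac:(discriminate)).
  unfold kroot in L1, L0; simpl in L1, L0.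
  rewrite Cmod_mult, Cmod_opp, Cmod_Ci, Rmult_1_l, E, Cmod_R, Rabs_pos_eq in L1 by lra.
  rewrite Cmod_mult, Cmod_opp, Cmod_Ci, Rmult_1_l, E0, Cmod_R, Rabs_pos_eq in L0 by apply sqrt_pos.
  fold cg in L1, L0. repeat split; try assumption.
  - apply Rmult_le_reg_l with (2 * cg); [lra|]. rewrite <- Rmult_assoc, Rinv_r, Rmult_1_l by lra. exact Lk.
  - apply Rabs_le. apply Rabs_le_between in U1; apply Rabs_le_between in U0. lra.
Qed.

(** One template for all five amplitudes. The number s' is the total phase of source and test
    factor: 2 for P+, 0 for P-, 1 for Q and R+, -1 for R-. The error eps comes from dropping the
    resolvent, the error mu^2 from replacing k_mu by kappa. *)
Lemma order0_phase (eps mu s s' : R) (g : Z -> R -> C) (n n' : Z) :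
  0 <= eps <= eps_max -> Cmod (RtoC mu) <= mu_gap beta -> admissible Rs g -> bnd G1 g ->
  Rabs s <= 1 -> Rabs s' <= 2 ->
  (forall x, (g n x * Cexp (RtoC s * Ci * k0 (RtoC mu) beta * RtoC x))%C
    = (Cexp (0%R, (s' * kmu mu * x)%R) * phi n' x)%C) ->
  Cmod (avg Rs (fun x => (resolv f Rs eps (RtoC mu) beta g n x
                          * Cexp (RtoC s * Ci * k0 (RtoC mu) beta * RtoC x))%C)
        - fhat n' (s' * kappa))%C
  <= 16 * Rs * opK * CH * G1 * exp (2 * Rs) * eps + fhat_lip / cg * (mu * mu).
Proof.
  intros He Hm Hg HG Hs Hs' Hgn.
  destruct (kmu_kappa mu Hm) as [D [K1 [K2 D4]]].
  pose proof (c_pos beta Hbeta) as Pc. fold cg in Pc.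
  assert (E1 := resolv_avg_order0 eps (RtoC mu) g
    (fun x => Cexp (RtoC s * Ci * k0 (RtoC mu) beta * RtoC x)%C) G1 (exp (2 * Rs)) n He Hm Hg HG
    (phase_continuous s (RtoC mu)) (fun x Hx => phase_bound s (RtoC mu) x Hs Hm Hx)).
  assert (E2 : avg Rs (fun x => (g n x * Cexp (RtoC s * Ci * k0 (RtoC mu) beta * RtoC x))%C)
    = fhat n' (s' * kmu mu)).
  { unfold fhat, avg. apply CInt_ext; intros x _; apply Hgn. }
  cbv beta in E1. rewrite E2 in E1.
  assert (A1 : Rabs (s' * kmu mu - s' * kappa) <= 2 * Rabs (kmu mu - kappa)).
  { replace (s' * kmu mu - s' * kappa) with (s' * (kmu mu - kappa)) by ring.
    rewrite Rabs_mult. apply Rmult_le_compat_r; [apply Rabs_pos | exact Hs']. }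
  assert (E3 := fhat_lipschitz n' (s' * kmu mu) (s' * kappa) ltac:(lra)).
  pose proof fhat_lip_pos.
  assert (E4 : Cmod (fhat n' (s' * kmu mu) - fhat n' (s' * kappa))%C <= fhat_lip / cg * (mu * mu)).
  { eapply Rle_trans; [exact E3|].
    replace (fhat_lip / cg * (mu * mu)) with (fhat_lip * (2 * (/ (2 * cg) * (mu * mu)))) by (field; lra).
    apply Rmult_le_compat_l; lra. }
  match goal with |- Cmod (?u - ?v)%C <= _ =>
    replace (u - v)%C with ((u - fhat n' (s' * kmu mu)) + (fhat n' (s' * kmu mu) - v))%C by ring end.
  eapply Rle_trans; [apply Cmod_triangle | lra].
Qed.

Lemma G1_ge_B : B <= G1.
Proof.
  unfold G1. assert (1 <= exp (2 * Rs)) by (rewrite <- exp_0; apply exp_le_mono; lra).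
  pose proof B_nonneg; nra.
Qed.

Lemma g2_bound_G1 : bnd G1 (g2 f).
Proof. intros n x; eapply Rle_trans; [apply g2_bound | apply G1_ge_B]. Qed.

Definition Kapp : R := 16 * Rs * opK * CH * G1 * exp (2 * Rs) + fhat_lip / cg.

Lemma Kapp_use (eps mu z : R) : 0 <= eps ->
  z <= 16 * Rs * opK * CH * G1 * exp (2 * Rs) * eps + fhat_lip / cg * (mu * mu) ->
  z <= Kapp * (eps + mu * mu).
Proof.
  intros He Hz. pose proof fhat_lip_pos. pose proof (c_pos beta Hbeta) as Pc. fold cg in Pc.
  pose proof opK_pos. pose proof B_nonneg. pose proof G1_ge_B. pose proof (exp_pos (2 * Rs)).
  assert (P1 : 0 <= 16 * Rs * opK * CH * G1 * exp (2 * Rs)).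
  { apply Rmult_le_pos; [apply Rmult_le_pos; [apply Rmult_le_pos; [apply Rmult_le_pos|]|]|]; lra. }
  assert (P2 : 0 <= fhat_lip / cg) by (apply Rmult_le_pos; [lra | left; apply Rinv_0_lt_compat; lra]).
  assert (m0 : 0 <= mu * mu) by nra. unfold Kapp.
  pose proof (Rmult_le_pos _ _ P1 m0). pose proof (Rmult_le_pos _ _ P2 He). lra.
Qed.

Lemma Cexp_im_plus (a b : R) : (Cexp (0%R, a) * Cexp (0%R, b))%C = Cexp (0%R, (a + b)%R).
Proof. rewrite <- Cexp_plus. f_equal. unfold Cplus; simpl; f_equal; ring. Qed.

Lemma g1_real (mu : R) (n : Z) (x : R) : Cmod (RtoC mu) <= mu_gap beta ->
  g1 f (RtoC mu) beta n x = (Cexp (0%R, (kmu mu * x)%R) * phi n x)%C.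
Proof.
  intros Hm; rewrite g1_phase, k0_phase by exact Hm. do 3 f_equal; ring.
Qed.

Section RealMu.
Variables eps mu : R.
Hypothesis He : 0 <= eps <= eps_max.
Hypothesis Hm : Cmod (RtoC mu) <= mu_gap beta.

Lemma QQ_approx :
  Cmod (QQ f Rs eps (RtoC mu) beta - Cconj (ftilde f Rs 1 kappa))%C <= Kapp * (eps + mu * mu).
Proof.
  apply Kapp_use; [apply He|].
  change (ftilde f Rs 1 kappa) with (fhat 1 (- kappa)). rewrite fhat_conj.
  replace (- - kappa) with (1 * kappa) by ring.
  (* Q has no test factor; it is written in with s = 0 to fit the template. *)
  assert (E0 : forall x, Cexp (RtoC 0 * Ci * k0 (RtoC mu) beta * RtoC x)%C = RtoC 1).
  { intros x. rewrite k0_phase by exact Hm. rewrite <- Cexp_0. f_equal.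
    unfold RtoC; f_equal; ring. }
  replace (QQ f Rs eps (RtoC mu) beta) with (avg Rs (fun x =>
    (resolv f Rs eps (RtoC mu) beta (g1 f (RtoC mu) beta) (-1)%Z x
     * Cexp (RtoC 0 * Ci * k0 (RtoC mu) beta * RtoC x))%C)).
  - apply order0_phase; auto using g1_admissible, g1_bound; try (apply Rabs_le; lra).
    intros x. rewrite E0, Cmult_1_r, g1_real by exact Hm. rewrite Rmult_1_l; reflexivity.
  - unfold QQ, avg. apply CInt_ext; intros x _. rewrite E0; ring.
Qed.

Lemma PP_plus_approx :
  Cmod (PP f Rs 1 eps (RtoC mu) beta - Cconj (ftilde f Rs 0 (2 * kappa)))%C <= Kapp * (eps + mu * mu).
Proof.
  apply Kapp_use; [apply He|].
  change (ftilde f Rs 0 (2 * kappa)) with (fhat 0 (- (2 * kappa))). rewrite fhat_conj, Ropp_involutive.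
  apply order0_phase; auto using g1_admissible, g1_bound; try (apply Rabs_le; lra).
  intros x. rewrite g1_real, k0_phase by exact Hm.
  replace (2 * kmu mu * x) with (kmu mu * x + 1 * kmu mu * x) by ring.
  rewrite <- Cexp_im_plus; simpl; ring.
Qed.

Lemma PP_minus_approx :
  Cmod (PP f Rs (-1) eps (RtoC mu) beta - ftilde f Rs 0 0)%C <= Kapp * (eps + mu * mu).
Proof.
  apply Kapp_use; [apply He|].
  change (ftilde f Rs 0 0) with (fhat 0 (- 0)). replace (- 0) with (0 * kappa) by ring.
  apply order0_phase; auto using g1_admissible, g1_bound; try (apply Rabs_le; lra).
  intros x. rewrite g1_real, k0_phase by exact Hm.
  replace (0 * kmu mu * x) with (kmu mu * x + -1 * kmu mu * x) by ring.
  rewrite <- Cexp_im_plus; ring.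
Qed.

Lemma RR_plus_approx :
  Cmod (RR f Rs 1 eps (RtoC mu) beta - ftilde f Rs 1 (- kappa))%C <= Kapp * (eps + mu * mu).
Proof.
  apply Kapp_use; [apply He|].
  change (ftilde f Rs 1 (- kappa)) with (fhat 1 (- - kappa)). replace (- - kappa) with (1 * kappa) by ring.
  apply order0_phase; auto using g2_admissible, g2_bound_G1; try (apply Rabs_le; lra).
  intros x. rewrite k0_phase by exact Hm. unfold g2; fold phi. apply Cmult_comm.
Qed.

Lemma RR_minus_approx :
  Cmod (RR f Rs (-1) eps (RtoC mu) beta - ftilde f Rs 1 kappa)%C <= Kapp * (eps + mu * mu).
Proof.
  apply Kapp_use; [apply He|].
  change (ftilde f Rs 1 kappa) with (fhat 1 (- kappa)). replace (- kappa) with (-1 * kappa) by ring.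
  apply order0_phase; auto using g2_admissible, g2_bound_G1; try (apply Rabs_le; lra).
  intros x. rewrite k0_phase by exact Hm. unfold g2; fold phi. apply Cmult_comm.
Qed.

Let gr := ((1 - beta) ^ 2 - mu * mu) / (4 * PI).
Let g0 := (1 - beta) ^ 2 / (4 * PI).

(** The first term is the variation of gamma divided by a lower bound of k_mu; the second is |k_mu -
    kappa| <= mu^2 / (2 cg) divided by k_mu kappa >= cg^2. *)
Definition Kgk : R := / cg + / (2 * cg * cg * cg).

Lemma gr_g0 : Rabs (gr - g0) <= mu * mu /\ 0 <= g0 <= 1.
Proof.
  pose proof PI2_3_2. assert (I : 0 < / (4 * PI) <= 1).
  { split; [apply Rinv_0_lt_compat; lra|]. rewrite <- Rinv_1. apply Rinv_le_contravar; lra. }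
  assert (0 <= mu * mu) by nra. split.
  - unfold gr, g0, Rdiv.
    replace (((1 - beta) ^ 2 - mu * mu) * / (4 * PI) - (1 - beta) ^ 2 * / (4 * PI))
      with (- (mu * mu * / (4 * PI))) by ring.
    rewrite Rabs_Ropp, Rabs_pos_eq by (apply Rmult_le_pos; lra).
    rewrite <- (Rmult_1_r (mu * mu)) at 2. apply Rmult_le_compat_l; lra.
  - unfold g0, Rdiv. assert (0 <= (1 - beta) ^ 2 <= 1) by nra. nra.
Qed.

Lemma gk_approx : Rabs (gr / kmu mu - g0 / kappa) <= Kgk * (mu * mu).
Proof.
  destruct gr_g0 as [Dg Bg]. destruct (kmu_kappa mu Hm) as [D [K1 [K2 _]]].
  pose proof (c_pos beta Hbeta) as Pc. fold cg in Pc.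
  replace (gr / kmu mu - g0 / kappa)
    with ((gr - g0) * / kmu mu + g0 * (- (kmu mu - kappa) * / (kmu mu * kappa))) by (field; split; lra).
  eapply Rle_trans; [apply Rabs_triang|]. rewrite !Rabs_mult, Rabs_Ropp.
  assert (I1 : Rabs (/ kmu mu) <= / cg).
  { rewrite Rabs_pos_eq by (left; apply Rinv_0_lt_compat; lra). apply Rinv_le_contravar; lra. }
  assert (I2 : Rabs (/ (kmu mu * kappa)) <= / (cg * cg)).
  { assert (cg * cg <= kmu mu * kappa) by (apply Rmult_le_compat; lra).
    rewrite Rabs_pos_eq by (left; apply Rinv_0_lt_compat; nra). apply Rinv_le_contravar; nra. }
  rewrite (Rabs_pos_eq g0) by lra.
  replace (Kgk * (mu * mu))
    with ((mu * mu) * / cg + 1 * ((/ (2 * cg) * (mu * mu)) * / (cg * cg)))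
    by (unfold Kgk; field; lra).
  apply Rplus_le_compat.
  - apply Rmult_le_compat; auto using Rabs_pos.
  - apply Rmult_le_compat; [lra | | lra |].
    + apply Rmult_le_pos; apply Rabs_pos.
    + apply Rmult_le_compat; auto using Rabs_pos.
Qed.

Lemma Cmod_sqr_diff (u v : C) (M d : R) : Cmod u <= M -> Cmod v <= M -> Cmod (u - v)%C <= d ->
  Rabs (Cmod u ^ 2 - Cmod v ^ 2) <= 2 * M * d.
Proof.
  intros Hu Hv Hd.
  pose proof (Cmod_le_plus u v). pose proof (Cmod_le_plus v u) as H1. rewrite Cmod_minus_sym in H1.
  pose proof (Cmod_ge_0 u); pose proof (Cmod_ge_0 v).
  replace (Cmod u ^ 2 - Cmod v ^ 2) with ((Cmod u + Cmod v) * (Cmod u - Cmod v)) by ring.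
  rewrite Rabs_mult, (Rabs_pos_eq (Cmod u + Cmod v)) by lra.
  apply Rmult_le_compat; [lra | apply Rabs_pos | lra | apply Rabs_le; lra].
Qed.

Definition KIm : R := 32 * Rs * (opK * CH) ^ 2 * B
  + (/ cg * (2 * (4 * Rs * B) * (fhat_lip / cg)) + Kgk * (2 * (4 * Rs * B) ^ 2)).

(** gamma / k_mu and the transforms at k_mu and -k_mu are frozen at mu = 0. Each changes by O(mu^2),
    and the prefactor eps makes the total eps mu^2. *)
Lemma FF_Im_approx :
  Rabs (Im (FF f Rs eps (RtoC mu) beta) -
    eps * (g0 / (2 * kappa) * (Cmod (ftilde f Rs 1 kappa) ^ 2 + Cmod (ftilde f Rs 1 (- kappa)) ^ 2)))
  <= KIm * (eps ^ 2 + eps * (mu * mu)).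
Proof.
  pose proof (FF_Im eps mu He Hm) as X. cbv zeta in X. fold gr (kmu mu) in X.
  destruct gr_g0 as [Dg Bg]. destruct (kmu_kappa mu Hm) as [D [K1 [K2 D4]]].
  pose proof (c_pos beta Hbeta) as Pc. fold cg in Pc.
  pose proof gk_approx as Gk. pose proof opK_pos; pose proof B_nonneg; pose proof fhat_lip_pos as Lp.
  set (S1 := Cmod (ftilde f Rs 1 (kmu mu)) ^ 2 + Cmod (ftilde f Rs 1 (- kmu mu)) ^ 2) in *.
  set (S0 := Cmod (ftilde f Rs 1 kappa) ^ 2 + Cmod (ftilde f Rs 1 (- kappa)) ^ 2) in *.
  assert (M0 : 0 <= 4 * Rs * B) by (apply Rmult_le_pos; lra).
  assert (FB : forall t, Cmod (ftilde f Rs 1 t) <= 4 * Rs * B) by (intros t; apply (fhat_bound 1 (- t))).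
  assert (m0 : 0 <= mu * mu) by nra.
  assert (DL : fhat_lip * Rabs (kmu mu - kappa) <= fhat_lip / cg * (mu * mu) / 2).
  { replace (fhat_lip / cg * (mu * mu) / 2) with (fhat_lip * (/ (2 * cg) * (mu * mu))) by (field; lra).
    apply Rmult_le_compat_l; assumption. }
  assert (SD : Rabs (S1 - S0) <= 2 * (4 * Rs * B) * (fhat_lip / cg * (mu * mu))).
  { assert (A1 : Cmod (ftilde f Rs 1 (kmu mu) - ftilde f Rs 1 kappa)%C <= fhat_lip / cg * (mu * mu) / 2).
    { eapply Rle_trans; [apply (fhat_lipschitz 1 (- kmu mu) (- kappa))|].
      - replace (- kmu mu - - kappa) with (- (kmu mu - kappa)) by ring. rewrite Rabs_Ropp; lra.
      - replace (- kmu mu - - kappa) with (- (kmu mu - kappa)) by ring. rewrite Rabs_Ropp; exact DL. }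
    assert (A2 : Cmod (ftilde f Rs 1 (- kmu mu) - ftilde f Rs 1 (- kappa))%C <= fhat_lip / cg * (mu * mu) / 2).
    { eapply Rle_trans; [apply (fhat_lipschitz 1 (- - kmu mu) (- - kappa))|];
        rewrite !Ropp_involutive; [lra | exact DL]. }
    pose proof (Cmod_sqr_diff _ _ _ _ (FB (kmu mu)) (FB kappa) A1) as B1.
    pose proof (Cmod_sqr_diff _ _ _ _ (FB (- kmu mu)) (FB (- kappa)) A2) as B2.
    unfold S1, S0.
    match goal with |- Rabs (?a + ?b - (?c + ?d)) <= _ =>
      replace (a + b - (c + d)) with ((a - c) + (b - d)) by ring;
      pose proof (Rabs_triang (a - c) (b - d)) end.
    lra. }
  assert (S0b : 0 <= S0 <= 2 * (4 * Rs * B) ^ 2).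
  { assert (Q : forall t, 0 <= Cmod (ftilde f Rs 1 t) ^ 2 <= (4 * Rs * B) ^ 2).
    { intros t; split; [apply pow2_ge_0 | apply pow_incr; split; [apply Cmod_ge_0 | apply FB]]. }
    pose proof (Q kappa); pose proof (Q (- kappa)); unfold S0; lra. }
  assert (gkb : Rabs (gr / kmu mu) <= / cg).
  { assert (0 <= gr <= 1).
    { unfold gr, Rdiv. pose proof PI2_3_2. assert (I : 0 < / (4 * PI) <= 1).
      { split; [apply Rinv_0_lt_compat; lra|]. rewrite <- Rinv_1. apply Rinv_le_contravar; lra. }
      assert (M : mu * mu <= 1 / 4).
      { rewrite Cmod_R in Hm. destruct (mu_gap_bounds beta Hbeta). apply Rabs_le_between in Hm. nra. }
      assert (0 <= (1 - beta) ^ 2 - mu * mu <= 1) by nra. nra. }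
    unfold Rdiv. rewrite Rabs_mult, !Rabs_pos_eq; try lra; [|left; apply Rinv_0_lt_compat; lra].
    assert (/ kmu mu <= / cg) by (apply Rinv_le_contravar; lra).
    assert (0 < / kmu mu) by (apply Rinv_0_lt_compat; lra). nra. }
  assert (Y : Rabs (gr / kmu mu * S1 - g0 / kappa * S0) <=
    (/ cg * (2 * (4 * Rs * B) * (fhat_lip / cg)) + Kgk * (2 * (4 * Rs * B) ^ 2)) * (mu * mu)).
  { replace (gr / kmu mu * S1 - g0 / kappa * S0)
      with (gr / kmu mu * (S1 - S0) + (gr / kmu mu - g0 / kappa) * S0) by ring.
    eapply Rle_trans; [apply Rabs_triang|]. rewrite !Rabs_mult, (Rabs_pos_eq S0) by lra.
    rewrite Rmult_plus_distr_r. apply Rplus_le_compat.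
    - replace (/ cg * (2 * (4 * Rs * B) * (fhat_lip / cg)) * (mu * mu))
        with (/ cg * (2 * (4 * Rs * B) * (fhat_lip / cg * (mu * mu)))) by ring.
      apply Rmult_le_compat; auto using Rabs_pos.
    - replace (Kgk * (2 * (4 * Rs * B) ^ 2) * (mu * mu))
        with ((Kgk * (mu * mu)) * (2 * (4 * Rs * B) ^ 2)) by ring.
      apply Rmult_le_compat; try lra; apply Rabs_pos. }
  set (KS := / cg * (2 * (4 * Rs * B) * (fhat_lip / cg)) + Kgk * (2 * (4 * Rs * B) ^ 2)) in *.
  assert (PK2 : 0 <= KS).
  { assert (0 < / cg) by (apply Rinv_0_lt_compat; lra).
    assert (0 <= fhat_lip / cg) by (apply Rmult_le_pos; lra).
    assert (0 <= Kgk).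
    { unfold Kgk. assert (0 < / (2 * cg * cg * cg))
        by (apply Rinv_0_lt_compat; repeat apply Rmult_lt_0_compat; lra). lra. }
    assert (0 <= (4 * Rs * B) ^ 2) by apply pow2_ge_0.
    unfold KS. apply Rplus_le_le_0_compat.
    - apply Rmult_le_pos; [lra|]. apply Rmult_le_pos; lra.
    - apply Rmult_le_pos; lra. }
  assert (PK1 : 0 <= 32 * Rs * (opK * CH) ^ 2 * B).
  { apply Rmult_le_pos; [|lra]. apply Rmult_le_pos; [lra | apply pow2_ge_0]. }
  assert (Xeq : eps * gr / (2 * kmu mu) * S1 = eps / 2 * (gr / kmu mu * S1)) by (field; lra).
  rewrite Xeq in X.
  replace (eps * (g0 / (2 * kappa) * S0)) with (eps / 2 * (g0 / kappa * S0)) by (field; lra).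
  match goal with |- Rabs (?i - ?b) <= _ =>
    replace (i - b) with ((i - eps / 2 * (gr / kmu mu * S1))
      + eps / 2 * (gr / kmu mu * S1 - g0 / kappa * S0)) by ring end.
  eapply Rle_trans; [apply Rabs_triang|]. rewrite (Rabs_mult (eps / 2)), (Rabs_pos_eq (eps / 2)) by lra.
  unfold KIm; fold KS.
  assert (eps / 2 * Rabs (gr / kmu mu * S1 - g0 / kappa * S0) <= eps / 2 * (KS * (mu * mu)))
    by (apply Rmult_le_compat_l; [lra | exact Y]).
  assert (0 <= eps ^ 2) by apply pow2_ge_0.
  assert (0 <= eps * (mu * mu)) by (apply Rmult_le_pos; lra).
  assert (0 <= KS * (eps * (mu * mu))) by (apply Rmult_le_pos; assumption).
  assert (0 <= KS * eps ^ 2) by (apply Rmult_le_pos; assumption).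
  assert (0 <= 32 * Rs * (opK * CH) ^ 2 * B * (eps * (mu * mu))) by (apply Rmult_le_pos; assumption).
  lra.
Qed.

End RealMu.

End Scattering.

(** * Assembling the asymptotics *)

Definition eps_close (eps A : R) (a a0 : C) : Prop := Cmod (a - a0)%C <= A * eps.

Lemma close_mult (eps A B : R) (a a0 b b0 : C) : 0 <= eps <= 1 -> 0 <= A -> 0 <= B ->
  eps_close eps A a a0 -> eps_close eps B b b0 ->
  eps_close eps (A * (Cmod b0 + B) + Cmod a0 * B) (a * b)%C (a0 * b0)%C.
Proof.
  intros He HA HB Ha Hb; unfold eps_close in *.
  replace ((A * (Cmod b0 + B) + Cmod a0 * B) * eps)
    with ((A * eps) * (Cmod b0 + B) + Cmod a0 * (B * eps)) by ring.
  apply Cmod_mult_diff; [|apply Rle_refl | exact Ha | exact Hb].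
  eapply Rle_trans; [apply (Cmod_le_plus b b0)|].
  assert (B * eps <= B * 1) by (apply Rmult_le_compat_l; lra). lra.
Qed.

(** This is an amplitude after division by W, with G standing for gamma / k_0 and S for Z / Y. The
    factor P is multiplied by Z itself, so its O(eps) error is amplified by delta, while the part of
    Z with eps Gam / 2 goes into the remainder. *)
Lemma amplitude_estimate (K0 Gam G0 g0 : R) (p q r : C) : 0 <= K0 -> exists K,
  forall (eps delta : R) (P Q Rr G gm S : C),
  0 <= eps <= 1 ->
  eps_close eps K0 P p -> eps_close eps K0 Q q -> eps_close eps K0 Rr r ->
  eps_close eps K0 G (RtoC G0) -> eps_close eps K0 gm (RtoC g0) -> eps_close eps K0 S (RtoC 1) ->
  Cmod (G * (P * (RtoC delta - Ci * RtoC (eps * (Gam / 2))) + gm * Q * Rr * S)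
        - (RtoC (G0 * g0) * q * r + RtoC (delta * G0) * p))%C <= K * (eps + eps * delta ^ 2).
Proof.
  intros HK.
  set (CM := fun A B x y : R => A * (y + B) + x * B).
  assert (CM0 : forall A B x y, 0 <= A -> 0 <= B -> 0 <= x -> 0 <= y -> 0 <= CM A B x y).
  { intros; unfold CM. apply Rplus_le_le_0_compat; apply Rmult_le_pos; lra. }
  set (A1 := CM K0 K0 (Rabs G0) (Cmod p)).
  set (B1 := CM K0 K0 (Rabs g0) (Cmod q)).
  set (B2 := CM B1 K0 (Cmod (RtoC g0 * q)%C) (Cmod r)).
  set (B3 := CM B2 K0 (Cmod (RtoC g0 * q * r)%C) (Cmod (RtoC 1))).
  set (B4 := CM K0 B3 (Rabs G0) (Cmod (RtoC g0 * q * r * RtoC 1)%C)).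
  assert (PA1 : 0 <= A1) by (apply CM0; auto using Rabs_pos, Cmod_ge_0).
  assert (PB1 : 0 <= B1) by (apply CM0; auto using Rabs_pos, Cmod_ge_0).
  assert (PB2 : 0 <= B2) by (apply CM0; auto using Rabs_pos, Cmod_ge_0).
  assert (PB3 : 0 <= B3) by (apply CM0; auto using Rabs_pos, Cmod_ge_0).
  assert (PB4 : 0 <= B4) by (apply CM0; auto using Rabs_pos, Cmod_ge_0).
  set (M := Cmod (RtoC G0 * p)%C).
  assert (M0 : 0 <= M) by apply Cmod_ge_0.
  exists (A1 + B4 + Rabs (Gam / 2) * (M + A1)).
  intros eps delta P Q Rr G gm S He HP HQ HR HG Hg HS.
  assert (E1 : eps_close eps A1 (G * P)%C (RtoC G0 * p)%C).
  { unfold A1, CM. rewrite <- (Cmod_R G0). apply close_mult; assumption. }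
  assert (E2 : eps_close eps B1 (gm * Q)%C (RtoC g0 * q)%C).
  { unfold B1, CM. rewrite <- (Cmod_R g0). apply close_mult; assumption. }
  assert (E3 : eps_close eps B2 (gm * Q * Rr)%C (RtoC g0 * q * r)%C) by (apply close_mult; assumption).
  assert (E4 : eps_close eps B3 (gm * Q * Rr * S)%C (RtoC g0 * q * r * RtoC 1)%C)
    by (apply close_mult; assumption).
  assert (E5 : eps_close eps B4 (G * (gm * Q * Rr * S))%C (RtoC G0 * (RtoC g0 * q * r * RtoC 1))%C).
  { unfold B4, CM. rewrite <- (Cmod_R G0). apply close_mult; assumption. }
  unfold eps_close in *.
  assert (E6 : Cmod (G * P)%C <= M + A1).
  { eapply Rle_trans; [apply (Cmod_le_plus _ (RtoC G0 * p)%C)|]. fold M.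
    assert (A1 * eps <= A1 * 1) by (apply Rmult_le_compat_l; lra). lra. }
  replace (G * (P * (RtoC delta - Ci * RtoC (eps * (Gam / 2))) + gm * Q * Rr * S)
        - (RtoC (G0 * g0) * q * r + RtoC (delta * G0) * p))%C
    with (RtoC delta * (G * P - RtoC G0 * p)
      + (G * (gm * Q * Rr * S) - RtoC G0 * (RtoC g0 * q * r * RtoC 1))
      - Ci * RtoC (eps * (Gam / 2)) * (G * P))%C
    by (rewrite (RtoC_mult G0 g0), (RtoC_mult delta G0); ring).
  eapply Rle_trans; [apply Cmod_triangle_minus|].
  (* Here |delta| <= 1 + delta^2 converts eps |delta| into the admissible remainder eps + eps
     delta^2. *)
  assert (F1 : Cmod (RtoC delta * (G * P - RtoC G0 * p))%C <= A1 * (eps + eps * delta ^ 2)).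
  { rewrite Cmod_mult, Cmod_R.
    apply Rle_trans with (Rabs delta * (A1 * eps)).
    - apply Rmult_le_compat_l; [apply Rabs_pos | exact E1].
    - replace (A1 * (eps + eps * delta ^ 2)) with ((1 + delta ^ 2) * (A1 * eps)) by ring.
      apply Rmult_le_compat_r; [apply Rmult_le_pos; lra|].
      rewrite <- (pow2_abs delta). pose proof (pow2_ge_0 (Rabs delta - 1)).
      pose proof (pow2_ge_0 (Rabs delta)). lra. }
  assert (F3 : Cmod (Ci * RtoC (eps * (Gam / 2)) * (G * P))%C <= Rabs (Gam / 2) * (M + A1) * eps).
  { rewrite Cmod_mult, (Cmod_mult Ci), Cmod_Ci, Cmod_R, Rabs_mult, (Rabs_pos_eq eps) by lra.
    replace (Rabs (Gam / 2) * (M + A1) * eps) with (1 * (eps * Rabs (Gam / 2)) * (M + A1)) by ring.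
    apply Rmult_le_compat_l; [|exact E6].
    pose proof (Rabs_pos (Gam / 2)). rewrite Rmult_1_l; apply Rmult_le_pos; lra. }
  pose proof (Cmod_triangle (RtoC delta * (G * P - RtoC G0 * p))%C
    (G * (gm * Q * Rr * S) - RtoC G0 * (RtoC g0 * q * r * RtoC 1))%C).
  assert (d0 : 0 <= eps * delta ^ 2) by (apply Rmult_le_pos; [lra | apply pow2_ge_0]).
  pose proof (Rmult_le_pos _ _ PB4 d0).
  assert (0 <= Rabs (Gam / 2) * (M + A1)) as PX by (apply Rmult_le_pos; [apply Rabs_pos | lra]).
  pose proof (Rmult_le_pos _ _ PX d0).
  lra.
Qed.

(** In this notation the root equation reads nu0 = h(eps nu0), and the denominator of the amplitudes
    is eps (nu - h(eps nu)). *)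
Definition hfun (f : R -> R -> R) (Rs beta eps : R) (mu : C) : C :=
  (gam mu beta * FF f Rs eps mu beta)%C.

(** Everything needed about the resolvent, with a single constant and thresholds independent of
    [delta]. The clause on Im h includes r = 0, where the value of H_{-1} is still real; it is
    applied at r = 0 to exclude a vanishing root and at r = eps to locate Im nu0. *)
Lemma scattering_estimates (f : R -> R -> R) (Rs beta : R) :
  smooth2 f -> (forall x y, f x (y + 2 * PI) = f x y) ->
  (forall x y, Rs < Rabs x -> f x y = 0) -> 0 < Rs -> 0 < beta < 1 / 2 ->
  let kappa := sqrt (1 - 2 * beta) in
  let dp := ftilde f Rs 1 kappa in
  let dm := ftilde f Rs 1 (- kappa) in
  let g0 := (1 - beta) ^ 2 / (4 * PI) in
  let Gam := g0 ^ 2 / kappa * (Cmod dp ^ 2 + Cmod dm ^ 2) in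
  exists K e1 m, 0 < K /\ 0 < e1 <= 1 /\ 0 < m /\
  (forall eps mu, 0 <= eps <= e1 -> Cmod mu <= m -> Cmod (hfun f Rs beta eps mu) <= K) /\
  (forall eps mu mu', 0 <= eps <= e1 -> Cmod mu <= m -> Cmod mu' <= m ->
     mu <> RtoC 0 -> mu' <> RtoC 0 ->
     Cmod (hfun f Rs beta eps mu - hfun f Rs beta eps mu')%C
       <= K * Cmod (mu - mu')%C * (Cmod mu + Cmod mu' + eps)) /\
  (forall eps r, 0 <= eps <= e1 -> 0 <= r <= eps -> r <= m ->
     Rabs (Im (hfun f Rs beta eps (RtoC r)) - eps * (Gam / 2)) <= K * eps ^ 2) /\
  (forall eps mu, 0 <= eps <= e1 -> Cmod (RtoC mu) <= m ->
     k0 (RtoC mu) beta <> RtoC 0 /\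
     Cmod (QQ f Rs eps (RtoC mu) beta - Cconj dp)%C <= K * (eps + mu * mu) /\
     Cmod (PP f Rs 1 eps (RtoC mu) beta - Cconj (ftilde f Rs 0 (2 * kappa)))%C <= K * (eps + mu * mu) /\
     Cmod (PP f Rs (-1) eps (RtoC mu) beta - ftilde f Rs 0 0)%C <= K * (eps + mu * mu) /\
     Cmod (RR f Rs 1 eps (RtoC mu) beta - dm)%C <= K * (eps + mu * mu) /\
     Cmod (RR f Rs (-1) eps (RtoC mu) beta - dp)%C <= K * (eps + mu * mu) /\
     Cmod (gam (RtoC mu) beta / k0 (RtoC mu) beta - RtoC (g0 / kappa))%C <= K * (eps + mu * mu) /\
     Cmod (gam (RtoC mu) beta - RtoC g0)%C <= K * (eps + mu * mu)).
Proof.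
  intros Hf Hp Hs HRs Hb kappa dp dm g0 Gam.
  destruct (fcoef_decay f Rs Hf Hp Hs) as [B [HBpos HB]].
  destruct (Hker_bound beta Rs Hb (Rlt_le _ _ HRs)) as [CH [HCH Hbound]].
  destruct (Hker_lipschitz beta Rs Hb (Rlt_le _ _ HRs)) as [L [HL Hlip]].
  set (m := mu_gap beta). destruct (mu_gap_bounds beta Hb) as [[m1 m2] _]. fold m in m1, m2.
  set (e1 := eps_max Rs B CH).
  assert (e1p : 0 < e1) by exact (eps_max_pos f Rs beta B CH HRs Hb HB HCH).
  assert (e1s : e1 <= 1 / 4)
    by exact (proj2 (eps_small f Rs beta B CH HRs Hb HB HCH e1 (conj (Rlt_le _ _ e1p) (Rle_refl _)))).
  set (KF := 4 * Rs * (2 * B)). set (KL := 32 * Rs * B * opc Rs B * (L + CH)).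
  set (KI := KIm Rs beta B CH). set (KA := Kapp Rs beta B CH). set (KG := Kgk beta).
  set (K := Rabs KF + Rabs KL + 2 * Rabs KI + Rabs KA + Rabs KG + 1).
  pose proof (Rabs_pos KF); pose proof (Rabs_pos KL); pose proof (Rabs_pos KI);
    pose proof (Rabs_pos KA); pose proof (Rabs_pos KG).
  pose proof (Rle_abs KF); pose proof (Rle_abs KL); pose proof (Rle_abs KI);
    pose proof (Rle_abs KA); pose proof (Rle_abs KG).
  assert (up : forall k u z, k <= K -> 0 <= z -> u <= k * z -> u <= K * z).
  { intros k u z Hk Hz Hu. eapply Rle_trans; [exact Hu|]. apply Rmult_le_compat_r; assumption. }
  assert (FB : forall eps mu, 0 <= eps <= e1 -> Cmod mu <= m -> Cmod (FF f Rs eps mu beta) <= KF)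
    by (intros; apply (FF_bound f Rs beta B CH); assumption).
  assert (gb : forall mu, Cmod mu <= m -> Cmod (gam mu beta) <= 1)
    by (intros; apply gam_bound; assumption).
  exists K, e1, m. split; [unfold K; lra|]. split; [lra|]. split; [lra|].
  split; [|split; [|split]].
  - intros eps mu He Hm. rewrite <- (Rmult_1_r K). apply (up KF); [unfold K; lra | lra |].
    rewrite Rmult_comm. apply Cmod_mult_le; auto.
  - intros eps mu mu' He Hm Hm' N N'. set (d := Cmod (mu - mu')%C).
    assert (d0 : 0 <= d) by apply Cmod_ge_0.
    pose proof (Cmod_ge_0 mu); pose proof (Cmod_ge_0 mu').
    rewrite Rmult_assoc. set (t := Cmod mu + Cmod mu' + eps).
    apply (up (Rabs KF + Rabs KL)); [unfold K; lra | apply Rmult_le_pos; unfold t; lra |].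
    assert (X : Cmod (hfun f Rs beta eps mu - hfun f Rs beta eps mu')%C
      <= (d * (Cmod mu + Cmod mu')) * KF + 1 * (KL * eps * d)).
    { apply Cmod_mult_diff; auto.
      - apply (gam_diff beta Hb).
      - apply (FF_lipschitz f Rs beta B CH L); assumption. }
    eapply Rle_trans; [exact X|].
    assert (KF * (d * (Cmod mu + Cmod mu')) <= Rabs KF * (d * t)).
    { apply Rle_trans with (Rabs KF * (d * (Cmod mu + Cmod mu'))).
      - apply Rmult_le_compat_r; [apply Rmult_le_pos; lra | lra].
      - apply Rmult_le_compat_l; [lra|]. apply Rmult_le_compat_l; unfold t; lra. }
    assert (KL * (d * eps) <= Rabs KL * (d * t)).
    { apply Rle_trans with (Rabs KL * (d * eps)).
      - apply Rmult_le_compat_r; [apply Rmult_le_pos; lra | lra].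
      - apply Rmult_le_compat_l; [lra|]. apply Rmult_le_compat_l; unfold t; lra. }
    lra.
  - intros eps r He Hr Hrm.
    assert (Hm : Cmod (RtoC r) <= m) by (rewrite Cmod_R, Rabs_pos_eq; lra).
    destruct (gr_g0 beta Hb r) as [Dg Bg]. fold g0 in Dg, Bg.
    pose proof (FF_Im_approx f Rs beta B CH Hf Hs HRs Hb HB HCH Hbound eps r He Hm) as X.
    fold kappa g0 in X. fold dp dm in X. fold KI in X.
    set (S0 := Cmod dp ^ 2 + Cmod dm ^ 2) in *.
    destruct (kmu_kappa beta Hb r Hm) as [_ [_ [Kp _]]]. fold kappa in Kp.
    pose proof (c_pos beta Hb) as Pc.
    assert (r2 : 0 <= r * r <= eps ^ 2) by nra.
    apply (up (Rabs KF + 2 * Rabs KI)); [unfold K; lra | lra |].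
    unfold hfun. rewrite gam_real, Im_mult.
    set (gr := ((1 - beta) ^ 2 - r * r) / (4 * PI)) in *.
    change (Re (RtoC gr)) with gr; change (Im (RtoC gr)) with 0.
    set (FI := Im (FF f Rs eps (RtoC r) beta)) in *.
    (* For real mu the factor gamma is real, so Im h = gamma Im F; freezing gamma costs O(r^2) <=
       O(eps^2), and g0 times g0 / (2 kappa) times the two squares is Gam / 2. *)
    replace (gr * FI + 0 * Re (FF f Rs eps (RtoC r) beta) - eps * (Gam / 2))
      with ((gr - g0) * FI + g0 * (FI - eps * (g0 / (2 * kappa) * S0)))
      by (unfold Gam; fold S0; field; lra).
    eapply Rle_trans; [apply Rabs_triang|]. rewrite !Rabs_mult, (Rabs_pos_eq g0) by lra.
    assert (FIb : Rabs FI <= Rabs KF).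
    { eapply Rle_trans; [apply im_le_Cmod|]. eapply Rle_trans; [apply (FB eps (RtoC r) He Hm) | lra]. }
    assert (Y1 : Rabs (gr - g0) * Rabs FI <= eps ^ 2 * Rabs KF)
      by (apply Rmult_le_compat; auto using Rabs_pos; lra).
    assert (Y2 : g0 * Rabs (FI - eps * (g0 / (2 * kappa) * S0)) <= 1 * (Rabs KI * (2 * eps ^ 2))).
    { apply Rmult_le_compat; [lra | apply Rabs_pos | lra|]. eapply Rle_trans; [exact X|].
      assert (z0 : 0 <= eps ^ 2 + eps * (r * r) <= 2 * eps ^ 2) by nra.
      apply Rle_trans with (Rabs KI * (eps ^ 2 + eps * (r * r))).
      - apply Rmult_le_compat_r; lra.
      - apply Rmult_le_compat_l; lra. }
    lra.
  - intros eps mu He Hm. assert (m0 : 0 <= mu * mu) by nra.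
    assert (z0 : 0 <= eps + mu * mu) by lra.
    destruct (k0_real beta Hb mu Hm) as [Ek Pk].
    split; [rewrite Ek; intros E; apply RtoC_inj in E; lra|].
    split; [|split; [|split; [|split; [|split; [|split]]]]].
    + apply (up KA); [unfold K; lra | exact z0 | apply (QQ_approx f Rs beta B CH); assumption].
    + apply (up KA); [unfold K; lra | exact z0 | apply (PP_plus_approx f Rs beta B CH); assumption].
    + apply (up KA); [unfold K; lra | exact z0 | apply (PP_minus_approx f Rs beta B CH); assumption].
    + apply (up KA); [unfold K; lra | exact z0 | apply (RR_plus_approx f Rs beta B CH); assumption].
    + apply (up KA); [unfold K; lra | exact z0 | apply (RR_minus_approx f Rs beta B CH); assumption].
    + rewrite Ek, gam_real, <- RtoC_div by lra. rewrite <- RtoC_minus, Cmod_R.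
      apply (up (Rabs KG)); [unfold K; lra | exact z0 |].
      eapply Rle_trans; [apply (gk_approx beta Hb mu Hm)|]. fold KG.
      apply Rle_trans with (Rabs KG * (mu * mu)).
      * apply Rmult_le_compat_r; lra.
      * apply Rmult_le_compat_l; lra.
    + rewrite gam_real, <- RtoC_minus, Cmod_R.
      apply (up 1); [unfold K; lra | exact z0 |].
      eapply Rle_trans; [apply (gr_g0 beta Hb mu) | lra].
Qed.

Lemma at_right_0_elim (P : R -> Prop) : at_right 0 P -> exists e, 0 < e /\ forall x, 0 < x < e -> P x.
Proof.
  intros [d Hd]. exists d; split; [apply cond_pos|]. intros x Hx. apply Hd; [|apply Hx].
  change (Rabs (x - 0) < d). rewrite Rminus_0_r, Rabs_pos_eq; lra.
Qed.

Lemma filterlim_0_small (g : R -> R) (m : R) : 0 < m ->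
  filterlim g (at_right 0) (locally 0) -> exists e, 0 < e /\ forall x, 0 < x < e -> Rabs (g x) < m.
Proof.
  intros Hm H. apply at_right_0_elim.
  apply (H (fun y => Rabs y < m)). exists (mkposreal m Hm). intros y Hy.
  change (Rabs (y - 0) < m) in Hy. rewrite Rminus_0_r in Hy; exact Hy.
Qed.

(** Used by contraposition: a nonpositive [Rs] would force Gam = 0. For negative [Rs] the integrand
    vanishes, for [Rs] = 0 the interval is a point. *)
Lemma ftilde_degenerate (f : R -> R -> R) (Rs xi : R) (j : Z) :
  (forall x y, Rs < Rabs x -> f x y = 0) -> Rs <= 0 -> ftilde f Rs j xi = RtoC 0.
Proof.
  intros Hs [H | ->].
  - rewrite <- (CInt_zero (- Rs) Rs). apply CInt_ext; intros x _.
    rewrite (fcoef_support f Rs Hs) by (pose proof (Rabs_pos x); lra). apply Cmult_0_r.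
  - unfold ftilde, CInt. rewrite Ropp_0, !(RInt_point (V := R_CompleteNormedModule)). reflexivity.
Qed.

(* The denominator [Y = (mu - eps gamma F)/eps] is compared with [delta - i eps Gam/2]. *)
Lemma denominator_estimate (K Gam : R) : 0 < K -> 0 < Gam -> exists C2 e2, 0 < C2 /\ 0 < e2 <= 1 /\
  forall (eps delta : R) (nu0 h : C),
  0 < eps < e2 -> eps * delta ^ 2 <= 1 ->
  Cmod nu0 <= K -> Rabs (Im nu0 - eps * (Gam / 2)) <= K * eps ^ 2 ->
  let nu := Re nu0 + delta in
  Cmod (nu0 - h)%C <= K * Cmod (RtoC (eps * nu) - RtoC eps * nu0)%C
     * (Cmod (RtoC (eps * nu)) + Cmod (RtoC eps * nu0)%C + eps) ->
  let Y := (RtoC nu - h)%C in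
  let Z := (RtoC delta - Ci * RtoC (eps * (Gam / 2)))%C in
  Y <> RtoC 0 /\ Z <> RtoC 0 /\ eps_close eps C2 (Z / Y)%C (RtoC 1).
Proof.
  intros HK HG.
  (* The first term is the error of Im nu0 relative to |Z|, the second the Lipschitz bound for nu0 -
     h, where 2K + 2 bounds |mu| + |mu0| + eps. *)
  set (C1 := K * (2 / Gam) + K * (2 * K + 2) * (1 + K * (2 / Gam))).
  assert (G2 : 0 < 2 / Gam) by (apply Rdiv_lt_0_compat; lra).
  assert (KG : 0 < K * (2 / Gam)) by (apply Rmult_lt_0_compat; assumption).
  assert (C1p : 0 < C1).
  { unfold C1. assert (0 < K * (2 * K + 2)) by nra. nra. }
  exists (2 * C1), (Rmin 1 (/ (2 * C1))). split; [lra|]. split.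
  { split; [apply Rmin_pos; [lra | apply Rinv_0_lt_compat; lra] | apply Rmin_l]. }
  intros eps delta nu0 h [He0 He2] Hed Hn HI nu Hh Y Z.
  assert (He1 : eps < 1) by (eapply Rlt_le_trans; [exact He2 | apply Rmin_l]).
  assert (HeC : eps * (2 * C1) < 1).
  { apply Rlt_le_trans with (/ (2 * C1) * (2 * C1)).
    - apply Rmult_lt_compat_r; [lra|]. eapply Rlt_le_trans; [exact He2 | apply Rmin_r].
    - right; field; lra. }
  (* (eps delta)^2 = eps (eps delta^2) <= 1, so mu stays bounded although [delta] itself may be
     large. *)
  assert (Hdelta : eps * Rabs delta <= 1).
  { assert (X : (eps * Rabs delta) ^ 2 <= 1).
    { rewrite Rpow_mult_distr, pow2_abs.
      replace (eps ^ 2 * delta ^ 2) with (eps * (eps * delta ^ 2)) by ring.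
      assert (0 <= eps * delta ^ 2) by (apply Rmult_le_pos; [lra | apply pow2_ge_0]). nra. }
    assert (0 <= eps * Rabs delta) by (apply Rmult_le_pos; [lra | apply Rabs_pos]). nra. }
  set (z := Cmod Z).
  (* The imaginary part alone keeps Z away from 0, even at delta = 0; it yields eps <= (2 / Gam)
     |Z|, the exchange rate between absolute and relative errors. *)
  assert (Zim : eps * (Gam / 2) <= z).
  { unfold z. eapply Rle_trans; [|apply im_le_Cmod].
    replace (Im Z) with (- (eps * (Gam / 2))) by (unfold Z, Ci, RtoC; simpl; ring).
    rewrite Rabs_Ropp. apply Rle_abs. }
  assert (zp : 0 < z) by nra.
  assert (Hez : eps <= 2 / Gam * z).
  { apply Rle_trans with (2 / Gam * (eps * (Gam / 2))); [right; field; lra|].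
    apply Rmult_le_compat_l; lra. }
  set (D := (RtoC nu - nu0)%C).
  (* By the choice of nu the real parts agree exactly: nu - nu0 = delta - i Im nu0. *)
  assert (ED : (D - Z)%C = (- Ci * RtoC (Im nu0 - eps * (Gam / 2)))%C).
  { unfold D, Z, nu. apply C_ext; unfold Ci, RtoC; simpl; unfold Re, Im; ring. }
  assert (DZ : Cmod (D - Z)%C <= K * eps ^ 2).
  { rewrite ED, Cmod_mult, Cmod_opp, Cmod_Ci, Cmod_R, Rmult_1_l. exact HI. }
  assert (Dz : Cmod D <= (1 + K * (2 / Gam)) * z).
  { eapply Rle_trans; [apply (Cmod_le_plus D Z)|]. fold z.
    assert (K * eps ^ 2 <= K * (2 / Gam) * z).
    { rewrite Rmult_assoc. apply Rmult_le_compat_l; [lra|]. nra. }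
    lra. }
  assert (E1 : (RtoC (eps * nu) - RtoC eps * nu0)%C = (RtoC eps * D)%C)
    by (unfold D; rewrite RtoC_mult; ring).
  rewrite E1, !Cmod_mult, !Cmod_R, (Rabs_pos_eq eps) in Hh by lra.
  assert (Hnu : Rabs (eps * nu) <= eps * K + 1 * 1).
  { unfold nu. rewrite Rmult_plus_distr_l. eapply Rle_trans; [apply Rabs_triang|].
    rewrite !Rabs_mult, (Rabs_pos_eq eps) by lra.
    assert (eps * Rabs (Re nu0) <= eps * K).
    { apply Rmult_le_compat_l; [lra|]. eapply Rle_trans; [apply re_le_Cmod | exact Hn]. }
    lra. }
  assert (Hh' : Cmod (nu0 - h)%C <= K * (2 * K + 2) * (1 + K * (2 / Gam)) * (eps * z)).
  { eapply Rle_trans; [exact Hh|].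
    apply Rle_trans with (K * (eps * ((1 + K * (2 / Gam)) * z)) * (2 * K + 2)); [|right; ring].
    pose proof (Cmod_ge_0 D). pose proof (Cmod_ge_0 nu0). pose proof (Rabs_pos (eps * nu)).
    assert (eps * Cmod nu0 <= 1 * K) by (apply Rmult_le_compat; lra).
    assert (eps * K <= 1 * K) by (apply Rmult_le_compat_r; lra).
    apply Rmult_le_compat; try lra.
    - apply Rmult_le_pos; [lra | apply Rmult_le_pos; lra].
    - assert (0 <= eps * Cmod nu0) by (apply Rmult_le_pos; lra). lra.
    - apply Rmult_le_compat_l; [lra|]. apply Rmult_le_compat_l; lra. }
  assert (YZ : Cmod (Y - Z)%C <= C1 * eps * z).
  { replace (Y - Z)%C with ((D - Z) + (nu0 - h))%C by (unfold Y, D; ring).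
    eapply Rle_trans; [apply Cmod_triangle|].
    assert (K * eps ^ 2 <= K * (2 / Gam) * (eps * z)).
    { rewrite Rmult_assoc. apply Rmult_le_compat_l; [lra|].
      replace (2 / Gam * (eps * z)) with (eps * (2 / Gam * z)) by ring.
      replace (eps ^ 2) with (eps * eps) by ring. apply Rmult_le_compat_l; lra. }
    unfold C1. lra. }
  (* The threshold on eps was chosen to make C1 eps <= 1/2, so Y inherits half of the lower bound of
     Z; this is the 2 in the constant 2 C1. *)
  assert (Ylow : z / 2 <= Cmod Y).
  { pose proof (Cmod_le_plus Z Y) as T. rewrite (Cmod_minus_sym Z Y) in T. fold z in T.
    assert (C1 * eps * z <= 1 / 2 * z) by (apply Rmult_le_compat_r; lra). lra. }
  assert (Y0 : Y <> RtoC 0) by (apply Cmod_gt_0; lra).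
  split; [exact Y0|]. split; [apply Cmod_gt_0; exact zp|].
  unfold eps_close. replace (Z / Y - RtoC 1)%C with ((Z - Y) / Y)%C by (field; exact Y0).
  rewrite Cmod_div, (Cmod_minus_sym Z Y) by exact Y0.
  unfold Rdiv. apply Rmult_le_reg_r with (Cmod Y); [lra|].
  rewrite Rmult_assoc, Rinv_l, Rmult_1_r by lra.
  eapply Rle_trans; [exact YZ|].
  replace (2 * C1 * eps * Cmod Y) with (C1 * eps * (2 * Cmod Y)) by ring.
  apply Rmult_le_compat_l; [apply Rmult_le_pos; lra | lra].
Qed.

Theorem theorem5p1 (f : R -> R -> R) (Rs beta : R) (delta0 : R -> R) (nu0 : R -> C) :
  smooth2 f ->
  (forall x y, f x (y + 2 * PI) = f x y) ->
  (forall x y, Rs < Rabs x -> f x y = 0) ->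
  0 < beta < 1 / 2 ->
  let kappa := sqrt (1 - 2 * beta) in
  let dp := ftilde f Rs 1 kappa in
  let dm := ftilde f Rs 1 (- kappa) in
  let g0 := (1 - beta) ^ 2 / (4 * PI) in
  let Gam := g0 ^ 2 / kappa * (Cmod dp ^ 2 + Cmod dm ^ 2) in
  Gam <> 0 ->
  (* nu0 = mu0 / eps, mu0 the root of mu - eps gamma F = 0 tending to 0 *)
  (exists e0, 0 < e0 /\ forall eps, 0 < eps < e0 ->
     (RtoC eps * nu0 eps - RtoC eps * gam (RtoC eps * nu0 eps) beta
        * FF f Rs eps (RtoC eps * nu0 eps) beta = RtoC 0)%C) ->
  filterlim (fun eps => Cmod (RtoC eps * nu0 eps)%C) (at_right 0) (locally 0) ->
  (* delta0 *)
  (forall eps, 0 < eps -> 0 < delta0 eps) ->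
  filterlim (fun eps => eps * delta0 eps ^ 2) (at_right 0) (locally 0) ->
  exists K eps1, 0 < eps1 /\
    forall eps delta, 0 < eps < eps1 -> Rabs delta < delta0 eps ->
      let nu := Re (nu0 eps) + delta in
      0 < nu ->
      let mu := RtoC (eps * nu) in
      exists E1 E2 : C,
        Cmod E1 <= K * (eps + eps * delta ^ 2) /\
        Cmod E2 <= K * (eps + eps * delta ^ 2) /\
        Refl f Rs eps mu beta =
          (Wfun Gam (delta / eps) *
           (RtoC (g0 ^ 2 / kappa) * Cconj dp * dm
            + RtoC (delta * (g0 / kappa)) * Cconj (ftilde f Rs 0 (2 * kappa))
            + E1))%C /\
        Trans f Rs eps mu beta =
          (Wfun Gam (delta / eps) *
           (RtoC (delta / eps) / Ci
            + RtoC (g0 ^ 2 / (2 * kappa) * (Cmod dp ^ 2 - Cmod dm ^ 2))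
            + RtoC (delta * (g0 / kappa)) * ftilde f Rs 0 0
            + E2))%C.
Proof.
  intros Hf Hp Hs Hb kappa dp dm g0 Gam HGam [e0 [He0 Hroot]] Hmu0 Hd0 Hdl.
  assert (kp : 0 < kappa) by (apply sqrt_lt_R0; lra).
  assert (HRs : 0 < Rs).
  { destruct (Rlt_dec 0 Rs) as [H | H]; [exact H | exfalso; apply HGam].
    unfold Gam, dp, dm. rewrite !(ftilde_degenerate f Rs) by (assumption || lra).
    rewrite Cmod_0; ring. }
  assert (GamP : 0 < Gam).
  { assert (0 <= Gam); [|lra]. unfold Gam.
    assert (0 < / kappa) by (apply Rinv_0_lt_compat; lra).
    pose proof (pow2_ge_0 g0); pose proof (pow2_ge_0 (Cmod dp)); pose proof (pow2_ge_0 (Cmod dm)).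
    unfold Rdiv. apply Rmult_le_pos; [apply Rmult_le_pos|]; lra. }
  destruct (scattering_estimates f Rs beta Hf Hp Hs HRs Hb)
    as [K [e1 [m [HK [He1 [Hm [hB [hL [hI hA]]]]]]]]].
  fold kappa in hI, hA. fold dp dm g0 in hI, hA. fold Gam in hI.
  (* K is the error of Im h at the real point mu = eps; the other term pays for moving from there to
     mu0. *)
  set (K3 := K + K * (2 * K + 4) * (K + 1)).
  assert (K3K : K <= K3) by (unfold K3; nra).
  destruct (denominator_estimate K3 Gam ltac:(lra) GamP) as [C2 [e2 [HC2 [He2 hD]]]].
  (* The first term rewrites K (eps + mu^2) as a multiple of eps through mu^2 <= (2 K^2 + 2) eps; C2
     is the constant of Z / Y. *)
  set (K4 := K * (1 + (2 * K * K + 2)) + C2).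
  assert (K4p : 0 <= K4) by (unfold K4; nra).
  destruct (amplitude_estimate K4 Gam (g0 / kappa) g0 (Cconj (ftilde f Rs 0 (2 * kappa)))
    (Cconj dp) dm K4p) as [KR hR].
  destruct (amplitude_estimate K4 Gam (g0 / kappa) g0 (ftilde f Rs 0 0)
    (Cconj dp) dp K4p) as [KT hT].
  destruct (filterlim_0_small _ m Hm Hmu0) as [e3 [He3 hmu0]].
  destruct (filterlim_0_small _ 1 Rlt_0_1 Hdl) as [e4 [He4 hdl]].
  (* The thresholds: [e5] puts the comparison point mu = eps inside the disc, [e6] does the same for
     mu through its square, and [e7] makes K eps < Gam / 2, which rules out the root 0. *)
  set (e5 := m / (K + 1)). assert (He5 : 0 < e5) by (apply Rdiv_lt_0_compat; lra).
  set (e6 := m ^ 2 / (2 * K * K + 2)).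
  assert (He6 : 0 < e6) by (apply Rdiv_lt_0_compat; nra).
  set (e7 := Gam / 2 / K). assert (He7 : 0 < e7) by (apply Rdiv_lt_0_compat; lra).
  exists (Rabs KR + Rabs KT),
    (Rmin (Rmin (Rmin e0 e1) (Rmin e2 e3)) (Rmin (Rmin e4 e5) (Rmin e6 e7))).
  split; [repeat apply Rmin_pos; lra|].
  intros eps delta [Hep Hes] Hdelta nu Hnu mu.
  assert (Hlt : (eps < e0 /\ eps < e1) /\ (eps < e2 /\ eps < e3) /\ (eps < e4 /\ eps < e5) /\
    (eps < e6 /\ eps < e7)).
  { apply Rlt_gt in Hes.
    repeat match goal with H : Rmin _ _ > eps |- _ => apply Rmin_Rgt_l in H; destruct H end.
    repeat split; lra. }
  destruct Hlt as [[L0 L1] [[L2 L3] [[L4 L5] [L6 L7]]]].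
  set (n0 := nu0 eps) in *. set (mu0 := (RtoC eps * n0)%C).
  assert (Hmu0m : Cmod mu0 <= m).
  { pose proof (hmu0 eps (conj Hep L3)) as X. rewrite Rabs_pos_eq in X by apply Cmod_ge_0.
    fold n0 mu0 in X; lra. }
  assert (epsC : RtoC eps <> RtoC 0) by (intros E; apply RtoC_inj in E; lra).
  assert (En0 : n0 = hfun f Rs beta eps mu0).
  { pose proof (Hroot eps (conj Hep L0)) as X. fold n0 mu0 in X. unfold hfun.
    replace n0 with (/ RtoC eps * (RtoC eps * n0 - RtoC eps * gam mu0 beta * FF f Rs eps mu0 beta)
      + gam mu0 beta * FF f Rs eps mu0 beta)%C by (field; exact epsC).
    fold mu0 in X |- *.
    rewrite X. ring. }
  assert (He1' : 0 <= eps <= e1) by lra.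
  assert (Hn : Cmod n0 <= K) by (rewrite En0; apply hB; assumption).
  assert (Emu0 : Cmod mu0 = eps * Cmod n0)
    by (unfold mu0; rewrite Cmod_mult, Cmod_R, Rabs_pos_eq by lra; reflexivity).
  assert (Hmu0K : Cmod mu0 <= eps * K) by (rewrite Emu0; apply Rmult_le_compat_l; lra).
  assert (epsm : eps <= m).
  { assert (eps * (K + 1) <= m).
    { apply Rle_trans with (e5 * (K + 1)); [apply Rmult_le_compat_r; lra|].
      unfold e5; right; field; lra. }
    nra. }
  assert (epsG : K * eps < Gam / 2).
  { apply Rlt_le_trans with (K * e7); [apply Rmult_lt_compat_l; lra|].
    unfold e7; right; field; lra. }
  (* At [mu = 0] the junk value of [H_{-1}] is 0 instead of [-|x|/2], so that the Lipschitz bound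
     does not apply there; but [Im F] alone excludes a root at 0. *)
  assert (mu0nz : mu0 <> RtoC 0).
  { intros E. rewrite E in En0.
    assert (n00 : n0 = RtoC 0).
    { replace n0 with (/ RtoC eps * mu0)%C by (unfold mu0; field; exact epsC). rewrite E; ring. }
    pose proof (hI eps 0 He1' ltac:(lra) ltac:(lra)) as X.
    rewrite <- En0, n00 in X. simpl in X.
    rewrite <- Rabs_Ropp in X. pose proof (Rle_abs (- (0 - eps * (Gam / 2)))). nra. }
  (* The comparison point mu = eps is real, nonzero, and as small as mu0; with both of size O(eps),
     the Lipschitz bound is O(eps) times O(eps). *)
  assert (HIm : Rabs (Im n0 - eps * (Gam / 2)) <= K3 * eps ^ 2).
  { pose proof (hI eps eps He1' ltac:(lra) epsm) as X1.
    pose proof (hL eps mu0 (RtoC eps) He1' Hmu0m ltac:(rewrite Cmod_R, Rabs_pos_eq; lra)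
      mu0nz epsC) as X2.
    rewrite <- En0 in X2. rewrite (Cmod_R eps), (Rabs_pos_eq eps) in X2 by lra.
    set (he := hfun f Rs beta eps (RtoC eps)) in *.
    pose proof (im_le_Cmod (n0 - he)%C) as X3.
    change (Im (n0 - he)%C) with (Im n0 - Im he) in X3.
    assert (X4 : Cmod (mu0 - RtoC eps)%C <= eps * K + eps).
    { eapply Rle_trans; [apply Cmod_triangle_minus|]. rewrite Cmod_R, Rabs_pos_eq; lra. }
    pose proof (Cmod_ge_0 mu0). pose proof (Cmod_ge_0 (mu0 - RtoC eps)%C).
    assert (X5 : K * Cmod (mu0 - RtoC eps)%C * (Cmod mu0 + eps + eps)
      <= K * (eps * K + eps) * (eps * K + eps + eps)).
    { apply Rmult_le_compat; try lra; [apply Rmult_le_pos; lra|]. apply Rmult_le_compat_l; lra. }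
    replace (Im n0 - eps * (Gam / 2)) with ((Im n0 - Im he) + (Im he - eps * (Gam / 2))) by ring.
    eapply Rle_trans; [apply Rabs_triang|].
    assert (X6 : K * (eps * K + eps) * (eps * K + eps + eps) <= K * (2 * K + 4) * (K + 1) * eps ^ 2).
    { replace (K * (eps * K + eps) * (eps * K + eps + eps))
        with (K * (K + 1) * (K + 2) * eps ^ 2) by ring.
      apply Rmult_le_compat_r; [apply pow2_ge_0|].
      replace (K * (2 * K + 4) * (K + 1)) with (K * (K + 1) * (K + 2) * 2) by ring.
      assert (0 <= K * (K + 1) * (K + 2)) by (repeat apply Rmult_le_pos; lra). lra. }
    unfold K3. lra. }
  assert (Hed : eps * delta ^ 2 <= 1).
  { pose proof (hdl eps (conj Hep L4)) as X. pose proof (Rle_abs (eps * delta0 eps ^ 2)).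
    apply Rle_trans with (eps * delta0 eps ^ 2); [|lra].
    apply Rmult_le_compat_l; [lra|]. rewrite <- (pow2_abs delta).
    apply pow_incr; split; [apply Rabs_pos | lra]. }
  set (r := eps * nu) in *.
  assert (rp : 0 < r) by (apply Rmult_lt_0_compat; assumption).
  (* mu = eps Re nu0 + eps delta, and the square of the second summand is eps (eps delta^2) <= eps.
     So mu^2 is O(eps), although mu itself need not be. *)
  assert (r2 : r * r <= (2 * K * K + 2) * eps).
  { assert (Hre : Re n0 ^ 2 <= K ^ 2).
    { rewrite <- (pow2_abs (Re n0)). apply pow_incr; split; [apply Rabs_pos|].
      eapply Rle_trans; [apply re_le_Cmod | exact Hn]. }
    assert (Y1 : r * r <= 2 * (eps ^ 2 * Re n0 ^ 2) + 2 * (eps * (eps * delta ^ 2))).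
    { unfold r, nu. pose proof (pow2_ge_0 (eps * Re n0 - eps * delta)). nra. }
    assert (Y2 : eps ^ 2 * Re n0 ^ 2 <= eps * K ^ 2).
    { apply Rmult_le_compat; try apply pow2_ge_0; [nra | exact Hre]. }
    assert (Y3 : eps * (eps * delta ^ 2) <= eps * 1) by (apply Rmult_le_compat_l; lra).
    nra. }
  assert (rm : r <= m).
  { assert (r * r <= m ^ 2).
    { eapply Rle_trans; [exact r2|].
      apply Rle_trans with ((2 * K * K + 2) * e6); [apply Rmult_le_compat_l; nra|].
      unfold e6; right; field; nra. }
    nra. }
  assert (rmC : Cmod mu <= m) by (unfold mu; rewrite Cmod_R, Rabs_pos_eq; lra).
  assert (munz : mu <> RtoC 0) by (intros E; apply RtoC_inj in E; lra).
  set (h := hfun f Rs beta eps mu).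
  destruct (hD eps delta n0 h (conj Hep L2) Hed ltac:(lra) HIm) as [Y0 [Z0 HS]].
  { fold nu r mu mu0. rewrite En0 at 1. unfold h.
    eapply Rle_trans; [apply (hL eps mu0 mu); assumption|].
    rewrite (Cmod_minus_sym mu0 mu), (Rplus_comm (Cmod mu0)).
    pose proof (Cmod_ge_0 (mu - mu0)%C); pose proof (Cmod_ge_0 mu); pose proof (Cmod_ge_0 mu0).
    apply Rmult_le_compat_r; [lra|]. apply Rmult_le_compat_r; lra. }
  fold nu in Y0, HS.
  set (Y := (RtoC nu - h)%C) in *. set (Z := (RtoC delta - Ci * RtoC (eps * (Gam / 2)))%C) in *.
  destruct (hA eps r He1' rmC) as [k0nz [aQ [aPp [aPm [aRp [aRm [aG ag]]]]]]]. fold mu in k0nz, aQ, aPp, aPm, aRp, aRm, aG, ag.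
  assert (cl : forall a a0 : C, Cmod (a - a0)%C <= K * (eps + r * r) -> eps_close eps K4 a a0).
  { intros a a0 X. unfold eps_close. eapply Rle_trans; [exact X|].
    apply Rle_trans with (K * (1 + (2 * K * K + 2)) * eps).
    - replace (K * (1 + (2 * K * K + 2)) * eps) with (K * (eps + (2 * K * K + 2) * eps)) by ring.
      apply Rmult_le_compat_l; lra.
    - apply Rmult_le_compat_r; [lra | unfold K4; lra]. }
  assert (cS : eps_close eps K4 (Z / Y)%C (RtoC 1)).
  { unfold eps_close in *. eapply Rle_trans; [exact HS|].
    apply Rmult_le_compat_r; [lra|]. unfold K4. assert (0 <= K * (1 + (2 * K * K + 2))) by nra. lra. }
  assert (He01 : 0 <= eps <= 1) by lra.
  pose proof (hR eps delta _ _ _ _ _ _ He01 (cl _ _ aPp) (cl _ _ aQ) (cl _ _ aRp) (cl _ _ aG)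
    (cl _ _ ag) cS) as bR.
  pose proof (hT eps delta _ _ _ _ _ _ He01 (cl _ _ aPm) (cl _ _ aQ) (cl _ _ aRm) (cl _ _ aG)
    (cl _ _ ag) cS) as bT.
  fold Z in bR, bT.
  match type of bR with Cmod (?u - ?v)%C <= _ => set (XR := u) in bR; set (VR := v) in bR end.
  match type of bT with Cmod (?u - ?v)%C <= _ => set (XT := u) in bT; set (VT := v) in bT end.
  (* The remainders are taken as exact differences, so the two asymptotic formulas become field
     identities. *)
  exists (XR - VR)%C, (XT - VT)%C.
  assert (w0 : 0 <= eps + eps * delta ^ 2)
    by (apply Rplus_le_le_0_compat; [lra | apply Rmult_le_pos; [lra | apply pow2_ge_0]]).
  assert (Kup : forall k v, k <= Rabs KR + Rabs KT -> v <= k * (eps + eps * delta ^ 2) ->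
    v <= (Rabs KR + Rabs KT) * (eps + eps * delta ^ 2)).
  { intros k v Hk Hv. eapply Rle_trans; [exact Hv|]. apply Rmult_le_compat_r; assumption. }
  pose proof (Rle_abs KR); pose proof (Rle_abs KT); pose proof (Rabs_pos KR); pose proof (Rabs_pos KT).
  split; [apply (Kup KR); [lra | exact bR]|]. split; [apply (Kup KT); [lra | exact bT]|].
  assert (Ci0 : Ci <> RtoC 0) by (unfold Ci, RtoC; injection; lra).
  assert (Ci2 : (Ci * Ci = - RtoC 1)%C) by (unfold Ci, Cmult, Copp, RtoC; simpl; f_equal; ring).
  assert (EW : Wfun Gam (delta / eps) = (Ci * RtoC eps / Z)%C).
  { unfold Wfun.
    assert (EZ : (RtoC (delta / eps) - Ci * RtoC (Gam / 2))%C = (Z / RtoC eps)%C).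
    { unfold Z. rewrite RtoC_div, RtoC_mult by lra. field. exact epsC. }
    rewrite EZ. field. auto. }
  assert (ED : (mu - RtoC eps * gam mu beta * FF f Rs eps mu beta)%C = (RtoC eps * Y)%C).
  { unfold Y, h, hfun, mu, r. rewrite RtoC_mult; ring. }
  split.
  - replace (RtoC (g0 ^ 2 / kappa) * Cconj dp * dm
       + RtoC (delta * (g0 / kappa)) * Cconj (ftilde f Rs 0 (2 * kappa)) + (XR - VR))%C with XR.
    + unfold Refl. rewrite EW, ED. unfold XR. field. auto.
    + unfold VR. replace (g0 ^ 2 / kappa) with (g0 / kappa * g0) by (field; lra). ring.
  (* The constant 1 in T is W times Z / (i eps), and Z / (i eps) = delta / (i eps) - Gam / 2.
     Subtracting Gam / 2 from (g0^2 / kappa) |d_+|^2 leaves half the difference of the squares. *)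
  - replace (RtoC (delta / eps) / Ci + RtoC (g0 ^ 2 / (2 * kappa) * (Cmod dp ^ 2 - Cmod dm ^ 2))
       + RtoC (delta * (g0 / kappa)) * ftilde f Rs 0 0 + (XT - VT))%C
      with (Z / (Ci * RtoC eps) + XT)%C.
    + unfold Trans. rewrite EW, ED. unfold XT. field. auto.
    + assert (EZ : (Z / (Ci * RtoC eps))%C = (RtoC (delta / eps) / Ci - RtoC (Gam / 2))%C).
      { unfold Z. rewrite RtoC_div, RtoC_mult by lra. field. auto. }
      assert (EG : (RtoC (Gam / 2))%C
        = (RtoC (g0 / kappa * g0) * (Cconj dp * dp)
           - RtoC (g0 ^ 2 / (2 * kappa) * (Cmod dp ^ 2 - Cmod dm ^ 2)))%C).
      { rewrite (Cmult_comm (Cconj dp)), <- Cmod2_conj.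
        rewrite <- RtoC_mult, <- RtoC_minus. f_equal. unfold Gam; field; lra. }
      rewrite EZ, EG. unfold VT. ring.
Qed.
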